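(* Let $\mathcal{F}$ be a codimension one distribution of degree $d$ on $\mathbb{P}^3$ such that $t_{\mathcal{F}}=1$. Then one of the following holds: 1. $T_{\mathcal{F}}\cong\mathcal{O}_{\mathbb{P}^3}\oplus\mathcal{O}_{\mathbb{P}^3}(2-d)$ with $d\geq 2$; or 2. $T_{\mathcal{F}}$ has Chern classes $(c_1,c_2,c_3)=(2-d,1,d)$ with $d\geq 1$; or 3. $T_{\mathcal{F}}$ has Chern classes $(c_1,c_2,c_3)=(2-d,2,2d)$ with $d\geq 0$.
   Context: Work over $\mathbb{C}$. A codimension one distribution $\mathcal{F}$ of degree $d\ge 0$ on $\mathbb{P}^3$ is an exact sequence $0\to T_{\mathcal{F}}\to T\mathbb{P}^3\to \mathcal{I}_Z(d+2)\to 0$, where $T_{\mathcal{F}}$ (the tangent sheaf) is a rank 2 reflexive sheaf and $\mathcal{I}_Z$ is the ideal sheaf of a closed subscheme $Z=\mathrm{Sing}(\mathcal{F})$ of codimension at least 2. Define $t_{\mathcal{F}}:=\min\{k\in\mathbb{Z}: H^0(T_{\mathcal{F}}(k-1))\neq 0\}$. *)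

(* Defs.v *)
From HB Require Import structures.
From mathcomp Require Import all_boot all_order all_algebra.
From mathcomp Require Import boolp classical_sets reals complex.
From mathcomp Require Import mpoly zify.

Set Implicit Arguments.
Unset Strict Implicit.
Unset Printing Implicit Defensive.

Import GRing.Theory.
Local Open Scope ring_scope.

(* Sheaves on P^3 over an algebraically closed field K, with P^3 seen as a     *)
(* variety: closed points, Zariski topology, sheaf of regular functions.       *)

Section ProjectiveSpace.
Variable K : closedFieldType.

(* Points of P^3 are given by homogeneous coordinates.  Two proportional       *)
(* vectors are different terms of type point, but they are never separated by  *)
(* an open set, so that subsets of P^3 are handled through their affine cones. *)
Definition point := {x : 'I_4 -> K | [exists i, x i != 0]}.

Definition peval (p : {mpoly K[4]}) (x : point) : K := p.@[sval x].

Definition homogeneous (p : {mpoly K[4]}) := exists n, p \is n.-homog.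

Definition zariski_closed (Z : set point) :=
  exists2 S : set {mpoly K[4]}, (forall p, S p -> homogeneous p) &
    forall x, Z x <-> forall p, S p -> peval p x = 0.

Record opens := Opens {
  opens_set :> point -> Prop;
  opensP : zariski_closed (fun x => ~ opens_set x) }.

Definition sub_opens (V U : opens) := forall x, V x -> U x.
Local Notation "V <<= U" := (sub_opens V U) (at level 70).

Lemma subO_refl U : U <<= U. Proof. by []. Qed.

Lemma subO_trans U V W : W <<= V -> V <<= U -> W <<= U.
Proof. by move=> WV VU x /WV /VU. Qed.

Lemma P3_subproof : zariski_closed (fun x => ~ (setT : set point) x).
Proof.
exists (fun p => p = 1); first by move=> p ->; exists 0%N; exact: dhomog1.
move=> x; split=> [[]//|/(_ 1 erefl)].
by rewrite /peval meval1 => /eqP; rewrite oner_eq0.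
Qed.

Definition P3 : opens := Opens P3_subproof.

Lemma subP3 U : U <<= P3. Proof. by []. Qed.

Lemma capO_subproof (U V : opens) :
  zariski_closed (fun x => ~ (fun y => U y /\ V y) x).
Proof.
case: (opensP U) (opensP V) => [S hS SE] [T hT TE].
exists (fun r => exists p q, [/\ S p, T q & r = p * q]).
  move=> _ [p [q [/hS [m hm] /hT [n hn] ->]]].
  by exists (m + n)%N; apply: dhomogM.
move=> x; split=> [nUV _ [p [q [Sp Tq ->]]]|zST [Ux Vx]].
  rewrite /peval mevalM; have [Ux|/SE/(_ p Sp)] := pselect (U x); last first.
    by rewrite /peval => ->; rewrite mul0r.
  have /TE/(_ q Tq) : ~ V x by move=> Vx; apply: nUV.
  by rewrite /peval => ->; rewrite mulr0.
have [p Sp /eqP p0] : exists2 p, S p & peval p x <> 0.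
  apply: contrapT => nS; suff : ~ U x by [].
  by apply/SE => p Sp; apply: contrapT => p0; apply: nS; exists p.
have [q Tq /eqP q0] : exists2 q, T q & peval q x <> 0.
  apply: contrapT => nT; suff : ~ V x by [].
  by apply/TE => q Tq; apply: contrapT => q0; apply: nT; exists q.
have /eqP : peval (p * q) x = 0 by apply: zST; exists p, q.
by rewrite /peval mevalM mulf_eq0 (negPf p0) (negPf q0).
Qed.

Definition capO (U V : opens) : opens := Opens (capO_subproof U V).

Lemma capO_subl U V : capO U V <<= U. Proof. by move=> x []. Qed.
Lemma capO_subr U V : capO U V <<= V. Proof. by move=> x []. Qed.

(* Sections of O(k) over U: functions on the cone of U which are locally a     *)
(* quotient of homogeneous polynomials with difference of degrees k.           *)
Definition regular_of_degree (k : int) (U : opens) (s : {x | U x} -> K) :=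
  forall x, U x -> exists (V : opens) (p q : {mpoly K[4]}) (m n : nat),
    [/\ V <<= U, V x, p \is m.-homog, q \is n.-homog & m%:Z = n%:Z + k] /\
    forall y (Uy : U y), V y ->
      peval q y != 0 /\ s (exist _ y Uy) = peval p y / peval q y.

Record twfun (k : int) (U : opens) := TwFun {
  twval :> {x | U x} -> K;
  twvalP : regular_of_degree k twval }.

Lemma twfun_ext k U (s t : twfun k U) : (forall x, s x = t x) -> s = t.
Proof.
case: s t => [s sP] [t tP] /= /funext st; case: _ / st tP => tP.
by congr TwFun; exact: Prop_irrelevance.
Qed.

Lemma regularC U (c : K) : @regular_of_degree 0 U (fun=> c).
Proof.
move=> x Ux; exists U, c%:MP, 1, 0%N, 0%N; split.
  split=> //; last exact: dhomog1.
  by rewrite -[c%:MP]mulr1 mul_mpolyC dhomogZ ?dhomog1.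
by move=> y Uy _; rewrite /peval mevalC meval1 oner_eq0 divr1.
Qed.

Lemma regular0 k U : @regular_of_degree k U (fun=> 0).
Proof.
move=> x Ux.
have /existsP [i xi] := svalP x.
have [V [VU Vx Vi]] : exists V : opens,
    [/\ V <<= U, V x & forall y, V y -> peval 'X_i y != 0].
  have Di : zariski_closed (fun y => ~ (fun y => peval 'X_i y != 0) y).
    exists (fun p => p = 'X_i).
      by move=> p ->; exists 1%N; rewrite dhomogX /= mdeg1.
    move=> y; split=> [/negP/negPn/eqP y0 p -> //|/(_ _ erefl) ->].
    by rewrite eqxx.
  exists (capO U (Opens Di)); split=> [|| y []//]; first exact: capO_subl.
  by split=> //=; rewrite /peval mevalXU.
exists V, 0, ('X_i ^+ absz k), (absz ((absz k)%:Z + k)), (absz k); split.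
  split=> //; first exact: dhomog0.
    by rewrite -[X in X.-homog]mul1n dhomogMn // dhomogX /= mdeg1.
  by rewrite gez0_abs //; lia.
move=> y Uy Vy; rewrite /peval rmorphXn /= expf_neq0; last exact: Vi.
by rewrite raddf0 mul0r.
Qed.

Lemma regularD k U (s t : twfun k U) :
  regular_of_degree k (fun x => s x + t x).
Proof.
move=> x Ux.
have [V [p [q [m [n [[VU Vx hp hq mn] hs]]]]]] := twvalP s Ux.
have [W [p' [q' [m' [n' [[WU Wx hp' hq' mn'] ht]]]]]] := twvalP t Ux.
exists (capO V W), (p * q' + p' * q), (q * q'), (m + n')%N, (n + n')%N; split.
  split=> //; first by apply: subO_trans VU; exact: capO_subl.
  - have e : (m + n' = m' + n)%N by lia.
    by apply: rpredD; [|rewrite e]; exact: dhomogM.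
  - exact: dhomogM.
  - by rewrite !PoszD mn addrAC.
move=> y Uy [/(hs _ Uy) [qy ->] /(ht _ Uy) [q'y ->]].
move: qy q'y; rewrite /peval mevalM mevalD !mevalM => qy q'y.
by rewrite mulf_neq0 // addf_div.
Qed.

Lemma regularM k l U (s : twfun k U) (t : twfun l U) :
  regular_of_degree (k + l) (fun x => s x * t x).
Proof.
move=> x Ux.
have [V [p [q [m [n [[VU Vx hp hq mn] hs]]]]]] := twvalP s Ux.
have [W [p' [q' [m' [n' [[WU Wx hp' hq' mn'] ht]]]]]] := twvalP t Ux.
exists (capO V W), (p * p'), (q * q'), (m + m')%N, (n + n')%N; split.
  split=> //; first by apply: subO_trans VU; exact: capO_subl.
  - exact: dhomogM.
  - exact: dhomogM.
  - by rewrite !PoszD mn mn' addrACA.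
move=> y Uy [/(hs _ Uy) [qy ->] /(ht _ Uy) [q'y ->]].
by move: qy q'y; rewrite /peval !mevalM => qy q'y; rewrite mulf_neq0 // mulf_div.
Qed.

Lemma regularZ k U (f : twfun 0 U) (s : twfun k U) :
  regular_of_degree k (fun x => f x * s x).
Proof. by have := regularM f s; rewrite add0r. Qed.

Lemma regularN k U (s : twfun k U) : regular_of_degree k (fun x => - s x).
Proof.
have -> : (fun x => - s x) = (fun x => TwFun (regularC (-1)) x * s x).
  by apply/funext => x /=; rewrite mulN1r.
exact: regularZ.
Qed.

HB.instance Definition _ k U := gen_eqMixin (twfun k U).
HB.instance Definition _ k U := gen_choiceMixin (twfun k U).

Section TwFunZmod.
Variables (k : int) (U : opens).
Let zero : twfun k U := TwFun (@regular0 k U).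
Let opp (s : twfun k U) : twfun k U := TwFun (regularN s).
Let add (s t : twfun k U) : twfun k U := TwFun (regularD s t).
Fact tw_addA : associative add.
Proof. by move=> r s t; apply: twfun_ext => x /=; rewrite addrA. Qed.
Fact tw_addC : commutative add.
Proof. by move=> s t; apply: twfun_ext => x /=; rewrite addrC. Qed.
Fact tw_add0 : left_id zero add.
Proof. by move=> s; apply: twfun_ext => x /=; rewrite add0r. Qed.
Fact tw_addN : left_inverse zero opp add.
Proof. by move=> s; apply: twfun_ext => x /=; rewrite addNr. Qed.
HB.instance Definition _ :=
  GRing.isZmodule.Build (twfun k U) tw_addA tw_addC tw_add0 tw_addN.
End TwFunZmod.

(* The ring O(U).  It is the zero ring when U is empty. *)
Definition regfun (U : opens) : Type := twfun 0 U.

HB.instance Definition _ U := GRing.Zmodule.on (regfun U).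

Definition regfunC U (c : K) : regfun U := TwFun (@regularC U c).

Section RegFunRing.
Variable U : opens.
Let one : regfun U := regfunC U 1.
Let mul (f g : regfun U) : regfun U := TwFun (regularZ f g).
Fact reg_mulA : associative mul.
Proof. by move=> f g h; apply: twfun_ext => x /=; rewrite mulrA. Qed.
Fact reg_mulC : commutative mul.
Proof. by move=> f g; apply: twfun_ext => x /=; rewrite mulrC. Qed.
Fact reg_mul1 : left_id one mul.
Proof. by move=> f; apply: twfun_ext => x /=; rewrite mul1r. Qed.
Fact reg_mulDl : left_distributive mul +%R.
Proof. by move=> f g h; apply: twfun_ext => x /=; rewrite mulrDl. Qed.
HB.instance Definition _ := GRing.Zmodule_isComPzRing.Build (regfun U)
  reg_mulA reg_mulC reg_mul1 reg_mulDl.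
End RegFunRing.

Section TwFunLmod.
Variables (k : int) (U : opens).
Let scale (f : regfun U) (s : twfun k U) : twfun k U := TwFun (regularZ f s).
Fact tw_scaleA f g s : scale f (scale g s) = scale (f * g) s.
Proof. by apply: twfun_ext => x /=; rewrite mulrA. Qed.
Fact tw_scale1 : left_id 1 scale.
Proof. by move=> s; apply: twfun_ext => x /=; rewrite mul1r. Qed.
Fact tw_scaleDr : right_distributive scale +%R.
Proof. by move=> f s t; apply: twfun_ext => x /=; rewrite mulrDr. Qed.
Fact tw_scaleDl s : {morph scale^~ s : f g / f + g}.
Proof. by move=> f g; apply: twfun_ext => x /=; rewrite mulrDl. Qed.
HB.instance Definition _ := GRing.Zmodule_isLmodule.Build (regfun U) (twfun k U)
  tw_scaleA tw_scale1 tw_scaleDr tw_scaleDl.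
End TwFunLmod.

Lemma regular_res k U V (VU : V <<= U) (s : twfun k U) :
  regular_of_degree k
    (fun x : {x | V x} => s (exist _ (sval x) (VU _ (svalP x)))).
Proof.
move=> x Vx.
have [W [p [q [m [n [[WU Wx hp hq mn] hs]]]]]] := twvalP s (VU _ Vx).
exists (capO V W), p, q, m, n; split; first by split=> //; exact: capO_subl.
by move=> y Vy [_ Wy] /=; apply: hs.
Qed.

Definition twres k U V (VU : V <<= U) (s : twfun k U) : twfun k V :=
  TwFun (regular_res VU s).

Definition regres U V (VU : V <<= U) (f : regfun U) : regfun V := twres VU f.

Record sheaf := Sheaf {
  sec :> forall U : opens, lmodType (regfun U);
  res : forall U V : opens, V <<= U -> sec U -> sec V;
  resD : forall U V (VU : V <<= U) s t, res VU (s + t) = res VU s + res VU t;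
  resZ : forall U V (VU : V <<= U) f s,
    res VU (f *: s) = regres VU f *: res VU s;
  res_id : forall U (UU : U <<= U) s, res UU s = s;
  res_comp : forall U V W (VU : V <<= U) (WV : W <<= V) (WU : W <<= U) s,
    res WV (res VU s) = res WU s;
  sheaf_sep : forall U (s t : sec U),
    (forall x, U x -> exists V (VU : V <<= U), V x /\ res VU s = res VU t) ->
    s = t;
  sheaf_glue : forall U (I : Type) (V : I -> opens) (VU : forall i, V i <<= U)
      (s : forall i, sec (V i)),
    (forall x, U x -> exists i, V i x) ->
    (forall i j W (Wi : W <<= V i) (Wj : W <<= V j),
      res Wi (s i) = res Wj (s j)) ->
    exists t, forall i, res (VU i) t = s i }.

Arguments res {_ U V}.

Section ResTheory.
Variable F : sheaf.
Lemma res0 U V (VU : V <<= U) : res VU (0 : F U) = 0.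
Proof. by apply: (addrI (res VU 0)); rewrite -resD !addr0. Qed.
End ResTheory.

Section LineBundle.
Variable k : int.

Fact tw_resD U V (VU : V <<= U) (s t : twfun k U) :
  twres VU (s + t) = twres VU s + twres VU t.
Proof. exact: twfun_ext. Qed.

Fact tw_resZ U V (VU : V <<= U) (f : regfun U) (s : twfun k U) :
  twres VU (f *: s) = regres VU f *: twres VU s.
Proof. exact: twfun_ext. Qed.

Lemma twvalE U (s : twfun k U) x (p q : U x) :
  s (exist _ x p) = s (exist _ x q).
Proof. by congr (s (exist _ _ _)); exact: Prop_irrelevance. Qed.

Fact tw_res_id U (UU : U <<= U) (s : twfun k U) : twres UU s = s.
Proof. by apply: twfun_ext => -[x Ux] /=; exact: twvalE. Qed.

Fact tw_res_comp U V W (VU : V <<= U) (WV : W <<= V) (WU : W <<= U)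
  (s : twfun k U) : twres WV (twres VU s) = twres WU s.
Proof. by apply: twfun_ext => -[x Ux] /=; exact: twvalE. Qed.

Fact tw_sep U (s t : twfun k U) :
  (forall x, U x -> exists V (VU : V <<= U), V x /\ twres VU s = twres VU t) ->
  s = t.
Proof.
move=> st; apply: twfun_ext => -[x Ux].
have [V [VU [Vx]]] := st _ Ux.
move=> /(congr1 (fun r : twfun k V => r (exist _ x Vx))) /=.
by rewrite (twvalE s _ Ux) (twvalE t _ Ux).
Qed.

Fact tw_glue U (I : Type) (V : I -> opens) (VU : forall i, V i <<= U)
    (s : forall i, twfun k (V i)) :
  (forall x, U x -> exists i, V i x) ->
  (forall i j W (Wi : W <<= V i) (Wj : W <<= V j),
    twres Wi (s i) = twres Wj (s j)) ->
  exists t : twfun k U, forall i, twres (VU i) t = s i.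
Proof.
move=> cov comp.
pose i0 (x : {x | U x}) := cid (cov _ (svalP x)).
pose t (x : {x | U x}) := s (sval (i0 x)) (exist _ (sval x) (svalP (i0 x))).
have tE i x (Ux : U x) (Vx : V i x) : t (exist _ x Ux) = s i (exist _ x Vx).
  rewrite /t; case: (i0 _) => j /= Vjx.
  have := comp j i _ (@capO_subl (V j) (V i)) (@capO_subr (V j) (V i)).
  move=> /(congr1 (fun r : twfun k (capO (V j) (V i)) =>
    r (exist _ x (conj Vjx Vx)))) /=.
  move=> e; apply: etrans (etrans _ e) _; exact: twvalE.
have tP : regular_of_degree k t.
  move=> x Ux; have [i Vx] := cov _ Ux.
  have [W [p [q [m [n [[WV Wx hp hq mn] hs]]]]]] := twvalP (s i) Vx.
  exists W, p, q, m, n; split; first by split=> //; exact: subO_trans (VU i).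
  by move=> y Uy Wy; rewrite (tE i _ _ (WV _ Wy)); exact: hs.
by exists (TwFun tP) => i; apply: twfun_ext => -[x Vx]; exact: tE.
Qed.

Definition lineb : sheaf :=
  Sheaf tw_resD tw_resZ tw_res_id tw_res_comp tw_sep tw_glue.

End LineBundle.

(* Sheaves of operators: an element of op C U is a family of maps              *)
(* F(V) -> G(V), for V contained in U, which is compatible with restrictions   *)
(* and whose members satisfy C.  This is used for sheaf Hom and for the sheaf  *)
(* of derivations.                                                             *)

Record opcond (F G : sheaf) := OpCond {
  cond :> forall V : opens, (F V -> G V) -> Prop;
  cond0 : forall V, cond (fun _ : F V => 0);
  condD : forall V (a b : F V -> G V),
    cond a -> cond b -> cond (fun s => a s + b s);
  condZ : forall V f (a : F V -> G V), cond a -> cond (fun s => f *: a s);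
  cond_local : forall V (a : F V -> G V),
    (forall x, V x -> exists W (WV : W <<= V) (b : F W -> G W),
      [/\ W x, cond b & forall s, res WV (a s) = b (res WV s)]) -> cond a }.

Record op (F G : sheaf) (C : opcond F G) (U : opens) := Op {
  opval :> forall V, V <<= U -> F V -> G V;
  op_res : forall V W (VU : V <<= U) (WV : W <<= V) (WU : W <<= U) s,
    res WV (opval VU s) = opval WU (res WV s);
  opP : forall V (VU : V <<= U), C V (opval VU) }.

Section OpSheaf.
Variables (F G : sheaf) (C : opcond F G).

Lemma op_ext U (a b : op C U) : (forall V VU s, @a V VU s = @b V VU s) -> a = b.
Proof.
case: a b => [a ar aP] [b br bP] /= ab.
have {}ab : a = b.
  by apply: functional_extensionality_dep => V; apply/funext => VU; apply/funext.
by case: _ / ab br bP => br bP; congr Op; exact: Prop_irrelevance.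
Qed.

HB.instance Definition _ U := gen_eqMixin (op C U).
HB.instance Definition _ U := gen_choiceMixin (op C U).

Section OpLmod.
Variable U : opens.
Implicit Types a b : op C U.

Program Definition op_zero : op C U := @Op _ _ _ _ (fun V _ _ => 0) _ _.
Next Obligation. by rewrite res0. Qed.
Next Obligation. exact: cond0. Qed.

Program Definition op_add a b : op C U :=
  @Op _ _ _ _ (fun V VU s => a V VU s + b V VU s) _ _.
Next Obligation. by rewrite resD !(op_res _ _ _ WU). Qed.
Next Obligation. by apply: condD; exact: opP. Qed.

Program Definition op_scale (f : regfun U) a : op C U :=
  @Op _ _ _ _ (fun V VU s => regres VU f *: a V VU s) _ _.
Next Obligation.
by rewrite resZ (op_res _ _ _ WU); congr (_ *: _); exact: tw_res_comp.
Qed.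
Next Obligation. by apply: condZ; exact: opP. Qed.

Let opp a := op_scale (-1) a.

Fact regres1 V (VU : V <<= U) : regres VU 1 = 1.
Proof. exact: twfun_ext. Qed.
Fact regresM V (VU : V <<= U) f g : regres VU (f * g) = regres VU f * regres VU g.
Proof. exact: twfun_ext. Qed.
Fact regresD V (VU : V <<= U) f g : regres VU (f + g) = regres VU f + regres VU g.
Proof. exact: twfun_ext. Qed.
Fact regresN1 V (VU : V <<= U) : regres VU (-1) = -1.
Proof. exact: twfun_ext. Qed.

Fact op_addA : associative op_add.
Proof. by move=> a b c; apply: op_ext => V VU s /=; rewrite addrA. Qed.
Fact op_addC : commutative op_add.
Proof. by move=> a b; apply: op_ext => V VU s /=; rewrite addrC. Qed.
Fact op_add0 : left_id op_zero op_add.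
Proof. by move=> a; apply: op_ext => V VU s /=; rewrite add0r. Qed.
Fact op_addN : left_inverse op_zero opp op_add.
Proof.
by move=> a; apply: op_ext => V VU s /=; rewrite regresN1 scaleN1r addNr.
Qed.
HB.instance Definition _ :=
  GRing.isZmodule.Build (op C U) op_addA op_addC op_add0 op_addN.

Fact op_scaleA f g a : op_scale f (op_scale g a) = op_scale (f * g) a.
Proof. by apply: op_ext => V VU s /=; rewrite regresM scalerA. Qed.
Fact op_scale1 : left_id 1 op_scale.
Proof. by move=> a; apply: op_ext => V VU s /=; rewrite regres1 scale1r. Qed.
Fact op_scaleDr : right_distributive op_scale +%R.
Proof. by move=> f a b; apply: op_ext => V VU s /=; rewrite scalerDr. Qed.
Fact op_scaleDl a : {morph op_scale^~ a : f g / f + g}.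
Proof. by move=> f g; apply: op_ext => V VU s /=; rewrite regresD scalerDl. Qed.
HB.instance Definition _ := GRing.Zmodule_isLmodule.Build (regfun U) (op C U)
  op_scaleA op_scale1 op_scaleDr op_scaleDl.
End OpLmod.

Program Definition opres U V (VU : V <<= U) (a : op C U) : op C V :=
  @Op _ _ _ _ (fun W WV s => a W (subO_trans WV VU) s) _ _.
Next Obligation. exact: op_res. Qed.
Next Obligation. exact: opP. Qed.

Lemma opvalE U (a : op C U) V (p q : V <<= U) s : a V p s = a V q s.
Proof. by congr (a V _ s); exact: Prop_irrelevance. Qed.

Fact op_resD U V (VU : V <<= U) (a b : op C U) :
  opres VU (a + b) = opres VU a + opres VU b.
Proof. exact: op_ext. Qed.

Fact op_resZ U V (VU : V <<= U) (f : regfun U) (a : op C U) :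
  opres VU (f *: a) = regres VU f *: opres VU a.
Proof.
by apply: op_ext => W WV s /=; congr (_ *: _); symmetry; exact: tw_res_comp.
Qed.

Fact op_res_id U (UU : U <<= U) (a : op C U) : opres UU a = a.
Proof. by apply: op_ext => V VU s /=; exact: opvalE. Qed.

Fact op_res_comp U V W (VU : V <<= U) (WV : W <<= V) (WU : W <<= U)
  (a : op C U) : opres WV (opres VU a) = opres WU a.
Proof. by apply: op_ext => Y YW s /=; exact: opvalE. Qed.

Fact op_sep U (a b : op C U) :
  (forall x, U x -> exists V (VU : V <<= U), V x /\ opres VU a = opres VU b) ->
  a = b.
Proof.
move=> ab; apply: op_ext => W WU s; apply: sheaf_sep => x Wx.
have [V [VU [Vx abV]]] := ab _ (WU _ Wx).
have IU : capO W V <<= U := subO_trans (@capO_subl W V) WU.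
exists (capO W V), (@capO_subl W V); split=> //.
rewrite !(op_res _ _ _ IU).
move/(congr1 (fun c : op C V => c _ (@capO_subr W V) (res (@capO_subl W V) s))): abV.
by move=> /=; rewrite (opvalE a _ IU) (opvalE b _ IU).
Qed.

Fact op_glue U (I : Type) (V : I -> opens) (VU : forall i, V i <<= U)
    (a : forall i, op C (V i)) :
  (forall x, U x -> exists i, V i x) ->
  (forall i j W (Wi : W <<= V i) (Wj : W <<= V j),
    opres Wi (a i) = opres Wj (a j)) ->
  exists b : op C U, forall i, opres (VU i) b = a i.
Proof.
move=> cov comp.
have aE i j Y (Yi : Y <<= V i) (Yj : Y <<= V j) s : a i Y Yi s = a j Y Yj s.
  have /(congr1 (fun c : op C Y => c _ (@subO_refl Y) s)) := comp i j Y Yi Yj.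
  by move=> /=; rewrite (opvalE (a i) _ Yi) (opvalE (a j) _ Yj).
have ex W (WU : W <<= U) (s : F W) : exists t : G W,
    forall i Y (YW : Y <<= W) (Yi : Y <<= V i), res YW t = a i Y Yi (res YW s).
  have [||t tE] := @sheaf_glue G W I (fun i => capO W (V i))
     (fun i => @capO_subl W (V i))
     (fun i => a i _ (@capO_subr W (V i)) (res (@capO_subl W (V i)) s)).
  - by move=> x Wx; have [i Vx] := cov _ (WU _ Wx); exists i.
  - move=> i j Y Yi Yj; have Y1 := subO_trans Yi (@capO_subr _ _).
    have Y2 := subO_trans Yj (@capO_subr _ _).
    have YW := subO_trans Yi (@capO_subl _ _).
    by rewrite (op_res _ _ _ Y1) (op_res _ _ _ Y2) !(res_comp _ _ YW) (aE i j _ Y1 Y2).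
  exists t => i Y YW Yi.
  have YI : Y <<= capO W (V i) by move=> y Yy; split; [exact: YW|exact: Yi].
  by rewrite -(res_comp (@capO_subl _ _) YI) tE (op_res _ _ _ Yi) (res_comp _ _ YW).
pose b W (WU : W <<= U) (s : F W) := sval (cid (ex W WU s)).
have bE W (WU : W <<= U) s i Y (YW : Y <<= W) (Yi : Y <<= V i) :
  res YW (b W WU s) = a i Y Yi (res YW s) := svalP (cid (ex W WU s)) i Y YW Yi.
have bres W Y (WU : W <<= U) (YW : Y <<= W) (YU : Y <<= U) s :
    res YW (b W WU s) = b Y YU (res YW s).
  apply: sheaf_sep => x Yx; have [i Vx] := cov _ (YU _ Yx).
  exists (capO Y (V i)), (@capO_subl Y (V i)); split=> //.
  have YW' := subO_trans (@capO_subl Y (V i)) YW.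
  rewrite (res_comp _ _ YW') !(bE _ _ _ i _ _ (@capO_subr Y (V i))).
  by rewrite (res_comp _ _ YW').
have bC W (WU : W <<= U) : C W (b W WU).
  apply: cond_local => x Wx; have [i Vx] := cov _ (WU _ Wx).
  exists (capO W (V i)), (@capO_subl W (V i)), (a i _ (@capO_subr W (V i))).
  by split=> [||s]; [split|exact: opP|exact: bE].
exists (Op bres bC) => i; apply: op_ext => W WV s /=.
by rewrite -[LHS](res_id (@subO_refl W)) (bE _ _ _ i _ _ WV) res_id.
Qed.

Definition opsheaf : sheaf :=
  Sheaf op_resD op_resZ op_res_id op_res_comp op_sep op_glue.

End OpSheaf.

Definition is_linear (F G : sheaf) V (a : F V -> G V) :=
  (forall s t, a (s + t) = a s + a t) /\ (forall f s, a (f *: s) = f *: a s).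

Local Obligation Tactic := idtac.

Section SheafHom.
Variables F G : sheaf.

Program Definition linear_cond : opcond F G :=
  @OpCond F G (fun V => @is_linear F G V) _ _ _ _.
Next Obligation. by move=> V; split=> *; rewrite ?addr0 ?scaler0. Qed.
Next Obligation.
move=> V a b [aD aZ] [bD bZ]; split=> [s t|f s]; first by rewrite aD bD addrACA.
by rewrite aZ bZ scalerDr.
Qed.
Next Obligation.
move=> V f a [aD aZ]; split=> [s t|g s]; first by rewrite aD scalerDr.
by rewrite aZ !scalerA mulrC.
Qed.
Next Obligation.
move=> V a aP; split=> [s t|f s]; apply: sheaf_sep => x.
  move=> /aP [W [WV [b [Wx [bD _] ab]]]]; exists W, WV; split=> //.
  by rewrite resD !ab resD bD.
move=> /aP [W [WV [b [Wx [_ bZ] ab]]]]; exists W, WV; split=> //.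
by rewrite resZ !ab resZ bZ.
Qed.

Definition sheaf_hom : sheaf := opsheaf linear_cond.

(* Morphisms of O-modules from F to G are the global sections of Hom(F, G).    *)
Definition mor := op linear_cond P3.

Definition app (a : mor) U (s : F U) : G U := a U (@subP3 U) s.

End SheafHom.

(* The tangent sheaf is the sheaf of K-linear derivations of O.                *)

Definition is_derivation V (a : lineb 0 V -> lineb 0 V) :=
  [/\ forall f g, a (f + g) = a f + a g,
      forall f g : regfun V, a (f * g) = f *: a g + g *: a f &
      forall c, a (regfunC V c) = 0].

Section Tangent.
Let O := lineb 0.

Program Definition derivation_cond : opcond O O :=
  @OpCond O O (fun V => @is_derivation V) _ _ _ _.
Next Obligation. by move=> V; split=> *; rewrite ?scaler0 ?addr0. Qed.
Next Obligation.
move=> V a b [aD aM aC] [bD bM bC]; split=> [f g|f g|c].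
- by rewrite aD bD addrACA.
- by rewrite aM bM !scalerDr addrACA.
- by rewrite aC bC addr0.
Qed.
Next Obligation.
move=> V h a [aD aM aC]; split=> [f g|f g|c].
- by rewrite aD scalerDr.
- by rewrite aM scalerDr !scalerA ![h * _]mulrC.
- by rewrite aC scaler0.
Qed.
Next Obligation.
move=> V a aP; split=> [f g|f g|c]; apply: (@sheaf_sep O) => x;
  move=> /aP [W [WV [b [Wx [bD bM bC] ab]]]]; exists W, WV; split=> //.
- by rewrite resD !ab resD bD.
- rewrite resD !resZ !ab -bM; congr (b _).
  exact: twfun_ext.
- rewrite ab (res0 O) -(bC c); congr (b _).
  exact: twfun_ext.
Qed.

Definition tangent_sheaf : sheaf := opsheaf derivation_cond.
End Tangent.

(* F(k): as O(k) is invertible with dual O(-k), the tensor product of F and    *)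
(* O(k) is Hom(O(-k), F).                                                      *)
Definition twist (F : sheaf) (k : int) : sheaf := sheaf_hom (lineb (- k)) F.

Definition dual (F : sheaf) : sheaf := sheaf_hom F (lineb 0).

Program Definition biduality (F : sheaf) U (s : F U) : dual (dual F) U :=
  @Op (dual F) (lineb 0) _ _
    (fun V VU (a : op (linear_cond F (lineb 0)) V) =>
       a V (@subO_refl V) (res VU s)) _ _.
Next Obligation.
move=> F U s V W VU WV WU a.
rewrite (op_res _ _ _ WV) (res_comp _ _ WU) /=.
by congr (opval a _ _); exact: Prop_irrelevance.
Qed.
Next Obligation.
move=> F U s V VU; split=> [a b|f a] //=.
by congr (_ *: _); exact: tw_res_id.
Qed.

Section DirectSum.
Variables F G : sheaf.
Let S (U : opens) : lmodType (regfun U) := (F U * G U)%type.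
Let sres U V (VU : V <<= U) (s : S U) : S V := (res VU s.1, res VU s.2).

Fact ds_resD U V (VU : V <<= U) (s t : S U) :
  sres VU (s + t) = sres VU s + sres VU t.
Proof. by rewrite /sres !resD. Qed.

Fact ds_resZ U V (VU : V <<= U) (f : regfun U) (s : S U) :
  sres VU (f *: s) = regres VU f *: sres VU s.
Proof. by rewrite /sres !resZ. Qed.

Fact ds_res_id U (UU : U <<= U) (s : S U) : sres UU s = s.
Proof. by case: s => s t; rewrite /sres !res_id. Qed.

Fact ds_res_comp U V W (VU : V <<= U) (WV : W <<= V) (WU : W <<= U) (s : S U) :
  sres WV (sres VU s) = sres WU s.
Proof. by rewrite /sres !(res_comp _ _ WU). Qed.

Fact ds_sep U (s t : S U) :
  (forall x, U x -> exists V (VU : V <<= U), V x /\ sres VU s = sres VU t) ->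
  s = t.
Proof.
case: s t => [s s'] [t t'] st.
congr (_, _); apply: sheaf_sep => x /st [V [VU [Vx [e1 e2]]]].
  by exists V, VU.
by exists V, VU.
Qed.

Fact ds_glue U (I : Type) (V : I -> opens) (VU : forall i, V i <<= U)
    (s : forall i, S (V i)) :
  (forall x, U x -> exists i, V i x) ->
  (forall i j W (Wi : W <<= V i) (Wj : W <<= V j),
    sres Wi (s i) = sres Wj (s j)) ->
  exists t : S U, forall i, sres (VU i) t = s i.
Proof.
move=> cov comp.
have [|t tE] := sheaf_glue VU (s := fun i => (s i).1) cov.
  by move=> i j W Wi Wj; case: (comp i j W Wi Wj).
have [|u uE] := sheaf_glue VU (s := fun i => (s i).2) cov.
  by move=> i j W Wi Wj; case: (comp i j W Wi Wj).
by exists (t, u) => i; rewrite /sres /= tE uE; case: (s i).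
Qed.

Definition dsum : sheaf :=
  Sheaf ds_resD ds_resZ ds_res_id ds_res_comp ds_sep ds_glue.
End DirectSum.

Section Zero.
Let S (U : opens) : lmodType (regfun U) := 'rV[regfun U]_0.

Program Definition zero_sheaf : sheaf :=
  @Sheaf S (fun U V _ _ => 0) _ _ _ _ _ _.
Next Obligation. by move=> *; rewrite addr0. Qed.
Next Obligation. by move=> *; rewrite scaler0. Qed.
Next Obligation. by move=> U UU s; apply/matrixP => i []. Qed.
Next Obligation. by []. Qed.
Next Obligation. by move=> U s t _; apply/matrixP => i []. Qed.
Next Obligation. by move=> U I V VU s _ _; exists 0 => i; apply/matrixP => j []. Qed.
End Zero.

Definition lines (a : seq int) : sheaf :=
  foldr (fun k F => dsum (lineb k) F) zero_sheaf a.

Section Exactness.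
Variables F G H : sheaf.

Definition mor_injective (a : mor F G) := forall U, injective (@app F G a U).

Definition in_image (a : mor F G) U (t : G U) :=
  forall x, U x -> exists V (VU : V <<= U),
    V x /\ exists s : F V, app a s = res VU t.

Definition mor_surjective (a : mor F G) := forall U (t : G U), in_image a t.

Definition isomorphic := exists a : mor F G, forall U, bijective (@app F G a U).
End Exactness.

Definition short_exact F G H (a : mor F G) (b : mor G H) :=
  [/\ mor_injective a, mor_surjective b &
      forall U (t : G U), app b t = 0 <-> in_image a t].

Definition generated F U n (e : 'I_n -> sec F U) :=
  forall V (VU : V <<= U) (s : F V) x, V x ->
    exists W (WV : W <<= V) (WU : W <<= U) (f : 'I_n -> regfun W),
      W x /\ res WV s = \sum_i f i *: res WU (e i).

Definition finite_type (F : sheaf) := forall x, exists (U : opens) n,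
  U x /\ exists e : 'I_n -> F U, generated e.

(* The sheaf of relations between e_1, ..., e_n is generated by the rows of r *)
Definition relations_generated F U n (e : 'I_n -> sec F U)
    m (r : 'I_m -> 'I_n -> regfun U) :=
  (forall j, \sum_i r j i *: e i = 0) /\
  forall V (VU : V <<= U) (f : 'I_n -> regfun V),
    \sum_i f i *: res VU (e i) = 0 ->
    forall x, V x -> exists W (WV : W <<= V) (WU : W <<= U)
        (g : 'I_m -> regfun W),
      W x /\ forall i, regres WV (f i) = \sum_j g j * regres WU (r j i).

Definition coherent (F : sheaf) :=
  finite_type F /\
  forall U n (e : 'I_n -> F U) x, U x ->
    exists V (VU : V <<= U) m (r : 'I_m -> 'I_n -> regfun V),
      V x /\ relations_generated (fun i => res VU (e i)) r.

Definition nonempty (U : opens) := exists x, U x.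

(* The germs of e_1, ..., e_r form a basis of the generic stalk of F over the  *)
(* function field of P^3.                                                      *)
Definition has_rank (F : sheaf) (r : nat) :=
  exists U (e : 'I_r -> F U), [/\ nonempty U,
    forall V (VU : V <<= U) (f : 'I_r -> regfun V), nonempty V ->
      \sum_i f i *: res VU (e i) = 0 -> forall i, f i = 0 &
    forall V (s : F V), nonempty V ->
      exists W (WV : W <<= V) (WU : W <<= U) (f : 'I_r -> regfun W),
        nonempty W /\ res WV s = \sum_i f i *: res WU (e i)].

Definition reflexive_sheaf (F : sheaf) :=
  coherent F /\ forall U, bijective (@biduality F U).

(* The ideal sheaf is given up to isomorphism, by a monomorphism into O.       *)
Record closed_subscheme := ClosedSubscheme {
  ideal : sheaf;
  ideal_coherent : coherent ideal;
  ideal_incl : mor ideal (lineb 0);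
  ideal_incl_inj : mor_injective ideal_incl }.

(* The points at which every local section of the ideal vanishes. *)
Definition support (Z : closed_subscheme) : set point := fun x =>
  forall (U : opens) (Ux : U x) (f : ideal Z U),
    (app (ideal_incl Z) f : twfun 0 U) (exist _ x Ux) = 0.

Definition irreducible_closed (Y : set point) :=
  [/\ zariski_closed Y, exists x, Y x &
    forall A B, zariski_closed A -> zariski_closed B ->
      (Y `<=` A `|` B -> Y `<=` A \/ Y `<=` B)%classic].

(* Every irreducible closed Y contained in Z starts a chain of irreducible     *)
(* closed subsets of length at least 2.                                        *)
Definition codim_ge2 (Z : set point) :=
  forall Y, irreducible_closed Y -> (Y `<=` Z)%classic ->
    exists Y1 Y2, [/\ irreducible_closed Y1, irreducible_closed Y2,
      (Y `<` Y1)%classic & (Y1 `<` Y2)%classic].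

(* Chern classes, as integers through A(P^3) = Z[h]/(h^4), computed from a     *)
(* finite resolution by sums of line bundles with the Whitney formula and      *)
(* c(O(a)) = 1 + a h.                                                          *)

(* free_resolution [:: E_0; ...; E_n] F: there is an exact sequence            *)
(*   0 -> lines E_n -> ... -> lines E_0 -> F -> 0,                             *)
(* cut into short exact sequences.                                             *)
Inductive free_resolution : seq (seq int) -> sheaf -> Prop :=
| FreeResNil (F : sheaf) : (forall U (s : F U), s = 0) -> free_resolution [::] F
| FreeResCons a E (F G : sheaf) (i : mor G (lines a)) (p : mor (lines a) F) :
    short_exact i p -> free_resolution E G -> free_resolution (a :: E) F.

Definition chern_poly (a : seq int) : {poly int} := \prod_(k <- a) (1 + k *: 'X).

Definition has_chern_classes (F : sheaf) (c1 c2 c3 : int) :=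
  exists2 E, free_resolution E F &
    take_poly 4 ((1 + c1 *: 'X + c2 *: 'X^2 + c3 *: 'X^3) *
                 \prod_(i < size E | odd i) chern_poly (nth [::] E i)) =
    take_poly 4 (\prod_(i < size E | ~~ odd i) chern_poly (nth [::] E i)).

Record distribution (d : nat) := Distribution {
  dist_tangent : sheaf;
  dist_sing : closed_subscheme;
  dist_incl : mor dist_tangent tangent_sheaf;
  dist_proj : mor tangent_sheaf (twist (ideal dist_sing) (d%:Z + 2));
  dist_exact : short_exact dist_incl dist_proj;
  dist_reflexive : reflexive_sheaf dist_tangent;
  dist_rank : has_rank dist_tangent 2;
  dist_codim : codim_ge2 (support dist_sing) }.

Definition has_sections (F : sheaf) := exists s : F P3, s != 0.

(* t is the least integer k such that H^0(F(k - 1)) is nonzero *)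
Definition is_first_twist (F : sheaf) (t : int) :=
  has_sections (twist F (t - 1)) /\
  forall k : int, has_sections (twist F (k - 1)) -> t <= k.

End ProjectiveSpace.

(* Main.v *)
(* The distribution is given by a homogeneous 1-form A = \sum_i A_i dx_i with   *)
(* A.x = 0 whose coefficients have no common factor, and the sections of its   *)
(* tangent sheaf are the homogeneous fields w with A.w = 0, modulo multiples   *)
(* of the Euler field x.  A nonzero global section is represented by a linear  *)
(* field v(x) = T x, and the absence of sections of T_F(-1) forces             *)
(* rank(T - a) >= 2 for every scalar a.                                        *)
(* Contracting the volume form with x, v and w yields g A for a polynomial g,  *)
(* and w |-> g identifies T_F / O v with a twist of the ideal J of the zero    *)
(* scheme of v.  This ideal contains the 2 x 2 minors of (x, T x), and it is   *)
(* saturated with respect to ideals of codimension 3.  The Jordan form of T    *)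
(* leaves the following possibilities: J = (1), or J is the ideal of a line,   *)
(* of two skew lines, or of a double line p0^2, p0 p1, p1^2, p0 p3 - p1 p2.    *)
(* The last two have resolutions with the same Betti numbers, and adding the   *)
(* generator v to the resolution of J gives one of T_F, hence the three cases. *)
From HB Require Import structures.
From mathcomp Require Import all_boot all_order all_algebra.
From mathcomp Require Import boolp classical_sets reals complex.
From mathcomp Require Import mpoly zify ring.
Require Import Defs.

Set Implicit Arguments.
Unset Strict Implicit.
Unset Printing Implicit Defensive.

Import GRing.Theory.
Local Open Scope ring_scope.

(** * Unique factorization and zeros of polynomials *)

(** The distribution is turned into polynomial algebra on the affine cone. Over a chart every
    derivation comes from a field with coefficients of degree 1, unique modulo the Euler field x
    ([tangent_der], [der_eq0]). The projection to the twisted ideal sheaf then becomes the pairing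
    with a 1-form [A], whose coefficients are global sections of O(d + 1), hence polynomials
    ([global_poly], [exists_form]). A common factor of the [A i] would put a hypersurface inside the
    singular scheme, against codimension 2; therefore every form proportional to [A] is a polynomial
    multiple of [A] ([form_primitive]).

    As t_F = 1, there is a nonzero global section of T_F, and global fields on P^3 are linear, given
    by a matrix M ([global_tangent]). If M - a had rank at most 1, then modulo x the field would be
    a linear form times a constant field, and that constant field would be a section of T_F(-1),
    which t_F = 1 excludes ([exists_linear_field]).

    Let v be this linear field. A field w killed by [A] is determined modulo x and v by the
    polynomial g with [cross x v w] = g [A] ([cross_parallel], [cross_kernel]). The polynomials g
    form an ideal J which contains the 2 x 2 minors of (x, v) and, by Koszul relations, has no
    isolated or embedded points ([zero_ideal_saturated]). Linear algebra on M then determines J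
    ([pencil_ideal_cases]). If every M - a has rank at least 3, eigenvectors added one at a time
    show that J contains all linear forms, so J = (1). Otherwise some M - a has rank 2, and J
    contains the ideal of two skew lines, of a line or of a double line, according to whether its
    image and kernel meet in dimension 0, 1 or 2. Saturation shows that J is this ideal, the ideal
    of a line, or (1).

    Each of these ideals has an explicit linear resolution. Lifting its generators to fields and
    adding v resolves the module of fields killed by [A] ([horseshoe]), hence the tangent sheaf
    ([tangent_free_resolution]), and the Chern classes follow. For J = (1) the module is freely
    generated, modulo x, by v and one more field, so the sheaf splits ([tangent_split]). The lower
    bounds on d come again from the absence of sections of T_F(-1) ([split_degree],
    [line_degree]). *)

Section Divisibility.
Variable R : idomainType.
Implicit Types (a b c p q : R) (s : seq R).

Definition dvd a b := exists c, b = c * a.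

Definition prime_elt p :=
  [/\ p != 0, ~ dvd p 1 & forall a b, dvd p (a * b) -> dvd p a \/ dvd p b].

Lemma dvd_mull a b c : dvd a b -> dvd a (c * b).
Proof. by move=> [d ->]; exists (c * d); rewrite mulrA. Qed.

Lemma dvd_mulr a b c : dvd a b -> dvd a (b * c).
Proof. by rewrite mulrC; exact: dvd_mull. Qed.

Lemma dvd_refl a : dvd a a.
Proof. by exists 1; rewrite mul1r. Qed.

Lemma dvd0 a : dvd a 0.
Proof. by exists 0; rewrite mul0r. Qed.

Lemma dvd_trans a b c : dvd a b -> dvd b c -> dvd a c.
Proof. by move=> [d ->] [e ->]; exists (e * d); rewrite mulrA. Qed.

Lemma dvdD a b c : dvd a b -> dvd a c -> dvd a (b + c).
Proof. by move=> [d ->] [e ->]; exists (d + e); rewrite mulrDl. Qed.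

Lemma dvdB a b c : dvd a b -> dvd a c -> dvd a (b - c).
Proof. by move=> [d ->] [e ->]; exists (d - e); rewrite mulrBl. Qed.

Lemma dvd_sum a I (r : seq I) (P : pred I) (F : I -> R) :
  (forall i, P i -> dvd a (F i)) -> dvd a (\sum_(i <- r | P i) F i).
Proof. by move=> aF; elim/big_ind: _ => //; [exact: dvd0|exact: dvdD]. Qed.

Lemma dvd1M a b : dvd a 1 -> dvd b 1 -> dvd (a * b) 1.
Proof. by move=> [c e] [d e']; exists (c * d); rewrite mulrACA -e -e' mulr1. Qed.

Definition all_prime s := forall p, p \in s -> prime_elt p.

Lemma all_prime_cons p s : all_prime (p :: s) -> prime_elt p /\ all_prime s.
Proof.
by move=> h; split=> [|q qs]; apply: h; rewrite inE ?eqxx // qs orbT.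
Qed.

Lemma all_prime_cat s t : all_prime s -> all_prime t -> all_prime (s ++ t).
Proof. by move=> hs ht p; rewrite mem_cat => /orP[/hs|/ht]. Qed.

Lemma prime_dvd_prod p s :
  prime_elt p -> dvd p (\prod_(q <- s) q) -> exists2 q, q \in s & dvd p q.
Proof.
move=> [_ p1 pM]; elim: s => [|q s IHs]; first by rewrite big_nil.
rewrite big_cons => /pM[pq|/IHs [r rs pr]]; first by exists q; rewrite ?inE ?eqxx.
by exists r; rewrite ?inE ?rs ?orbT.
Qed.

Definition factorial_domain := forall a, a != 0 ->
  exists u s, [/\ dvd u 1, all_prime s & a = u * \prod_(p <- s) p].

Lemma dvd_cancel_primes a b s : all_prime s -> (forall p, p \in s -> ~ dvd p a) ->
  dvd a (\prod_(p <- s) p * b) -> dvd a b.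
Proof.
elim: s => [|p s IHs]; first by rewrite big_nil mul1r.
rewrite big_cons => /all_prime_cons [[p0 p1 pM] sP] nd [c e].
have [||pa] := pM c a; last by case: (nd p); rewrite ?inE ?eqxx.
  by exists (\prod_(q <- s) q * b); rewrite -e; ring.
move=> [d dE].
apply: IHs => // [q qs|]; first by apply: nd; rewrite inE qs orbT.
by exists d; apply: (mulfI p0); rewrite mulrA e dE; ring.
Qed.

(** The last clause is the coprimality of [a'] and [b'], phrased for later use: any fraction c / d
    equal to a' / b' has a denominator divisible by [b']. The primes of [b] that divide [a] are
    cancelled one by one. *)
Lemma lowest_terms a b : factorial_domain -> b != 0 -> exists a' b' g,
  [/\ a = a' * g, b = b' * g & forall c d, a' * d = c * b' -> dvd b' d].
Proof.
move=> R_ufd b0; have [u [s [u1 sP bE]]] := R_ufd _ b0.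
elim: s a b b0 u u1 sP bE => [|p s IHs] a b b0 u u1 sP bE.
  exists a, b, 1; rewrite !mulr1; split=> // c d _.
  apply: dvd_trans (_ : dvd 1 d); last by exists d; rewrite mulr1.
  by rewrite bE big_nil mulr1.
have [pP {}sP] := all_prime_cons sP; have [p0 p1 pM] := pP.
pose b1 := u * \prod_(q <- s) q.
have bE1 : b = b1 * p by rewrite bE big_cons /b1; ring.
have b10 : b1 != 0 by apply: contra b0 => /eqP e; rewrite bE1 e mul0r.
have [[c cE]|npa] := pselect (dvd p a).
  have [a' [b' [g [e1 e2 e3]]]] := IHs c b1 b10 u u1 sP erefl.
  exists a', b', (g * p); split=> //; first by rewrite cE e1 mulrA.
  by rewrite bE1 e2 mulrA.
have [a' [b' [g [e1 e2 e3]]]] := IHs a b1 b10 u u1 sP erefl.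
exists a', (b' * p), g; split=> //; first by rewrite bE1 e2 mulrAC.
move=> c d; rewrite mulrA => e.
have [d' dE] := e3 _ _ (etrans e (mulrAC _ _ _)).
have b'0 : b' != 0 by apply: contra b10 => /eqP e'; rewrite e2 e' mul0r.
have e4 : a' * d' = c * p.
  by apply: (mulIf b'0); rewrite -mulrA -dE e mulrAC.
have [|pa'|[d'' d'E]] := pM a' d'; first by rewrite e4; exists c.
  by case: npa; rewrite e1; exact: dvd_mulr.
by exists d''; rewrite dE d'E; ring.
Qed.

End Divisibility.

Section FactorialIso.
Variables (R S : idomainType) (f : {rmorphism R -> S}) (g : {rmorphism S -> R}).
Hypotheses (fK : cancel f g) (gK : cancel g f).

Lemma dvd_iso a b : dvd a b <-> dvd (f a) (f b).
Proof.
split=> [[c ->]|[c e]]; first by exists (f c); rewrite rmorphM.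
by exists (g c); rewrite -[LHS]fK e rmorphM fK.
Qed.

Lemma prime_iso p : prime_elt p <-> prime_elt (f p).
Proof.
split=> -[p0 p1 pM]; split.
- by apply: contra p0 => /eqP e; rewrite -[p]fK e rmorph0.
- by rewrite -(rmorph1 f) => /dvd_iso.
- by move=> a b; rewrite -[a]gK -[b]gK -rmorphM => /dvd_iso/pM [] /dvd_iso; auto.
- by apply: contra p0 => /eqP ->; rewrite rmorph0.
- by move/dvd_iso; rewrite rmorph1.
- by move=> a b /dvd_iso; rewrite rmorphM => /pM [] /dvd_iso; auto.
Qed.

Lemma factorial_iso : factorial_domain R -> factorial_domain S.
Proof.
move=> R_ufd a a0.
have ga0 : g a != 0 by apply: contra a0 => /eqP e; rewrite -[a]gK e rmorph0.
have [u [s [u1 sP aE]]] := R_ufd _ ga0.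
exists (f u), [seq f p | p <- s]; split.
- by rewrite -(rmorph1 f); apply/dvd_iso.
- by move=> p /mapP [q /sP qP ->]; apply/prime_iso.
- by rewrite -[a]gK aE rmorphM rmorph_prod big_map.
Qed.
End FactorialIso.

(** * Gauss's lemma: factoriality passes to polynomial rings *)

Section PolyFactorial.
Variable R : idomainType.
Implicit Types (a b c p : R) (f g h : {poly R}).

Lemma dvd_polyC a f : dvd a%:P f <-> forall i, dvd a f`_i.
Proof.
split=> [[g ->] i|h]; first by exists g`_i; rewrite coefMC.
exists (\poly_(i < size f) projT1 (cid (h i))); apply/polyP => i.
rewrite coefMC coef_poly; case: ltnP => [_|hi]; first exact: (projT2 (cid (h i))).
by rewrite nth_default // mul0r.
Qed.

Lemma dvd_polyCC a b : dvd a%:P b%:P <-> dvd a b.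
Proof.
split=> [/dvd_polyC/(_ 0%N)|[c ->]]; first by rewrite coefC.
by exists c%:P; rewrite polyCM.
Qed.

(** If [p] divides neither f nor g, consider in each the first coefficient not divisible by [p].
    Their product is the only term of some coefficient of f g that [p] could fail to divide. *)
Lemma prime_polyC p : prime_elt p <-> prime_elt p%:P.
Proof.
split=> -[p0 p1 pM]; split.
- by rewrite polyC_eq0.
- by move/dvd_polyCC.
- move=> f g pfg; apply: contrapT => /not_orP [nf ng].
  have low (h : {poly R}) : ~ dvd p%:P h ->
      exists i, ~ dvd p h`_i /\ forall j, (j < i)%N -> dvd p h`_j.
    move=> nh; have : exists i, `[< ~ dvd p h`_i >].
      apply: contrapT => h'; apply/nh/dvd_polyC => i; apply: contrapT => nd.
      by apply: h'; exists i; apply/asboolP.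
    case/ex_minnP => i /asboolP nd mini; exists i; split=> // j.
    rewrite ltnNge => /negP ij; apply: contrapT => ndj; apply: ij.
    by apply: mini; apply/asboolP.
  have [i [nfi ltf]] := low f nf; have [j [ngj ltg]] := low g ng.
  have /dvd_polyC/(_ (i + j)%N) := pfg.
  have ij : (i < (i + j).+1)%N by rewrite ltnS leq_addr.
  rewrite coefM (bigD1 (Ordinal ij)) //= addKn => h.
  have : dvd p (f`_i * g`_j).
    rewrite -[_ * _](addrK (\sum_(k < (i + j).+1 | k != Ordinal ij) f`_k * g`_(i + j - k))).
    apply: dvdB => //; apply: dvd_sum => k /eqP kij.
    case: (ltngtP k i) => ki.
    + by apply/dvd_mulr/ltf.
    + by apply/dvd_mull/ltg; have := ltn_ord k; lia.
    + by case: kij; exact: val_inj.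
  by case/pM.
- by rewrite -polyC_eq0.
- by move/dvd_polyCC.
- by move=> a b /dvd_polyCC; rewrite polyCM => /pM [] /dvd_polyCC; auto.
Qed.

Definition degree_irreducible f :=
  forall g h, f = g * h -> (size g <= 1)%N \/ (size h <= 1)%N.

Definition primitive f := forall p, prime_elt p -> ~ dvd p%:P f.

Hypothesis R_ufd : factorial_domain R.

Lemma primitive_cancel f g c : primitive f -> c != 0 ->
  dvd f (c%:P * g) -> dvd f g.
Proof.
move=> fprim c0; have [u [s [[v uv] sP cE]]] := R_ufd c0.
move=> h; apply: (@dvd_cancel_primes _ f g [seq p%:P | p <- s]).
- by move=> _ /mapP [p ps ->]; apply/(prime_polyC p).1/sP.
- by move=> _ /mapP [p ps ->]; apply/fprim/sP.
have -> : \prod_(p <- [seq p%:P | p <- s]) p * g = v%:P * (c%:P * g).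
  by rewrite big_map cE -rmorph_prod polyCM !mulrA -[v%:P * _]polyCM -uv mul1r.
exact: dvd_mull.
Qed.

(** A factorization over the fraction field descends to [R] with the same degrees: each prime of the
    denominator [c] divides one of the two factors and is cancelled there. *)
Lemma clear_denominator f g h c : c != 0 -> c%:P * f = g * h ->
  exists g' h', [/\ f = g' * h', size g' = size g & size h' = size h].
Proof.
move=> c0; have [u [s [u1 sP cE]]] := R_ufd c0.
elim: s c c0 u u1 sP cE g h => [|p s IHs] c c0 u u1 sP cE g h e.
  have [v uv] := u1; have v0 : v != 0.
    by apply/eqP => v0; move: uv; rewrite v0 mul0r => /eqP; rewrite oner_eq0.
  exists (v *: g), h; split=> //; last by rewrite size_scale.
  rewrite -scalerAl -e cE big_nil mulr1 -mul_polyC mulrA -polyCM -uv.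
  by rewrite mul1r.
have [pP {}sP] := all_prime_cons sP; have [p0 p1 pM] := pP.
pose c1 := u * \prod_(q <- s) q.
have cE1 : c = p * c1 by rewrite cE big_cons /c1; ring.
have c10 : c1 != 0 by apply: contra c0 => /eqP e'; rewrite cE1 e' mulr0.
have [_ _ pPM] := (prime_polyC p).1 pP.
have pP0 : p%:P != 0 by rewrite polyC_eq0.
have [|[g' gE]|[h' hE]] := pPM g h.
- by rewrite -e cE1; exists (c1%:P * f); rewrite polyCM; ring.
- have [|g'' [h'' [fE sg sh]]] := IHs c1 c10 u u1 sP erefl g' h.
    by apply: (mulfI pP0); rewrite mulrA -polyCM -cE1 e gE; ring.
  by exists g'', h''; split; rewrite // gE mulrC mul_polyC size_scale.
- have [|g'' [h'' [fE sg sh]]] := IHs c1 c10 u u1 sP erefl g h'.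
    by apply: (mulfI pP0); rewrite mulrA -polyCM -cE1 e hE; ring.
  by exists g'', h''; split; rewrite // hE mulrC mul_polyC size_scale.
Qed.

(** The gcd over the fraction field is a nonconstant factor of [f]. Irreducibility makes its
    cofactor constant, so [f] divides a constant multiple of [g], and primitivity removes the
    constant. *)
Lemma dvd_not_coprime f g : primitive f -> degree_irreducible f ->
  (1 < size f)%N -> ~~ coprimep f g -> dvd f g.
Proof.
move=> fprim firr sf ncop; pose d := gcdp f g.
have f0 : f != 0 by rewrite -size_poly_gt0 (ltn_trans _ sf).
have d0 : d != 0 by rewrite gcdp_eq0 (negPf f0).
have sd : (1 < size d)%N.
  by move: ncop; rewrite /coprimep -/d => h; rewrite ltn_neqAle eq_sym h size_poly_gt0.
have /Pdiv.Idomain.dvdpP [[c q] /= c0 e] : d %| f by exact: dvdp_gcdl.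
have /Pdiv.Idomain.dvdpP [[c' q'] /= c'0 e'] : d %| g by exact: dvdp_gcdr.
have [g' [h' [fE sg sh]]] := clear_denominator c0 (etrans (mul_polyC _ _) e).
have sq : (size q <= 1)%N by have [] := firr _ _ fE; rewrite ?sg ?sh // leqNgt sd.
have [q0 qE] : exists q0, q = q0%:P by exists q`_0; exact: size1_polyC.
have q00 : q0 != 0.
  apply: contraNneq f0 => q00; move: e; rewrite qE q00 polyC0 mul0r => /eqP.
  by rewrite -mul_polyC mulf_eq0 polyC_eq0 (negPf c0).
apply: (@primitive_cancel _ _ (q0 * c')) => //; first by rewrite mulf_neq0.
move: e e'; rewrite -!mul_polyC => e e'; exists (c%:P * q').
by rewrite mulrAC e qE polyCM -mulrA e'; ring.
Qed.

Lemma coprime_bezout f g : coprimep f g ->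
  exists u v r, r != 0 /\ u * f + v * g = r%:P.
Proof.
move=> /Pdiv.Idomain.Bezout_coprimepP [[u v] /= /Pdiv.Idomain.eqpP [[c1 c2] /= /andP[c10 c20] e]].
exists (c1 *: u), (c1 *: v), c2; split=> //.
by rewrite -!scalerAl -scalerDr e alg_polyC.
Qed.

Lemma coprime_common_root (L : comNzRingType) f g : coprimep f g ->
  exists r, r != 0 /\ forall (phi : {rmorphism R -> L}) t,
    (map_poly phi f).[t] = 0 -> (map_poly phi g).[t] = 0 -> phi r = 0.
Proof.
move=> /coprime_bezout [u [v [r [r0 e]]]]; exists r; split=> // phi t ft gt.
have := congr1 (fun p : {poly R} => (map_poly phi p).[t]) e.
by rewrite /= rmorphD !rmorphM map_polyC hornerC hornerD !hornerM ft gt !mulr0 addr0.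
Qed.

Lemma primitive_irreducible_prime f : primitive f -> degree_irreducible f ->
  (1 < size f)%N -> prime_elt f.
Proof.
move=> fprim firr sf; split.
- by rewrite -size_poly_gt0 (ltn_trans _ sf).
- move=> [g] /(congr1 (fun p : {poly R} => size p)); rewrite size_poly1.
  have [->|g0] := eqVneq g 0; first by rewrite mul0r size_poly0.
  rewrite size_mul // -?size_poly_gt0 ?(ltn_trans _ sf) //.
  by move: g0; rewrite -size_poly_gt0; case: (size g) (size f) sf => [|m] [|[|k]] //; lia.
- move=> g h fgh; have [cop|] := boolP (coprimep f g); last first.
    by move/(dvd_not_coprime fprim firr sf); left.
  have [u [v [r [r0 e]]]] := coprime_bezout cop; right.
  apply: (primitive_cancel fprim r0).
  rewrite -e mulrDl; apply: dvdD; first by exists (u * h); ring.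
  by rewrite -mulrA; exact: dvd_mull.
Qed.

Lemma prime_degree_irreducible f : prime_elt f -> degree_irreducible f.
Proof.
move=> [f0 f1 fM] g h fE.
have g0 : g != 0 by apply: contra f0 => /eqP e; rewrite fE e mul0r.
have h0 : h != 0 by apply: contra f0 => /eqP e; rewrite fE e mulr0.
have key (a b c : {poly R}) : a != 0 -> b != 0 -> c * (a * b) = a -> (size b <= 1)%N.
  move=> a0 b0 e; have c0 : c != 0.
    by apply: contra a0 => /eqP c0; rewrite -e c0 mul0r.
  move/(congr1 (fun p : {poly R} => size p)): e.
  rewrite !size_mul ?mulf_neq0 //; move: a0 b0 c0; rewrite -!size_poly_gt0; lia.
have [|[c e]|[c e]] := fM g h; first by rewrite -fE; exact: dvd_refl.
  by right; apply: (key g h c) => //; rewrite -fE.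
by left; apply: (key h g c) => //; rewrite [h * g]mulrC -fE.
Qed.

Lemma prime_primitive f : prime_elt f -> (1 < size f)%N -> primitive f.
Proof.
move=> fP sf p [p0 p1 pM] [g fE].
have [f0 _ fM] := fP; have pP0 : p%:P != 0 by rewrite polyC_eq0.
have [|[h e]|[h e]] := fM g p%:P; first by rewrite -fE; exact: dvd_refl.
  case: p1; apply/dvd_polyCC; exists h; apply: (mulIf f0).
  by rewrite polyC1 mul1r {1}fE e; ring.
have h0 : h != 0 by apply: contra pP0 => /eqP h0; rewrite e h0 mul0r.
move/(congr1 (fun p : {poly R} => size p)): e; rewrite size_polyC p0 size_mul //.
by move: h0; rewrite -size_poly_gt0; lia.
Qed.

(** Induction on the number of primes in the leading coefficient: a prime dividing [f] divides it,
    hence is associated to one of them, and dividing [f] by it removes that one. *)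
Lemma extract_content f : (1 < size f)%N -> exists c g,
  [/\ c != 0, f = c%:P * g & primitive g].
Proof.
move=> sf; have lf0 : lead_coef f != 0.
  by rewrite lead_coef_eq0 -size_poly_gt0 (ltn_trans _ sf).
have [u [s [u1 sP lfE]]] := R_ufd lf0.
have [n sn] := ubnP (size s); elim: n => // n IHn in s sP f u u1 sf lf0 lfE sn *.
have [fprim|] := pselect (primitive f).
  by exists 1, f; rewrite mul1r oner_neq0.
move=> /existsNP [p] /not_implyP [pP] /contrapT [g fE].
have [p0 p1 pM] := pP.
have lfg : lead_coef f = lead_coef g * p by rewrite fE lead_coefM lead_coefC.
have pl : dvd p (\prod_(q <- s) q).
  have [|pu|//] := pM u (\prod_(q <- s) q).
    by rewrite -lfE lfg; exact/dvd_mull/dvd_refl.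
  by case: p1; exact: dvd_trans u1.
have [q qs [w qE]] := prime_dvd_prod pP pl.
have [q0 q1 qM] := sP q qs.
have w0 : w != 0 by apply: contra q0 => /eqP e; rewrite qE e mul0r.
have w1 : dvd w 1.
  have [|[e eE]|[e eE]] := qM w p; first by rewrite -qE; exact: dvd_refl.
    case: p1; exists e; apply: (mulIf w0); rewrite mul1r {1}eE qE; ring.
  by exists e; apply: (mulIf p0); rewrite mul1r {1}eE qE; ring.
have sg : size f = size g by rewrite fE mulrC mul_polyC size_scale.
have [||||||c [g' [c0 gE g'prim]]] := IHn (rem q s) _ g (u * w).
- by move=> r /mem_rem; exact: sP.
- exact: dvd1M.
- by rewrite -sg.
- by apply: contra lf0 => /eqP e; rewrite lfg e mul0r.
- apply: (mulIf p0); rewrite -lfg lfE (big_rem q) //= qE; ring.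
- by move: sn; rewrite size_rem //; case: (s) qs => //= *; lia.
exists (c * p), g'; split=> //; first by rewrite mulf_neq0.
by rewrite fE gE polyCM; ring.
Qed.

Lemma factorial_poly : factorial_domain {poly R}.
Proof.
move=> f; have [n sn] := ubnP (size f); elim: n => // n IHn in f sn *.
move=> f0; have [firr|] := pselect (degree_irreducible f); last first.
  move=> /existsNP [g] /existsNP [h] /not_implyP [fE] /not_orP [/negP gs /negP hs].
  have g0 : g != 0 by apply: contra f0 => /eqP e; rewrite fE e mul0r.
  have h0 : h != 0 by apply: contra f0 => /eqP e; rewrite fE e mulr0.
  have sE : size f = (size g + size h).-1 by rewrite fE size_mul.
  have [||u [s [u1 sP gE]]] := IHn g => //; first by lia.
  have [||v [t [v1 tP hE]]] := IHn h => //; first by lia.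
  exists (u * v), (s ++ t); split; [exact: dvd1M|exact: all_prime_cat|].
  by rewrite big_cat /= fE gE hE; ring.
have polyC_fact (c : R) : c != 0 -> exists (u : {poly R}) s,
    [/\ dvd u 1, all_prime s & c%:P = u * \prod_(p <- s) p].
  move=> c0; have [u [s [u1 sP cE]]] := R_ufd c0.
  exists u%:P, [seq p%:P | p <- s]; split; first exact/dvd_polyCC.
    by move=> _ /mapP [p ps ->]; apply/(prime_polyC p).1/sP.
  by rewrite cE polyCM rmorph_prod big_map.
have [sf|sf] := leqP (size f) 1.
  by rewrite (size1_polyC sf); apply: polyC_fact; rewrite -polyC_eq0 -size1_polyC.
have [c [g [c0 fE gprim]]] := extract_content sf.
have [u [s [u1 sP cE]]] := polyC_fact c c0.
have sg : size f = size g by rewrite fE mul_polyC size_scale.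
have gP : prime_elt g.
  apply: primitive_irreducible_prime => //; last by rewrite -sg.
  move=> a b gE; have [||] := firr (c%:P * a) b; first by rewrite fE gE mulrA.
    by rewrite mul_polyC size_scale //; left.
  by right.
exists u, (rcons s g); split=> //; last by rewrite -cats1 big_cat big_seq1 /= fE cE mulrA.
by move=> p; rewrite mem_rcons inE => /orP[/eqP ->|/sP].
Qed.

End PolyFactorial.

(** * Polynomials in n + 1 variables as univariate polynomials *)

Lemma mpoly_rmorph_eq n (K S : comNzRingType) (f g : {rmorphism {mpoly K[n]} -> S}) :
  (forall c, f c%:MP = g c%:MP) -> (forall i, f 'X_i = g 'X_i) -> f =1 g.
Proof.
move=> fgC fgX p; rewrite [p]mpolyE !rmorph_sum; apply: eq_bigr => m _.
rewrite -!mul_mpolyC !rmorphM fgC mpolyXE_id !rmorph_prod; congr (_ * _).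
by apply: eq_bigr => i _; rewrite !rmorphXn fgX.
Qed.

Section MpolyMorph.
Variables (n : nat) (K : comNzRingType).

Definition multi (P : {poly {mpoly K[n]}}) : {mpoly K[n.+1]} :=
  horner_eval 'X_ord_max (map_poly (@mwiden n K) P).

HB.instance Definition _ :=
  GRing.RMorphism.copy multi (horner_eval 'X_ord_max \o map_poly (@mwiden n K)).

Lemma multiC c : multi c%:P = mwiden c.
Proof. by rewrite /multi map_polyC horner_evalE hornerC. Qed.

Lemma multiX : multi 'X = 'X_ord_max.
Proof. by rewrite /multi map_polyX horner_evalE hornerX. Qed.

Lemma muni_X (i : 'I_n) : muni 'X_(widen_ord (leqnSn n) i) = ('X_i)%:P :> {poly {mpoly K[n]}}.
Proof.
rewrite muniE msuppX big_seq1 mcoeffX eqxx scale1r mnm1E.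
have -> : (widen_ord (leqnSn n) i == ord_max) = false.
  by apply/eqP => /(congr1 val) /= e; have := ltn_ord i; rewrite e ltnn.
rewrite expr0 alg_polyC; congr ('X_[_])%:P.
by apply/mnmP => j; rewrite !mnmE -val_eqE /= val_eqE.
Qed.

Lemma muni_Xmax : muni 'X_ord_max = 'X :> {poly {mpoly K[n]}}.
Proof.
rewrite muniE msuppX big_seq1 mcoeffX eqxx scale1r mnm1E eqxx expr1.
have -> : [multinom U_(ord_max)%MM (widen_ord (leqnSn n) i) | i < n] = 0%MM.
  apply/mnmP => j; rewrite mnmE mnm1E mnm0E; apply/eqP; rewrite eqb0.
  by apply/eqP => /(congr1 val) /= e; have := ltn_ord j; rewrite -e ltnn.
by rewrite mpolyX0 scale1r.
Qed.

Lemma ordS_ind (i : 'I_n.+1) :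
  i = ord_max \/ exists j, i = widen_ord (leqnSn n) j.
Proof.
have [->|h] := eqVneq i ord_max; [by left|right].
have hi : (i < n)%N.
  have := ltn_ord i; rewrite ltnS leq_eqVlt => /orP[/eqP e|//].
  by case/eqP: h; exact: val_inj.
by exists (Ordinal hi); exact: val_inj.
Qed.

Lemma muniK : cancel (@muni n K) multi.
Proof.
move=> p; apply: (@mpoly_rmorph_eq _ _ _ (multi \o @muni n K) idfun) => [c|i] /=.
  by rewrite muniC multiC mwidenC.
have [->|[j ->]] := ordS_ind i; first by rewrite muni_Xmax multiX.
by rewrite muni_X multiC mwidenX mnmwiden1.
Qed.

Lemma muni_widen (p : {mpoly K[n]}) : muni (mwiden p) = p%:P.
Proof.
apply: (@mpoly_rmorph_eq _ _ _ (@muni n K \o @mwiden n K) polyC) => [c|i] /=.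
  by rewrite mwidenC muniC.
by rewrite mwidenX mnmwiden1 muni_X.
Qed.

Lemma multiK : cancel multi (@muni n K).
Proof.
move=> P; elim/poly_ind: P => [|P c IH]; first by rewrite !rmorph0.
by rewrite !rmorphD !rmorphM /= IH multiX multiC muni_Xmax muni_widen.
Qed.

Lemma meval_muni (x : 'I_n.+1 -> K) p : p.@[x] =
  (map_poly (meval (x \o widen_ord (leqnSn n))) (muni p)).[x ord_max].
Proof.
apply: (@mpoly_rmorph_eq _ _ _ (meval x)
  (horner_eval (x ord_max) \o map_poly (meval (x \o widen_ord (leqnSn n)))
    \o @muni n K)) => [c|i] /=; rewrite /horner_eval.
  by rewrite mevalC muniC map_polyC hornerC /= mevalC.
have [->|[j ->]] := ordS_ind i; first by rewrite muni_Xmax map_polyX hornerX mevalXU.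
by rewrite muni_X map_polyC hornerC /= !mevalXU.
Qed.

End MpolyMorph.

Lemma factorial_mpoly (K : fieldType) n : factorial_domain {mpoly K[n]}.
Proof.
elim: n => [|n IHn].
  move=> a a0; exists a, [::]; split=> //; last by rewrite big_nil mulr1.
  rewrite (nvar0_mpolyC a) in a0 *; move: a0; rewrite mpolyC_eq0 => a0.
  by exists (a@_0%MM)^-1%:MP; rewrite -mpolyCM mulVf.
apply: (@factorial_iso {poly {mpoly K[n]}} {mpoly K[n.+1]} (@multi n K) (@muni n K)).
- exact: multiK.
- exact: muniK.
- exact: factorial_poly.
Qed.

Lemma mpolyXU_neq0 (K : fieldType) n (i : 'I_n) : 'X_i != 0 :> {mpoly K[n]}.
Proof.
apply/eqP => /(congr1 (mcoeff U_(i)%MM)); rewrite mcoeffXU eqxx mcoeff0 => /eqP.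
by rewrite oner_eq0.
Qed.

(** * The Nullstellensatz for hypersurfaces *)

Section Nullstellensatz.
Variable K : closedFieldType.

Lemma horner_eq0 (p : {poly K}) : (forall x, p.[x] = 0) -> p = 0.
Proof.
move=> h; apply/eqP; apply: contraT => /closed_nonrootP [x].
by rewrite /root h eqxx.
Qed.

Definition snoc n (x : 'I_n -> K) (t : K) (i : 'I_n.+1) : K :=
  if insub (val i) is Some j then x j else t.

Lemma snoc_max n (x : 'I_n -> K) t : snoc x t ord_max = t.
Proof. by rewrite /snoc insubN //= ltnn. Qed.

Lemma snoc_widen n (x : 'I_n -> K) t : snoc x t \o widen_ord (leqnSn n) =1 x.
Proof. by move=> i; rewrite /= /snoc /= valK. Qed.

Lemma meval_snoc n (x : 'I_n -> K) t (p : {mpoly K[n.+1]}) :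
  p.@[snoc x t] = (map_poly (meval x) (muni p)).[t].
Proof.
rewrite meval_muni snoc_max; congr (_.[_]); apply/polyP => i.
by rewrite !coef_map /=; apply: meval_eq; exact: snoc_widen.
Qed.

Lemma mpoly_eq0 n (p : {mpoly K[n]}) : (forall x, p.@[x] = 0) -> p = 0.
Proof.
elim: n p => [|n IHn] p h.
  by have := h (fun=> 0); rewrite (nvar0_mpolyC p) mevalC => ->; rewrite mpolyC0.
apply: (can_inj (@muniK _ _)); rewrite muni0; apply/polyP => i; rewrite coef0.
apply: IHn => x; have -> : ((muni p)`_i).@[x] = (map_poly (meval x) (muni p))`_i.
  by rewrite coef_map.
by rewrite (@horner_eq0 (map_poly _ _)) ?coef0 // => t; rewrite -meval_snoc.
Qed.

(** Induction on [n]. If [h] is free of the last variable, it divides each coefficient of [f].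
    Otherwise, if [h] does not divide [f], a Bezout relation gives a nonzero [r], free of the last
    variable, vanishing at all common zeros. Over a point where [r] and the leading coefficient of
    [h] are nonzero, [h] has a root; [f] vanishes there too, which contradicts the choice of the
    point. *)
Lemma dvd_of_zeros n (h f : {mpoly K[n]}) : prime_elt h ->
  (forall x, h.@[x] = 0 -> f.@[x] = 0) -> dvd h f.
Proof.
elim: n h f => [|n IHn] h f hP hf.
  case: hP => h0 h1 _; case: h1.
  rewrite (nvar0_mpolyC h) in h0 *; move: h0; rewrite mpolyC_eq0 => h0.
  by exists (h@_0%MM)^-1%:MP; rewrite -mpolyCM mulVf.
apply/(dvd_iso (@muniK n K)); pose H := muni h; pose F := muni f.
have HP : prime_elt H by apply/(prime_iso (@muniK n K) (@multiK n K)).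
change (dvd H F); have [sH|sH] := leqP (size H) 1.
  have HE := size1_polyC sH; rewrite HE; apply/dvd_polyC => i; apply: IHn.
    by apply/prime_polyC; rewrite -HE.
  move=> x Hx; have -> : (F`_i).@[x] = (map_poly (meval x) F)`_i by rewrite coef_map.
  rewrite (@horner_eq0 (map_poly _ _)) ?coef0 // => t; rewrite -meval_snoc.
  by apply: hf; rewrite meval_snoc -/H HE map_polyC hornerC.
have Hprim := prime_primitive HP sH; have Hirr := prime_degree_irreducible HP.
have R_ufd := @factorial_mpoly K n.
have [cop|] := boolP (coprimep H F); last exact: dvd_not_coprime.
have [r [r0 rP]] := coprime_common_root K cop.
have [H0 _ _] := HP.
have [x /eqP xP] : exists x, (r * lead_coef H).@[x] <> 0.
  apply/not_existsP => nx; suff /eqP : r * lead_coef H = 0.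
    by rewrite mulf_eq0 (negPf r0) lead_coef_eq0 (negPf H0).
  by apply: mpoly_eq0 => x; apply: contrapT => /nx.
move: xP; rewrite mevalM mulf_eq0 => /norP [rx lx].
have sHx : size (map_poly (meval x) H) = size H by rewrite size_map_poly_id0.
have [t] : exists t, root (map_poly (meval x) H) t.
  by apply/closed_rootP; rewrite sHx eq_sym neq_ltn sH.
rewrite /root -meval_snoc => /eqP ht.
move/eqP: rx; case; apply: (rP (meval x) t).
  by rewrite -meval_snoc.
by rewrite -meval_snoc hf.
Qed.

End Nullstellensatz.

(** * Homogeneous polynomials *)

Section Homogeneous.
Variables (K : fieldType) (n : nat).
Implicit Types p q : {mpoly K[n]}.

(* The substitution x_i -> x_i t: the homogeneous components become the        *)
(* coefficients of a univariate polynomial in t.                               *)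
Definition grade : {mpoly K[n]} -> {poly {mpoly K[n]}} :=
  mmap (polyC \o @mpolyC n K) (fun i => 'X_i *: 'X).

HB.instance Definition _ := GRing.RMorphism.copy grade
  (mmap (polyC \o @mpolyC n K) (fun i => 'X_i *: 'X)).

Lemma gradeX m : grade 'X_[m] = 'X_[m] *: 'X^(mdeg m).
Proof.
rewrite /grade mmapX /mmap1 mpolyXE_id mdegE.
elim/big_rec3: _ => [|i a b c _ ->]; first by rewrite expr0 scale1r.
by rewrite exprZn -scalerAl -scalerAr scalerA exprD.
Qed.

Lemma coef_grade p k : (grade p)`_k = pihomog mdeg k p.
Proof.
rewrite [in LHS](mpolyE p) [in RHS](mpolyE p) rmorph_sum linear_sum coef_sum.
apply: eq_bigr => m _; rewrite linearZ /= pihomogX -mul_mpolyC rmorphM /= gradeX.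
rewrite {1}/grade mmapC /= coefCM coefZ coefXn eq_sym mul_mpolyC.
by case: eqP => _; rewrite ?mulr1 ?mulr0 ?mulr_natr.
Qed.

Lemma grade_dhomog p d : p \is d.-homog -> grade p = p%:P * 'X^d.
Proof.
move=> hp; apply/polyP => k; rewrite coef_grade coefCM coefXn.
have [->|kd] := eqVneq k d; first by rewrite mulr1 pihomog_dE.
by rewrite mulr0 (pihomog_ne0 _ hp) // eq_sym.
Qed.

Lemma mulX_factor (R : idomainType) (f g : {poly R}) c k : c != 0 ->
  f * g = c%:P * 'X^k -> exists a e, f = a%:P * 'X^e.
Proof.
move=> c0; elim: k f g => [|k IHk] f g e.
  have : f * g != 0 by rewrite e expr0 mulr1 polyC_eq0.
  rewrite mulf_eq0 => /norP [f0 g0]; exists f`_0, 0%N; rewrite expr0 mulr1.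
  apply: size1_polyC; move/(congr1 (fun p : {poly R} => size p)): e.
  rewrite expr0 mulr1 size_polyC c0 size_mul //.
  by move: f0 g0; rewrite -!size_poly_gt0; lia.
have X0 : 'X != 0 :> {poly R} by rewrite polyX_eq0.
have fX (h : {poly R}) : h.[0] = 0 -> exists h', h = h' * 'X.
  by move/eqP => /factor_theorem [h' ->]; exists h'; rewrite subr0.
have : (f * g).[0] = 0 by rewrite e hornerM hornerXn exprS mul0r mulr0.
rewrite hornerM => /eqP; rewrite mulf_eq0 => /orP[] /eqP /fX [h hE].
  have [|a [d hE']] := IHk h g.
    by apply: (mulIf X0); rewrite mulrAC -hE e exprSr mulrA.
  by exists a, d.+1; rewrite hE hE' exprSr mulrA.
apply: (IHk f h); apply: (mulIf X0).
by rewrite -mulrA -hE e exprSr mulrA.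
Qed.

(** Under [grade], a homogeneous polynomial becomes a monomial in t, and the factors of a monomial
    over a domain are monomials ([mulX_factor]). *)
Lemma dhomog_factor p q d : p * q != 0 -> p * q \is d.-homog ->
  exists e, p \is e.-homog.
Proof.
move=> pq0 pqd.
have e : grade p * grade q = (p * q)%:P * 'X^d by rewrite -rmorphM; exact: grade_dhomog.
have [a [m pE]] := mulX_factor pq0 e.
have : horner_eval 1 (grade p) = p.
  apply: (@mpoly_rmorph_eq _ _ _ (horner_eval 1 \o grade) idfun) => [c|i] /=.
    by rewrite /grade mmapC /= horner_evalE hornerC.
  by rewrite /grade mmapX mmap1U horner_evalE hornerZ hornerX mulr1.
rewrite horner_evalE pE hornerM hornerC hornerXn expr1n mulr1 => ap.
by exists m; rewrite homog_piE -coef_grade pE coefCM coefXn eqxx mulr1 ap.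
Qed.

Lemma dhomog_quotient p q d e : p != 0 -> p \is e.-homog -> q * p \is d.-homog ->
  q = 0 \/ (e <= d)%N /\ q \is (d - e).-homog.
Proof.
move=> p0 pe qpd; have [|q0] := eqVneq q 0; [by left|right].
have qp0 : q * p != 0 by rewrite mulf_neq0.
have [k qk] := dhomog_factor qp0 qpd.
have kd := dhomog_uniq qp0 (dhomogM qk pe) qpd.
by rewrite -kd leq_addl addnK.
Qed.

Lemma meval_dhomog p d (c : K) (x : 'I_n -> K) : p \is d.-homog ->
  p.@[fun i => c * x i] = c ^+ d * p.@[x].
Proof.
move=> /dhomogP pd; rewrite !mevalE mulr_sumr !big_seq; apply: eq_bigr => m mp.
rewrite mulrCA; congr (_ * _); rewrite -(pd _ mp) /= mdegE.
rewrite -prodrXr -big_split /=; apply: eq_bigr => i _.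
by rewrite exprMn.
Qed.

Lemma pihomogM p q d e : q \is e.-homog ->
  pihomog mdeg (d + e) (p * q) = pihomog mdeg d p * q.
Proof.
move=> qe; rewrite -!coef_grade rmorphM /= (grade_dhomog qe).
by rewrite mulrA coefMXn ltnNge leq_addl /= addnK coefMC.
Qed.

Lemma pihomogM_lt p q d e : q \is e.-homog -> (d < e)%N ->
  pihomog mdeg d (p * q) = 0.
Proof.
move=> qe de; rewrite -!coef_grade rmorphM /= (grade_dhomog qe).
by rewrite mulrA coefMXn de.
Qed.

End Homogeneous.

Lemma dhomog0_const (K : fieldType) n (p : {mpoly K[n]}) : p \is 0.-homog ->
  p = (p@_0)%:MP.
Proof.
move=> hp; apply/mpolyP => m; rewrite mcoeffC.
have [->|m0] := eqVneq m 0%MM; first by rewrite mulr1.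
by rewrite mulr0 (dhomog_nemf_coeff hp) // mdeg_eq0.
Qed.

Section Zeros.
Variables (K : closedFieldType) (n : nat).
Implicit Types p q h : {mpoly K[n]}.

(** On the coordinate line, either h(1, t) has a root or it is a nonzero constant c. In the second
    case homogeneity gives h(s, 1) = c s^e, which vanishes at s = 0. *)
Lemma homog_zero_line h e (i j : 'I_n) : h \is e.-homog -> (0 < e)%N -> i != j ->
  exists x : 'I_n -> K, [/\ x i != 0 \/ x j != 0,
    forall k, k != i -> k != j -> x k = 0 & h.@[x] = 0].
Proof.
move=> he e0 ij; pose xy (s t : K) k := if k == i then s else if k == j then t else 0.
have sup s t k : k != i -> k != j -> xy s t k = 0 by rewrite /xy => /negPf-> /negPf->.
have xi s t : xy s t i = s by rewrite /xy eqxx.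
have xj s t : xy s t j = t by rewrite /xy eq_sym (negPf ij) eqxx.
pose Q := mmap polyC (fun k => if k == i then 1 else if k == j then 'X else 0) h.
have QE t : Q.[t] = h.@[xy 1 t].
  apply: (@mpoly_rmorph_eq _ _ _ (horner_eval t \o
    mmap polyC (fun k => if k == i then 1 else if k == j then 'X else 0)) (meval (xy 1 t))).
    by move=> c /=; rewrite mmapC horner_evalE hornerC mevalC.
  move=> k /=; rewrite mmapX mmap1U horner_evalE mevalXU /xy.
  by case: eqP => _; [rewrite hornerC|case: eqP => _; rewrite ?hornerX ?hornerC].
have [sQ|/negPf sQ] := boolP (size Q != 1%N).
  have /closed_rootP [t] := sQ; rewrite /root QE => /eqP ht.
  exists (xy 1 t); split=> //; first by left; rewrite xi oner_neq0.
  exact: sup.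
exists (xy 0 1); split=> //; [by right; rewrite xj oner_neq0|exact: sup|].
have /size_poly1P [c c0 QC] : size Q == 1%N by rewrite -[_ == _]negbK sQ.
pose P := mmap polyC (fun k => if k == i then 'X else if k == j then 1 else 0) h.
have PE t : P.[t] = h.@[xy t 1].
  apply: (@mpoly_rmorph_eq _ _ _ (horner_eval t \o
    mmap polyC (fun k => if k == i then 'X else if k == j then 1 else 0)) (meval (xy t 1))).
    by move=> d /=; rewrite mmapC horner_evalE hornerC mevalC.
  move=> k /=; rewrite mmapX mmap1U horner_evalE mevalXU /xy.
  by case: eqP => _; [rewrite hornerX|case: eqP => _; rewrite ?hornerC].
(* Homogeneity gives the identity only for t nonzero; the extra factor ['X] covers t = 0. *)
have : 'X * (P - c%:P * 'X^e) = 0.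
  apply: horner_eq0 => t; rewrite hornerM hornerX hornerD hornerN hornerM hornerC hornerXn PE.
  have [->|t0] := eqVneq t 0; first by rewrite mul0r.
  have -> : h.@[xy t 1] = h.@[fun k => t * xy 1 t^-1 k].
    apply: meval_eq => k; rewrite /xy.
    by case: eqP => _; rewrite ?mulr1 //; case: eqP => _; rewrite ?mulr0 // mulfV.
  by rewrite (meval_dhomog _ _ he) -QE QC hornerC mulrC [c * _]mulrC subrr mul0r.
move/eqP; rewrite mulf_eq0 polyX_eq0 /= subr_eq0 => /eqP PC.
by rewrite -PE PC hornerM hornerXn -(prednK e0) exprS mul0r mulr0.
Qed.

(* A fraction p / q is a polynomial as soon as it is regular along a line,     *)
(* because the denominator of its lowest terms has a zero on every line.       *)
Lemma dvd_of_regular p q d e (i j : 'I_n) : i != j -> q != 0 ->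
    p \is d.-homog -> q \is e.-homog ->
    (forall x : 'I_n -> K, (forall k, k != i -> k != j -> x k = 0) ->
      x i != 0 \/ x j != 0 -> exists p' q', q'.@[x] != 0 /\ p * q' = p' * q) ->
  dvd q p.
Proof.
move=> ij q0 pd qe reg.
have [a [b [g [pE qE low]]]] := lowest_terms p (@factorial_mpoly K n) q0.
have [k bk] : exists k, b \is k.-homog.
  by apply: (@dhomog_factor _ _ b g e); rewrite -qE.
have g0 : g != 0 by apply: contra q0 => /eqP g0; rewrite qE g0 mulr0.
have b0 : b != 0 by apply: contra q0 => /eqP b0; rewrite qE b0 mul0r.
have [k0|k0] := posnP k; last first.
  have [x [xij x0 bx]] := homog_zero_line bk k0 ij.
  have [p' [q' [q'x e']]] := reg _ x0 xij.
  have [|c q'E] := low p' q'.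
    by apply: (mulIf g0); rewrite mulrAC -pE e' qE mulrA.
  by move: q'x; rewrite q'E mevalM bx mulr0 eqxx.
rewrite k0 in bk; have bE := dhomog0_const bk; set c := b@_0 in bE.
have c0 : c != 0 by apply: contra b0 => /eqP c0; rewrite bE c0.
exists (a * c^-1%:MP); rewrite pE qE bE mulrA -[a * _ * _]mulrA -mpolyCM mulVf //.
by rewrite mulr1.
Qed.

End Zeros.

(** * Linear forms and ideals containing the minors of a linear pencil *)

Section LinearForms.
Variable K : fieldType.
Local Notation S := {mpoly K[4]}.
Implicit Types (phi chi psi : 'rV[K]_4) (e : 'cV[K]_4) (f g : S).

(** Linear forms are row vectors, so that the linear field x |-> T x sends the form [phi] to
    [phi *m T]. *)
Definition lf phi : S := \sum_i phi 0 i *: 'X_i.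

Lemma lf_is_linear : linear lf.
Proof.
move=> c phi psi; rewrite /lf scaler_sumr -big_split /=; apply: eq_bigr => i _.
by rewrite !mxE scalerDl scalerA.
Qed.
HB.instance Definition _ := GRing.isLinear.Build K 'rV[K]_4 S *:%R lf lf_is_linear.

Lemma lfZ c phi : lf (c *: phi) = c *: lf phi.
Proof. exact: linearZ. Qed.

Lemma lf_dhomog phi : lf phi \is 1.-homog.
Proof. by apply: rpred_sum => i _; rewrite dhomogZ // dhomogX /= mdeg1. Qed.

Lemma mcoeff_lf phi i : (lf phi)@_U_(i)%MM = phi 0 i.
Proof.
rewrite /lf raddf_sum (bigD1 i) //= mcoeffZ mcoeffXU eqxx mulr1.
by rewrite big1 ?addr0 // => j /negPf ji; rewrite mcoeffZ mcoeffXU ji mulr0.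
Qed.

Lemma lf_inj : injective lf.
Proof. by move=> phi psi e; apply/rowP => i; rewrite -!mcoeff_lf e. Qed.

Lemma lf_eq0 phi : lf phi = 0 -> phi = 0.
Proof. by move=> e; apply: lf_inj; rewrite e raddf0. Qed.

Lemma lf_delta i : lf (delta_mx 0 i) = 'X_i.
Proof.
rewrite /lf (bigD1 i) //= mxE !eqxx scale1r big1 ?addr0 // => j /negPf ji.
by rewrite mxE ji andbF scale0r.
Qed.

Definition in_ideal2 phi psi f := exists a b, f = a * lf phi + b * lf psi.

(* If (e, e') is dual to (phi, psi), then this substitution is the projection  *)
(* of S onto the polynomials on {phi = psi = 0} along the ideal of this set.   *)
Definition proj_subst phi e psi e' : S -> S :=
  mmap (@mpolyC 4 K) (fun i => 'X_i - e i 0 *: lf phi - e' i 0 *: lf psi).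

HB.instance Definition _ phi e psi e' := GRing.RMorphism.copy
  (proj_subst phi e psi e')
  (mmap (@mpolyC 4 K) (fun i => 'X_i - e i 0 *: lf phi - e' i 0 *: lf psi)).

Lemma proj_subst_lf phi e psi e' chi : proj_subst phi e psi e' (lf chi) =
  lf chi - (chi *m e) 0 0 *: lf phi - (chi *m e') 0 0 *: lf psi.
Proof.
rewrite [in LHS]/lf rmorph_sum /= [X in X - _ - _]/lf !mxE !scaler_suml -!sumrB.
apply: eq_bigr => i _; rewrite /proj_subst mmapZ mmapX mmap1U mul_mpolyC.
by rewrite !scalerBr !scalerA.
Qed.

Lemma proj_subst_mod phi e psi e' f :
  in_ideal2 phi psi (f - proj_subst phi e psi e' f).
Proof.
set s := proj_subst phi e psi e'; pose P g := in_ideal2 phi psi (g - s g).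
have sD g h : s (g + h) = s g + s h by exact: rmorphD.
have sM g h : s (g * h) = s g * s h by exact: rmorphM.
have PD g h : P g -> P h -> P (g + h).
  move=> [a [b E]] [a' [b' E']]; exists (a + a'), (b + b').
  rewrite sD [LHS](_ : _ = (g - s g) + (h - s h)); last by ring.
  by rewrite E E'; ring.
have PM g h : P g -> P h -> P (g * h).
  move=> [a [b E]] [a' [b' E']]; exists (a * h + s g * a'), (b * h + s g * b').
  rewrite sM [LHS](_ : _ = (g - s g) * h + s g * (h - s h)); last by ring.
  by rewrite E E'; ring.
have PC c : P c%:MP.
  by exists 0, 0; rewrite /s /proj_subst mmapC subrr !mul0r addr0.
have PX i : P 'X_i.
  exists (e i 0)%:MP, (e' i 0)%:MP; rewrite /s /proj_subst mmapX mmap1U.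
  by rewrite !mul_mpolyC; ring.
suff : P f by [].
rewrite [f]mpolyE; elim/big_ind: _ => // [|m _]; first exact: (PC 0).
rewrite -mul_mpolyC; apply: (PM) => //; rewrite mpolyXE_id.
elim/big_ind: _ => // [|i _]; first exact: (PC 1).
elim: (m i) => [|k IHk]; first by rewrite expr0; exact: (PC 1).
by rewrite exprS; apply: PM.
Qed.

Definition indep phi psi := row_free (col_mx phi psi).

Lemma indep_dual phi psi : indep phi psi -> exists e e',
  [/\ phi *m e = 1%:M, phi *m e' = 0, psi *m e = 0 & psi *m e' = 1%:M].
Proof.
move=> /row_freeP [B]; rewrite -[B]hsubmxK mul_col_row scalar_mx_block.
by move/eq_block_mx => [h1 h2 h3 h4]; exists (lsubmx B), (rsubmx B).
Qed.

Lemma indep_sym phi psi : indep phi psi -> indep psi phi.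
Proof.
by rewrite /indep /row_free -!addsmxE addsmxC.
Qed.

Lemma proj_subst_ideal phi e psi e' f :
  phi *m e = 1%:M -> phi *m e' = 0 -> psi *m e = 0 -> psi *m e' = 1%:M ->
  in_ideal2 phi psi f <-> proj_subst phi e psi e' f = 0.
Proof.
move=> h1 h2 h3 h4; split=> [[a [b ->]]|f0]; last first.
  by have := proj_subst_mod phi e psi e' f; rewrite f0 subr0.
rewrite rmorphD !rmorphM /= !proj_subst_lf h1 h2 h3 h4 !mxE eqxx !mulr1n.
by rewrite !scale1r !scale0r !subr0 !subrr !mulr0 addr0.
Qed.

(** The ideal is the kernel of the endomorphism [proj_subst] of an integral domain, hence prime. *)
Lemma in_ideal2_prime phi psi f g : indep phi psi -> ~ in_ideal2 phi psi f ->
  in_ideal2 phi psi (f * g) -> in_ideal2 phi psi g.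
Proof.
move=> /indep_dual [e [e' [h1 h2 h3 h4]]].
rewrite !(proj_subst_ideal _ h1 h2 h3 h4) rmorphM => /eqP f0 /eqP.
by rewrite mulf_eq0 (negPf f0) => /eqP.
Qed.

(** Setting [phi] to 0, by a [proj_subst] whose second form is 0, leaves g psi = 0 with psi nonzero;
    so [phi] divides [g]. *)
Lemma lf_koszul phi psi f g : indep phi psi -> f * lf phi = g * lf psi ->
  exists c, f = c * lf psi /\ g = c * lf phi.
Proof.
move=> /indep_dual [e [e' [h1 h2 h3 h4]]] fg.
have phi0 : lf phi != 0.
  apply: contra_eq_neq h1 => /lf_eq0 ->; rewrite mul0mx eq_sym.
  by apply/eqP => /matrixP/(_ 0 0); rewrite !mxE => /eqP; rewrite oner_eq0.
have psi0 : lf psi != 0.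
  apply: contra_eq_neq h4 => /lf_eq0 ->; rewrite mul0mx eq_sym.
  by apply/eqP => /matrixP/(_ 0 0); rewrite !mxE => /eqP; rewrite oner_eq0.
pose s := proj_subst phi e 0 0.
have sphi : s (lf phi) = 0.
  by rewrite /s proj_subst_lf h1 !mxE eqxx raddf0 scaler0 subr0 scale1r subrr.
have spsi : s (lf psi) = lf psi.
  by rewrite /s proj_subst_lf h3 !mxE raddf0 scaler0 scale0r !subr0.
have sg : s g = 0.
  have /eqP := congr1 s fg; rewrite /s !rmorphM /= -!/(s _) sphi spsi mulr0 eq_sym mulf_eq0.
  by rewrite (negPf psi0) orbF => /eqP.
have [c [b]] := proj_subst_mod phi e 0 0 g.
rewrite -/s sg subr0 raddf0 mulr0 addr0 => gE; exists c; split=> //.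
by apply: (mulIf phi0); rewrite fg gE; ring.
Qed.

Lemma in_ideal2_lf phi psi chi : in_ideal2 phi psi (lf chi) ->
  indep phi psi -> (chi <= col_mx phi psi)%MS.
Proof.
move=> h /indep_dual [e [e' [h1 h2 h3 h4]]].
move/(proj_subst_ideal _ h1 h2 h3 h4): h; rewrite proj_subst_lf -!linearZ -!linearB.
move/lf_eq0/eqP; rewrite -addrA -opprD subr_eq0 => /eqP ->.
by rewrite -addsmxE addmx_sub_adds // scalemx_sub.
Qed.

Lemma exists_row_notin m n (U : 'M[K]_(m, 4)) (V : 'M[K]_(n, 4)) :
  (\rank V < \rank U)%N -> exists2 u : 'rV_4, (u <= U)%MS & ~~ (u <= V)%MS.
Proof.
move=> r; have : ~~ (U <= V)%MS.
  by apply: contraL r => /mxrankS; rewrite -leqNgt.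
by move/row_subPn => [i ui]; exists (row i U); rewrite ?row_sub.
Qed.

Lemma indepP phi psi : phi != 0 -> ~~ (psi <= phi)%MS -> indep phi psi.
Proof.
move=> phi0 psiphi; rewrite /indep /row_free eqn_leq rank_leq_row /=.
have r1 : \rank phi = 1%N by rewrite rank_rV phi0.
rewrite -addsmxE -[X in (X < _)%N]r1; apply: rank_ltmx.
rewrite /ltmx addsmxSl /=; apply: contra psiphi => h.
exact: submx_trans (addsmxSr _ _) h.
Qed.

Lemma indep_rank phi psi : indep phi psi -> \rank (col_mx phi psi) = 2.
Proof. by move=> /eqP. Qed.

Lemma indep_n0 phi psi : indep phi psi -> phi != 0.
Proof.
apply: contraTneq => ->; rewrite /indep /row_free -addsmxE adds0mx.
by rewrite neq_ltn (leq_ltn_trans (rank_leq_row _)).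
Qed.

Definition ideal_pred (J : S -> Prop) :=
  (forall f g, J f -> J g -> J (f + g)) /\ (forall f g, J g -> J (f * g)).

(** As (phi, psi) is prime, an [f] outside it makes (phi, psi, f) an ideal of codimension at least
    3. The condition forbids isolated and embedded points in the zero scheme of [J]. *)
Definition saturated3 (J : S -> Prop) := forall phi psi f g, indep phi psi ->
  ~ in_ideal2 phi psi f -> J (lf phi * g) -> J (lf psi * g) -> J (f * g) -> J g.

Definition saturated2 (J : S -> Prop) := forall phi psi g, indep phi psi ->
  J (lf phi * g) -> J (lf psi * g) -> J g.

Lemma saturated23 J : saturated2 J -> saturated3 J.
Proof. by move=> h phi psi f g ind _ h1 h2 _; exact: h ind h1 h2. Qed.

Section Ideals.
Variable J : S -> Prop.
Hypotheses (J_ideal : ideal_pred J) (J_sat : saturated3 J).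

Let JD := J_ideal.1.
Let JM := J_ideal.2.

Lemma ideal_scale c f : J f -> J (c *: f).
Proof. by rewrite -mul_mpolyC; exact: JM. Qed.

(** Saturation is applied to three independent forms of [U]: the third is not in the prime ideal of
    the first two. *)
Lemma ideal_lf_rank3 m (U : 'M[K]_(m, 4)) f : (2 < \rank U)%N ->
  (forall u : 'rV_4, (u <= U)%MS -> J (lf u * f)) -> J f.
Proof.
move=> r h.
have [|u uU u0] := @exists_row_notin _ _ U (0 : 'M_(1, 4)); first by rewrite mxrank0; lia.
have {}u0 : u != 0 by apply: contra u0 => /eqP ->; exact: sub0mx.
have [|u' u'U u'u] := @exists_row_notin _ _ U u; first by rewrite rank_rV u0; lia.
have ind := indepP u0 u'u.
have [|w wU wu] := @exists_row_notin _ _ U (col_mx u u'); first by rewrite indep_rank.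
apply: (J_sat ind (f := lf w)); try exact: h.
by move=> /in_ideal2_lf /(_ ind); exact/negP.
Qed.

Lemma ideal_lf_sub m n (U : 'M[K]_(m, 4)) (V : 'M[K]_(n, 4)) f :
  (forall u : 'rV_4, (u <= U)%MS -> J (lf u * f)) ->
  (forall u : 'rV_4, (u <= V)%MS -> J (lf u * f)) ->
  forall u : 'rV_4, (u <= U + V)%MS -> J (lf u * f).
Proof.
move=> hU hV u /sub_addsmxP [[a b] /= ->]; rewrite raddfD mulrDl.
by apply: JD; [apply: hU|apply: hV]; rewrite submxMl.
Qed.

End Ideals.
End LinearForms.

(** * Ideals containing the minors of (x, T x) *)

Section Pencil.
Variable K : closedFieldType.
Local Notation S := {mpoly K[4]}.
Variable T : 'M[K]_4.
Implicit Types (phi chi psi : 'rV[K]_4).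

(** This is an eigenvector of [T] modulo [L]. The linear factors of the characteristic polynomial
    are applied in turn to a row of [W] outside [L]; by Cayley-Hamilton the result ends in [L], and
    the last vector outside [L] is taken. *)
Lemma eigen_mod m (W : 'M[K]_4) (L : 'M[K]_(m, 4)) : (W *m T <= W)%MS -> ~~ (W <= L)%MS ->
  exists phi a, [/\ (phi <= W)%MS, ~~ (phi <= L)%MS & (phi *m (T - a%:M) <= L)%MS].
Proof.
move=> WT /row_subPn [i wi]; set w := row i W in wi.
have wW : (w <= W)%MS by exact: row_sub.
have [r rE] := closed_field_poly_normal (char_poly T).
move: rE; rewrite (monicP (char_poly_monic T)) scale1r => rE.
have : (w *m horner_mx T (\prod_(z <- r) ('X - z%:P)) <= L)%MS.
  by rewrite -rE Cayley_Hamilton mulmx0 sub0mx.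
elim: r w wi wW {rE} => [|a r IHr] w wL wW.
  by rewrite big_nil rmorph1 mulmx1 (negPf wL).
rewrite big_cons rmorphM /= rmorphB /= horner_mx_X horner_mx_C mulmxA.
have [h _|/IHr] := boolP (w *m (T - a%:M) <= L)%MS; first by exists w, a.
apply; rewrite mulmxBr addmx_sub ?eqmx_opp ?mul_mx_scalar ?scalemx_sub //.
by apply: submx_trans WT; exact: submxMr.
Qed.

Variable J : S -> Prop.
Hypotheses (J_ideal : ideal_pred J) (J_sat : saturated3 J).

Definition pencil_minors (N : 'M[K]_4) := forall phi psi,
  J (lf phi * lf (psi *m N) - lf psi * lf (phi *m N)).

(** Subtracting a multiple of x from the field does not change its minors against x. *)
Lemma pencil_minors_shift (N : 'M[K]_4) a :
  pencil_minors N -> pencil_minors (N - a%:M).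
Proof.
move=> h phi psi; rewrite !mulmxBr !mul_mx_scalar !raddfB /= !linearZ /=.
rewrite -!mul_mpolyC; have := h phi psi; congr (J _); ring.
Qed.

Hypothesis J_minors : pencil_minors T.

(** In the minor of [phi] and any w, the term containing [phi *m (T - a%:M)] already lies in [J];
    what remains is the product of [phi] with w (T - a). *)
Lemma eigen_mod_ideal m (L : 'M[K]_(m, 4)) phi a :
  (forall u : 'rV_4, (u <= L)%MS -> J (lf u)) -> (phi *m (T - a%:M) <= L)%MS ->
  forall u : 'rV_4, (u <= (T - a%:M)%R + L)%MS -> J (lf u * lf phi).
Proof.
move=> JL phiL; apply: ideal_lf_sub => // u uU; last first.
  by rewrite mulrC; apply: J_ideal.2; exact: JL.
have /submxP [w ->] := uU.
have h1 := pencil_minors_shift a J_minors phi w.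
have h2 : J (lf w * lf (phi *m (T - a%:M))) by apply: J_ideal.2; exact: JL.
by have := J_ideal.1 _ _ h1 h2; rewrite subrK mulrC.
Qed.

Lemma ideal_one : (forall phi, J (lf phi)) -> J 1.
Proof.
move=> h; apply: (@ideal_lf_rank3 _ _ J_sat _ 1%:M).
  by rewrite mxrank1.
by move=> u _; rewrite mulr1.
Qed.

(* When all the eigenspaces are lines, J contains an invariant flag. *)
Lemma nonderogatory_ideal :
  (forall a : K, (2 < \rank (T - a%:M)%R)%N) -> J 1.
Proof.
move=> rT; apply: ideal_one.
suff flag n (L : 'M[K]_4) : (4 - \rank L <= n)%N -> (L *m T <= L)%MS ->
    (forall u : 'rV_4, (u <= L)%MS -> J (lf u)) -> forall phi, J (lf phi).
  apply: (@flag 4%N 0) => [||u]; [exact: leq_subr|by rewrite mul0mx sub0mx|].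
  rewrite submx0 => /eqP ->; rewrite raddf0 -(mul0r (lf u * lf (u *m T) - lf u * lf (u *m T))).
  exact: (J_ideal.2 _ _ (J_minors u u)).
elim: n L => [|n IHn] L rL LT JL.
  move=> phi; apply: JL; apply: submx_full.
  by rewrite /row_full eqn_leq rank_leq_row; lia.
have [L1|L1] := boolP (1%:M <= L)%MS.
  by move=> phi; apply: JL; apply: submx_trans L1; exact: submx1.
have [phi [a [_ phiL phiT]]] := eigen_mod (submx1 _) L1.
apply: (IHn (L + phi)%MS).
- have : (\rank L < \rank (L + phi)%MS)%N.
    by apply: rank_ltmx; rewrite /ltmx addsmxSl addsmx_sub submx_refl.
  lia.
- rewrite addsmxMr addsmx_sub (submx_trans LT) ?addsmxSl //=.
  have -> : phi *m T = phi *m (T - a%:M) + a *: phi.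
    by rewrite mulmxBr mul_mx_scalar subrK.
  rewrite addmx_sub //; first exact: submx_trans phiT (addsmxSl _ _).
  by rewrite scalemx_sub // addsmxSr.
- have Jphi : J (lf phi).
    apply: (@ideal_lf_rank3 _ _ J_sat _ ((T - a%:M)%R + L)%MS).
      exact: leq_trans (rT a) (mxrankS (addsmxSl _ _)).
    exact: eigen_mod_ideal.
  move=> u /sub_addsmxP [[c b] /= ->]; rewrite raddfD /=.
  apply: J_ideal.1; first by apply: JL; rewrite submxMl.
  by rewrite [b]mx11_scalar mul_scalar_mx lfZ; exact: ideal_scale.
Qed.

Definition two_lines_ideal (phi0 phi1 phi2 phi3 : 'rV[K]_4) :=
  [/\ J (lf phi0 * lf phi2), J (lf phi0 * lf phi3), J (lf phi1 * lf phi2) &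
      J (lf phi1 * lf phi3)].

Definition double_line_ideal (phi0 phi1 phi2 phi3 : 'rV[K]_4) :=
  [/\ J (lf phi0 * lf phi0), J (lf phi0 * lf phi1), J (lf phi1 * lf phi1) &
      J (lf phi0 * lf phi3 - lf phi1 * lf phi2)].

Definition frame (phi0 phi1 phi2 phi3 : 'rV[K]_4) :=
  row_free (col_mx (col_mx phi0 phi1) (col_mx phi2 phi3)).

Lemma sub_eq_rank m n (U : 'M[K]_(m, 4)) (V : 'M[K]_(n, 4)) : (U <= V)%MS ->
  \rank U = \rank V -> (V <= U)%MS.
Proof. by move=> UV e; have := mxrank_leqif_sup UV; rewrite /leqif e eqxx => -[_ <-]. Qed.

Lemma exists_indep m (U : 'M[K]_(m, 4)) : (1 < \rank U)%N ->
  exists phi psi, [/\ (phi <= U)%MS, (psi <= U)%MS & indep phi psi].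
Proof.
move=> r; have [|u uU u0] := @exists_row_notin _ _ _ U (0 : 'M_(1, 4)).
  by rewrite mxrank0; lia.
have {}u0 : u != 0 by apply: contra u0 => /eqP ->; exact: sub0mx.
have [|u' u'U u'u] := @exists_row_notin _ _ _ U u; first by rewrite rank_rV u0; lia.
by exists u, u'; split=> //; exact: indepP.
Qed.

Lemma sub_indep m (U : 'M[K]_(m, 4)) phi psi : \rank U = 2 -> (phi <= U)%MS ->
  (psi <= U)%MS -> indep phi psi -> (U <= col_mx phi psi)%MS.
Proof.
move=> rU phiU psiU /indep_rank ind.
apply: sub_eq_rank; last by rewrite ind rU.
by rewrite -addsmxE addsmx_sub phiU.
Qed.

(* A preimage chi of psi turns the minor of (chi, kappa) into a product. *)
Lemma image_kernel_ideal kappa psi : (kappa <= kermx T)%MS -> (psi <= T)%MS ->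
  J (lf kappa * lf psi).
Proof.
move=> /sub_kermxP kT /submxP [chi ->].
have := J_minors kappa chi; rewrite kT raddf0 mulr0 subr0 //.
Qed.

(** A vector phi common to kernel and image multiplies both of them into [J], and their sum has rank
    3, so phi lies in [J]. Then psi, an eigenvector in the image modulo phi, is treated in the same
    way. *)
Lemma image_meets_kernel_ideal : \rank T = 2 ->
  (forall b : K, (1 < \rank (T - b%:M)%R)%N) -> \rank (kermx T :&: T)%MS = 1%N ->
  exists phi psi, [/\ indep phi psi, J (lf phi) & J (lf psi)].
Proof.
move=> rT rTb rcap.
have rker : \rank (kermx T) = 2 by rewrite mxrank_ker rT.
have rsum : \rank (kermx T + T)%MS = 3.
  by have := mxrank_sum_cap (kermx T) T; rewrite rcap rker rT; lia.
have [|phi phiI phi0] := @exists_row_notin _ _ _ (kermx T :&: T)%MS (0 : 'M_(1, 4)).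
  by rewrite mxrank0 rcap.
have {}phi0 : phi != 0 by apply: contra phi0 => /eqP ->; exact: sub0mx.
move: phiI; rewrite sub_capmx => /andP[phik phiT].
have phiT0 : phi *m T = 0 by exact/sub_kermxP.
have Jphi : J (lf phi).
  apply: (@ideal_lf_rank3 _ _ J_sat _ (kermx T + T)%MS); first by rewrite rsum.
  apply: ideal_lf_sub => // u uU; first exact: image_kernel_ideal.
  by rewrite mulrC; exact: image_kernel_ideal.
have Tphi : ~~ (T <= phi)%MS.
  by apply/negP => /mxrankS; rewrite rT rank_rV phi0.
have [psi [b [psiT psiphi psib]]] := eigen_mod (submxMl _ _) Tphi.
exists phi, psi; split=> //; first exact: indepP.
have Jl (u : 'rV_4) : (u <= phi)%MS -> J (lf u).
  move=> /sub_rVP [c ->].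
  by rewrite lfZ; exact: ideal_scale.
have step : forall u : 'rV_4, (u <= (T - b%:M)%R + kermx T)%MS -> J (lf u * lf psi).
  apply: ideal_lf_sub => // u uU.
    apply: (eigen_mod_ideal Jl psib).
    exact: submx_trans uU (addsmxSl _ _).
  exact: image_kernel_ideal.
apply: (@ideal_lf_rank3 _ _ J_sat _ _ _ _ step).
have [b0|b0] := eqVneq b 0.
  by rewrite b0 raddf0 subr0 addsmxC rsum.
(* For b nonzero, a rank of at most 2 would force the b-eigenspace to be the whole image of [T]; phi
   would then have both eigenvalues b and 0. *)
rewrite ltnNge; apply/negP => r2.
have rb : \rank (T - b%:M)%R = 2.
  apply/eqP; rewrite eqn_leq rTb andbT.
  by apply: leq_trans r2; exact/mxrankS/addsmxSl.
pose V := kermx (T - b%:M).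
have VE : (T <= V)%MS.
  apply: sub_eq_rank; last by rewrite mxrank_ker rb rT.
  have : V *m (T - b%:M) = 0 by exact: mulmx_ker.
  rewrite mulmxBr mul_mx_scalar => /eqP; rewrite subr_eq0 => /eqP e.
  rewrite -[V]scale1r -(mulVf b0) -scalerA -e scalemx_sub //.
  exact: submxMl.
have : phi *m (T - b%:M) = 0 by apply/sub_kermxP; exact: submx_trans VE.
rewrite mulmxBr phiT0 mul_mx_scalar sub0r => /eqP; rewrite oppr_eq0.
by rewrite scalemx_eq0 (negPf b0) (negPf phi0).
Qed.

(** The cases are the dimensions 1, 0 and 2 of the intersection of kernel and image. When both
    coincide, phi0 and phi1 span them, phi2 and phi3 are preimages, and the quadric of the double
    line is the minor of phi2 and phi3. *)
Lemma derogatory_ideal : \rank T = 2 -> (forall b : K, (1 < \rank (T - b%:M)%R)%N) ->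
  [\/ exists phi psi, [/\ indep phi psi, J (lf phi) & J (lf psi)],
      exists phi0 phi1 phi2 phi3,
        frame phi0 phi1 phi2 phi3 /\ two_lines_ideal phi0 phi1 phi2 phi3
    | exists phi0 phi1 phi2 phi3,
        frame phi0 phi1 phi2 phi3 /\ double_line_ideal phi0 phi1 phi2 phi3].
Proof.
move=> rT rTb; have rker : \rank (kermx T) = 2 by rewrite mxrank_ker rT.
have := mxrank_sum_cap (kermx T) T; rewrite rker rT.
have : (\rank (kermx T :&: T)%MS <= 2)%N by rewrite -[X in (_ <= X)%N]rT mxrankS ?capmxSr.
case rcap : (\rank (kermx T :&: T)%MS) => [|[|[|//]]] _ rsum.
- apply: Or32.
  have [|phi0 [phi1 [h0 h1 ind01]]] := @exists_indep _ (kermx T); first by rewrite rker.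
  have [|phi2 [phi3 [h2 h3 ind23]]] := @exists_indep _ T; first by rewrite rT.
  exists phi0, phi1, phi2, phi3; split; last by split; exact: image_kernel_ideal.
  rewrite /frame /row_free eqn_leq rank_leq_row /=.
  have r4 : (4 <= \rank (kermx T + T)%MS)%N by move: rsum; rewrite addn0 => ->.
  apply: leq_trans r4 _; rewrite -addsmxE.
  by apply/mxrankS/addsmxS; apply: sub_indep.
- by apply: Or31; apply: image_meets_kernel_ideal.
- apply: Or33.
  have kerT : (T <= kermx T)%MS.
    apply: submx_trans (capmxSl _ T).
    by apply: sub_eq_rank; [exact: capmxSr|rewrite rcap rT].
  have [|phi0 [phi1 [h0 h1 ind01]]] := @exists_indep _ T; first by rewrite rT.
  have [phi2 e0] := submxP h0; have [phi3 e1] := submxP h1.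
  have k0 := submx_trans h0 kerT; have k1 := submx_trans h1 kerT.
  have z0 := sub_kermxP k0; have z1 := sub_kermxP k1.
  exists phi0, phi1, phi2, phi3; split.
    apply: inj_row_free => v; rewrite -[v]hsubmxK mul_row_col.
    set a := lsubmx v; set b := rsubmx v => e.
    have b0 : b = 0.
      apply: (row_free_inj ind01); rewrite mul0mx.
      have := congr1 (mulmx^~ T) e; rewrite mulmxDl mul0mx -!mulmxA !mul_col_mx z0 z1.
      by rewrite col_mx0 mulmx0 add0r -e0 -e1.
    move: e; rewrite b0 mul0mx addr0 => e.
    suff -> : a = 0 by exact: row_mx0.
    by apply: (row_free_inj ind01); rewrite mul0mx.
  split; try exact: image_kernel_ideal.
  by have := J_minors phi2 phi3; rewrite -e0 -e1 -(mulrN1) => h; have := J_ideal.2 (-1) _ h; congr (J _); ring.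
Qed.

End Pencil.

(** * Determination of the saturated ideals *)

Section PencilCases.
Variable K : closedFieldType.
Local Notation S := {mpoly K[4]}.
Variables (T : 'M[K]_4) (J : S -> Prop).
Hypotheses (J_ideal : ideal_pred J) (J_minors : pencil_minors J T).
Hypothesis T_rank : forall a : K, (1 < \rank (T - a%:M)%R)%N.

Lemma pencil_trichotomy : saturated3 J ->
  J 1 \/
  [\/ exists phi psi, [/\ indep phi psi, J (lf phi) & J (lf psi)],
      exists phi0 phi1 phi2 phi3,
        frame phi0 phi1 phi2 phi3 /\ two_lines_ideal J phi0 phi1 phi2 phi3
    | exists phi0 phi1 phi2 phi3,
        frame phi0 phi1 phi2 phi3 /\ double_line_ideal J phi0 phi1 phi2 phi3].
Proof.
move=> J_sat; have [rT|] := pselect (forall a : K, (2 < \rank (T - a%:M)%R)%N).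
  by left; exact: (nonderogatory_ideal J_ideal J_sat J_minors).
move=> /existsNP [a /negP]; rewrite -leqNgt => ra; right.
have ra2 : \rank (T - a%:M)%R = 2 by apply/eqP; rewrite eqn_leq ra T_rank.
apply: (derogatory_ideal J_ideal J_sat (pencil_minors_shift a J_minors) ra2).
by move=> b; rewrite -addrA -opprD -raddfD; exact: T_rank.
Qed.

Lemma frame_dual (p0 p1 p2 p3 : 'rV[K]_4) : frame p0 p1 p2 p3 ->
  exists e0 e1 e2 e3 : 'cV[K]_4,
  [/\ [/\ p0 *m e0 = 1%:M, p0 *m e1 = 0, p0 *m e2 = 0 & p0 *m e3 = 0],
      [/\ p1 *m e0 = 0, p1 *m e1 = 1%:M, p1 *m e2 = 0 & p1 *m e3 = 0],
      [/\ p2 *m e0 = 0, p2 *m e1 = 0, p2 *m e2 = 1%:M & p2 *m e3 = 0] &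
      [/\ p3 *m e0 = 0, p3 *m e1 = 0, p3 *m e2 = 0 & p3 *m e3 = 1%:M]].
Proof.
move=> /row_freeP [B]; rewrite -[B]hsubmxK mul_col_row scalar_mx_block.
move/eq_block_mx; rewrite -[lsubmx B]hsubmxK -[rsubmx B]hsubmxK !mul_col_row.
rewrite !scalar_mx_block -(@block_mx0 _ 1 1 1 1).
move=> [/eq_block_mx [a1 a2 a3 a4] /eq_block_mx [b1 b2 b3 b4]].
move=> /eq_block_mx [c1 c2 c3 c4] /eq_block_mx [d1 d2 d3 d4].
exists (lsubmx (lsubmx B)), (rsubmx (lsubmx B)), (lsubmx (rsubmx B)), (rsubmx (rsubmx B)).
by split; split.
Qed.

Lemma dual_indep (phi psi : 'rV[K]_4) (e e' : 'cV[K]_4) : phi *m e = 1%:M ->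
  phi *m e' = 0 -> psi *m e = 0 -> psi *m e' = 1%:M -> indep phi psi.
Proof.
move=> h1 h2 h3 h4; apply/row_freeP; exists (row_mx e e').
by rewrite mul_col_row h1 h2 h3 h4 -scalar_mx_block.
Qed.

Lemma frame_indep (p0 p1 p2 p3 : 'rV[K]_4) : frame p0 p1 p2 p3 ->
  [/\ indep p0 p1, indep p2 p3 & indep p1 p3].
Proof.
move=> /frame_dual [e0 [e1 [e2 [e3 [[a0 a1 a2 a3] [b0 b1 b2 b3] [c0 c1 c2 c3] [d0 d1 d2 d3]]]]]].
by split; [exact: (@dual_indep _ _ e0 e1)|exact: (@dual_indep _ _ e2 e3)|
  exact: (@dual_indep _ _ e1 e3)].
Qed.

(** Saturation in codimension 2 removes the curves left by the trichotomy. It serves to prove that x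
    and v are independent and that their span is saturated. *)
Lemma saturated2_one : saturated2 J -> J 1.
Proof.
move=> J_sat; have J2 (phi psi : 'rV[K]_4) : indep phi psi -> J (lf phi) ->
    J (lf psi) -> J 1.
  by move=> ind h h'; apply: (J_sat _ _ _ ind); rewrite mulr1.
have [//|[]] := pencil_trichotomy (saturated23 J_sat).
- by move=> [phi [psi [ind h h']]]; exact: J2 ind h h'.
- move=> [p0 [p1 [p2 [p3 [fr [h02 h03 h12 h13]]]]]].
  have [i01 i23 _] := frame_indep fr.
  by apply: (J2 _ _ i01); apply: (J_sat _ _ _ i23); rewrite mulrC.
- move=> [p0 [p1 [p2 [p3 [fr [h00 h01 h11 _]]]]]].
  have [i01 _ _] := frame_indep fr; apply: (J2 _ _ i01).
    by apply: (J_sat _ _ _ i01) => //; rewrite mulrC.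
  by apply: (J_sat _ _ _ i01).
Qed.

Hypothesis J_sat : saturated3 J.

(** An element g of [J] outside the prime ideal (phi, psi) makes (phi, psi, g) of codimension 3, and
    saturation yields 1. *)
Lemma line_ideal_cases (phi psi : 'rV[K]_4) : indep phi psi -> J (lf phi) ->
  J (lf psi) -> J 1 \/ forall g, J g <-> in_ideal2 phi psi g.
Proof.
move=> ind h h'; have [sub|] := pselect (forall g, J g -> in_ideal2 phi psi g).
  right=> g; split; first exact: sub.
  by move=> [a [b ->]]; apply: J_ideal.1; exact: J_ideal.2.
move=> /existsNP [g] /not_implyP [Jg ng]; left.
by apply: (J_sat ind ng); rewrite mulr1.
Qed.

Definition two_lines_gen (p0 p1 p2 p3 : 'rV[K]_4) (g : S) := exists a b c d,
  g = a * (lf p0 * lf p2) + b * (lf p0 * lf p3) + c * (lf p1 * lf p2)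
      + d * (lf p1 * lf p3).

Definition double_line_gen (p0 p1 p2 p3 : 'rV[K]_4) (g : S) := exists a b c d,
  g = a * (lf p0 * lf p0) + b * (lf p0 * lf p1) + c * (lf p1 * lf p1)
      + d * (lf p0 * lf p3 - lf p1 * lf p2).

Lemma proj_subst_fix (phi chi psi : 'rV[K]_4) (e e' : 'cV[K]_4) :
  chi *m e = 0 -> chi *m e' = 0 -> proj_subst phi e psi e' (lf chi) = lf chi.
Proof. by move=> h h'; rewrite proj_subst_lf h h' !mxE !scale0r !subr0. Qed.

(** Write g = a p0 + b p1. Modulo (p2, p3) this combination vanishes, so there (a, b) is a multiple
    of (p1, - p0), which contributes nothing to g. *)
Lemma two_lines_intersection (p0 p1 p2 p3 : 'rV[K]_4) g : frame p0 p1 p2 p3 ->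
  in_ideal2 p0 p1 g -> in_ideal2 p2 p3 g -> two_lines_gen p0 p1 p2 p3 g.
Proof.
move=> fr [a [b gE]]; have [ind _ _] := frame_indep fr.
have [e0 [e1 [e2 [e3 [[_ _ h02 h03] [_ _ h12 h13] [_ _ h22 h23] [_ _ h32 h33]]]]]] :=
  frame_dual fr.
move/(proj_subst_ideal _ h22 h23 h32 h33); rewrite gE rmorphD !rmorphM /=.
have [a2 [a3 aE]] := proj_subst_mod p2 e2 p3 e3 a.
have [b2 [b3 bE]] := proj_subst_mod p2 e2 p3 e3 b.
rewrite !proj_subst_fix // => /eqP; rewrite addr_eq0 -mulNr => /eqP.
move=> /(lf_koszul ind) [c [ac bc]].
exists a2, a3, b2, b3.
have -> : a = c * lf p1 + (a2 * lf p2 + a3 * lf p3) by rewrite -aE ac; ring.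
have -> : b = - (c * lf p0) + (b2 * lf p2 + b3 * lf p3) by rewrite -bE -bc; ring.
ring.
Qed.

(** An element of [J] that does not vanish on one line lets saturation along that line put the
    equations of the other line into [J]. *)
Lemma two_lines_cases (p0 p1 p2 p3 : 'rV[K]_4) : frame p0 p1 p2 p3 ->
  two_lines_ideal J p0 p1 p2 p3 ->
  (exists phi psi, [/\ indep phi psi, J (lf phi) & J (lf psi)]) \/
  forall g, J g <-> two_lines_gen p0 p1 p2 p3 g.
Proof.
move=> fr [h02 h03 h12 h13].
have [i01 i23 _] := frame_indep fr.
have [sub|] := pselect (forall g, J g -> in_ideal2 p0 p1 g /\ in_ideal2 p2 p3 g).
  right=> g; split.
    by move=> /sub [h h']; exact: two_lines_intersection.
  by move=> [a [b [c [d ->]]]]; do !apply: J_ideal.1; apply: J_ideal.2.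
move=> /existsNP [g] /not_implyP [Jg] /not_andP [ng|ng]; left.
  exists p2, p3; split=> //.
    by apply: (J_sat i01 ng); rewrite // mulrC; exact: J_ideal.2.
  by apply: (J_sat i01 ng); rewrite // mulrC; exact: J_ideal.2.
exists p0, p1; split=> //.
  by apply: (J_sat i23 ng); rewrite mulrC //; exact: J_ideal.2.
by apply: (J_sat i23 ng); rewrite mulrC //; exact: J_ideal.2.
Qed.

Lemma double_line_cases (p0 p1 p2 p3 : 'rV[K]_4) : frame p0 p1 p2 p3 ->
  double_line_ideal J p0 p1 p2 p3 ->
  (exists phi psi, [/\ indep phi psi, J (lf phi) & J (lf psi)]) \/
  forall g, J g <-> double_line_gen p0 p1 p2 p3 g.
Proof.
move=> fr [h00 h01 h11 hQ].
have [i01 i23 _] := frame_indep fr.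
have line f : ~ in_ideal2 p0 p1 f -> J (f * lf p0) -> J (f * lf p1) ->
    J (lf p0) /\ J (lf p1).
  move=> nf f0 f1; split; apply: (J_sat i01 nf) => //.
  by rewrite mulrC.
have [sub|] := pselect (forall g, J g -> double_line_gen p0 p1 p2 p3 g).
  right=> g; split; first exact: sub.
  by move=> [a [b [c [d ->]]]]; do !apply: J_ideal.1; apply: J_ideal.2.
move=> /existsNP [g] /not_implyP [Jg ng]; left; exists p0, p1.
suff [h h'] : J (lf p0) /\ J (lf p1) by split.
have [[a [b gE]]|ng'] := pselect (in_ideal2 p0 p1 g); last first.
  by apply: (line g ng'); rewrite mulrC; exact: J_ideal.2.
(* With Q = p0 p3 - p1 p2, one has h p0 = p2 g + b Q and h p1 = p3 g - a Q, so [h] multiplies p0 and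
   p1 into [J]. If [h] were in (p0, p1), then g would be in the double line ideal. *)
pose h := a * lf p2 + b * lf p3.
apply: (line h).
- move=> ih; apply: ng.
  have [e0 [e1 [e2 [e3 [[h00' h01' _ _] [h10 h11' _ _] [h20 h21 _ _] [h30 h31 _ _]]]]]] :=
    frame_dual fr.
  move/(proj_subst_ideal _ h00' h01' h10 h11'): ih; rewrite rmorphD !rmorphM /=.
  have [a2 [a3 aE]] := proj_subst_mod p0 e0 p1 e1 a.
  have [b2 [b3 bE]] := proj_subst_mod p0 e0 p1 e1 b.
  rewrite !proj_subst_fix // => /eqP; rewrite addr_eq0 -mulNr => /eqP.
  move=> /(lf_koszul i23) [c [ac bc]].
  exists a2, (a3 + b2), b3, c; rewrite gE.
  have -> : a = c * lf p3 + (a2 * lf p0 + a3 * lf p1) by rewrite -aE ac; ring.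
  have -> : b = - (c * lf p2) + (b2 * lf p0 + b3 * lf p1) by rewrite -bE -bc; ring.
  ring.
- have -> : h * lf p0 = lf p2 * g + b * (lf p0 * lf p3 - lf p1 * lf p2).
    by rewrite /h gE; ring.
  by apply: J_ideal.1; exact: J_ideal.2.
- have -> : h * lf p1 = lf p3 * g + (- a) * (lf p0 * lf p3 - lf p1 * lf p2).
    by rewrite /h gE; ring.
  by apply: J_ideal.1; exact: J_ideal.2.
Qed.

Lemma pencil_ideal_cases :
  [\/ J 1,
      exists phi psi, indep phi psi /\ forall g, J g <-> in_ideal2 phi psi g,
      exists p0 p1 p2 p3, frame p0 p1 p2 p3 /\
        forall g, J g <-> two_lines_gen p0 p1 p2 p3 g
    | exists p0 p1 p2 p3, frame p0 p1 p2 p3 /\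
        forall g, J g <-> double_line_gen p0 p1 p2 p3 g].
Proof.
have line phi psi : indep phi psi -> J (lf phi) -> J (lf psi) ->
    J 1 \/ exists phi psi, indep phi psi /\ forall g, J g <-> in_ideal2 phi psi g.
  by move=> ind h h'; have [|e] := line_ideal_cases ind h h'; [left|right; exists phi, psi].
have [|[]] := pencil_trichotomy J_sat; first by constructor.
- by move=> [phi [psi [ind h h']]]; have [] := line _ _ ind h h'; by constructor.
- move=> [p0 [p1 [p2 [p3 [fr h]]]]].
  have [[phi [psi [ind h1 h2]]]|e] := two_lines_cases fr h.
    by have [] := line _ _ ind h1 h2; by constructor.
  by apply: Or43; exists p0, p1, p2, p3.
- move=> [p0 [p1 [p2 [p3 [fr h]]]]].
  have [[phi [psi [ind h1 h2]]]|e] := double_line_cases fr h.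
    by have [] := line _ _ ind h1 h2; by constructor.
  by apply: Or44; exists p0, p1, p2, p3.
Qed.

End PencilCases.

(* A linear free resolution 0 -> S^k -> S^m -> S^n -> J -> 0, the generators   *)
(* of J being of degree delta.                                                 *)
Record linear_resolution (K : fieldType) (J : {mpoly K[4]} -> Prop)
    (delta n m k : nat) := LinearResolution {
  lr_gen : nat -> {mpoly K[4]};
  lr_rel : nat -> nat -> {mpoly K[4]};
  lr_syz : nat -> nat -> {mpoly K[4]};
  lr_gen_homog : forall j, lr_gen j \is delta.-homog;
  lr_rel_homog : forall i j, lr_rel i j \is 1.-homog;
  lr_syz_homog : forall l i, lr_syz l i \is 1.-homog;
  lr_genP : forall h, J h <-> exists c : nat -> {mpoly K[4]},
    h = \sum_(j < n) c j * lr_gen j;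
  lr_rel_gen : forall i, \sum_(j < n) lr_rel i j * lr_gen j = 0;
  lr_relP : forall f : nat -> {mpoly K[4]}, \sum_(j < n) f j * lr_gen j = 0 ->
    exists e : nat -> {mpoly K[4]}, forall j, (j < n)%N ->
      f j = \sum_(i < m) e i * lr_rel i j;
  lr_syz_rel : forall l j, (j < n)%N -> \sum_(i < m) lr_syz l i * lr_rel i j = 0;
  lr_syzP : forall e : nat -> {mpoly K[4]},
    (forall j, (j < n)%N -> \sum_(i < m) e i * lr_rel i j = 0) ->
    exists u : nat -> {mpoly K[4]}, forall i, (i < m)%N ->
      e i = \sum_(l < k) u l * lr_syz l i;
  lr_syz_inj : forall u : nat -> {mpoly K[4]},
    (forall i, (i < m)%N -> \sum_(l < k) u l * lr_syz l i = 0) ->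
    forall l, (l < k)%N -> u l = 0 }.

(** * Explicit resolutions of the four ideals *)

Section LinearResolutions.
Variable K : closedFieldType.
Local Notation S := {mpoly K[4]}.
Variable J : S -> Prop.

Lemma unit_resolution : J 1 -> ideal_pred J -> linear_resolution J 0 1 0 0.
Proof.
move=> J1 [JD JM].
apply: (@LinearResolution _ _ _ _ _ _ (fun=> 1) (fun _ _ => 0) (fun _ _ => 0)).
- by move=> _; exact: dhomog1.
- by move=> *; exact: dhomog0.
- by move=> *; exact: dhomog0.
- move=> h; split=> [_|_]; last by rewrite -(mulr1 h); exact: JM.
  by exists (fun=> h); rewrite big_ord1 mulr1.
- by move=> i; rewrite big_ord1 mul0r.
- move=> f; rewrite big_ord1 mulr1 => f0; exists (fun=> 0) => j.
  by rewrite ltnS leqn0 => /eqP ->; rewrite big_ord0.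
- by move=> *; rewrite big_ord0.
- by move=> e _; exists (fun=> 0) => i; rewrite ltn0.
- by move=> u _ l; rewrite ltn0.
Qed.

Lemma line_resolution (phi psi : 'rV[K]_4) : indep phi psi ->
  (forall g, J g <-> in_ideal2 phi psi g) -> linear_resolution J 1 2 1 0.
Proof.
move=> ind JE.
have psi0 : lf psi != 0.
  by apply: contra (indep_n0 (indep_sym ind)) => /eqP /lf_eq0 ->.
pose g j := nth 0 [:: lf phi; lf psi] j.
pose r (i j : nat) := nth 0 [:: lf psi; - lf phi] j.
apply: (@LinearResolution _ _ _ _ _ _ g r (fun _ _ => 0)).
- by case=> [|[|j]]; rewrite /g /= ?lf_dhomog ?nth_nil ?dhomog0.
- by move=> i [|[|j]]; rewrite /r /= ?rpredN ?lf_dhomog ?nth_nil ?dhomog0.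
- by move=> *; exact: dhomog0.
- move=> h; rewrite JE; split=> [[a [b ->]]|[c ->]].
    by exists (nth 0 [:: a; b]); rewrite !big_ord_recl big_ord0 addr0.
  by exists (c 0%N), (c 1%N); rewrite !big_ord_recl big_ord0 addr0.
- by move=> i; rewrite !big_ord_recl big_ord0 /r /g /=; ring.
- move=> f; rewrite !big_ord_recl big_ord0 addr0 /g /=.
  move/eqP; rewrite addr_eq0 -mulNr => /eqP /(lf_koszul ind) [c [f0 f1]].
  exists (fun=> c) => -[|[|//]] _; rewrite big_ord1 /r /= ?f0 //.
  by rewrite mulrN -f1 opprK.
- by move=> l j _; rewrite big_ord1 mul0r.
- move=> e /(_ 0%N isT); rewrite big_ord1 /r /= => /eqP.
  rewrite mulf_eq0 (negPf psi0) orbF => /eqP e0.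
  by exists (fun=> 0) => -[|//] _; rewrite big_ord0.
- by move=> u _ l; rewrite ltn0.
Qed.

Lemma lf_neq0 (phi psi : 'rV[K]_4) : indep phi psi -> lf phi != 0.
Proof. by move=> ind; apply: contra (indep_n0 ind) => /eqP /lf_eq0 ->. Qed.

Lemma frame_notin (p0 p1 p2 p3 : 'rV[K]_4) : frame p0 p1 p2 p3 ->
  ~ in_ideal2 p0 p1 (lf p2) /\ ~ in_ideal2 p2 p3 (lf p1).
Proof.
move=> fr; have [i01 i23 _] := frame_indep fr.
have [e0 [e1 [e2 [e3 [[h00 h01 h02 h03] [h10 h11 h12 h13]
  [h20 h21 h22 h23] [h30 h31 h32 h33]]]]]] := frame_dual fr.
split.
  move/(proj_subst_ideal _ h00 h01 h10 h11); rewrite proj_subst_fix // => /eqP.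
  by rewrite (negPf (lf_neq0 i23)).
move/(proj_subst_ideal _ h22 h23 h32 h33); rewrite proj_subst_fix // => /eqP.
by rewrite (negPf (lf_neq0 (indep_sym i01))).
Qed.

Lemma lf_koszulN (phi psi : 'rV[K]_4) f g : indep phi psi ->
  f * lf phi + g * lf psi = 0 -> exists c, f = c * lf psi /\ g = - (c * lf phi).
Proof.
move=> ind /eqP; rewrite addr_eq0 -mulNr => /eqP /(lf_koszul ind) [c [-> gE]].
by exists c; rewrite -gE opprK.
Qed.

Lemma sum4P (g : nat -> S) h :
  (exists a b c d, h = a * g 0%N + b * g 1%N + c * g 2 + d * g 3) <->
  exists c : nat -> S, h = \sum_(j < 4) c j * g j.
Proof.
split=> [[a [b [c [d ->]]]]|[c ->]].
  by exists (nth 0 [:: a; b; c; d]); rewrite !big_ord_recl !big_ord0 /= ?addr0 ?addrA.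
by exists (c 0%N), (c 1%N), (c 2), (c 3); rewrite !big_ord_recl !big_ord0 /= ?addr0 ?addrA.
Qed.

(** This is the tensor product of the resolutions of (p0, p1) and (p2, p3). Exactness is checked by
    the Koszul relation of the first pair, then twice by that of the second. *)
Lemma two_lines_resolution (p0 p1 p2 p3 : 'rV[K]_4) : frame p0 p1 p2 p3 ->
  (forall g, J g <-> two_lines_gen p0 p1 p2 p3 g) -> linear_resolution J 2 4 4 1.
Proof.
move=> fr JE; have [i01 i23 _] := frame_indep fr.
have [nf2 nf1] := frame_notin fr.
have n0 := lf_neq0 i01; have n1 := lf_neq0 (indep_sym i01).
pose l0 := lf p0; pose l1 := lf p1; pose l2 := lf p2; pose l3 := lf p3.
pose g j := nth 0 [:: l0 * l2; l0 * l3; l1 * l2; l1 * l3] j.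
pose r (i j : nat) := nth 0 (nth [::] [:: [:: l1; 0; - l0; 0]; [:: 0; l1; 0; - l0];
  [:: l3; - l2; 0; 0]; [:: 0; 0; l3; - l2]] i) j.
pose s (l i : nat) := nth 0 [:: l3; - l2; - l1; l0] i.
apply: (@LinearResolution _ _ _ _ _ _ g r s).
- by move=> [|[|[|[|j]]]]; rewrite /g /= ?nth_nil ?dhomog0 ?(dhomogM (lf_dhomog _) (lf_dhomog _)).
- by move=> [|[|[|[|i]]]] [|[|[|[|j]]]]; rewrite /r /= ?nth_nil ?rpredN ?dhomog0 ?lf_dhomog.
- by move=> l [|[|[|[|i]]]]; rewrite /s /= ?nth_nil ?rpredN ?dhomog0 ?lf_dhomog.
- by move=> h; rewrite JE; exact: sum4P.
- by move=> [|[|[|[|i]]]]; rewrite !big_ord_recl !big_ord0 /r /g /= ?nth_nil; ring.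
- move=> f; rewrite !big_ord_recl !big_ord0 /g /= => e.
  have [|c [e1 e2]] := @lf_koszulN p0 p1 (f 0%N * l2 + f 1%N * l3) (f 2 * l2 + f 3 * l3) i01.
    by rewrite -[RHS]e /l0 /l1; ring.
  have [a [b cE]] : in_ideal2 p2 p3 c.
    apply: (in_ideal2_prime i23 nf1).
    by exists (f 0%N), (f 1%N); rewrite mulrC -e1.
  have [|u [u1 u2]] := @lf_koszulN p2 p3 (f 0%N - a * l1) (f 1%N - b * l1) i23.
    transitivity (f 0%N * l2 + f 1%N * l3 - c * l1); last by rewrite e1 subrr.
    by rewrite cE /l1 /l2 /l3; ring.
  have [|w [w1 w2]] := @lf_koszulN p2 p3 (f 2 + a * l0) (f 3 + b * l0) i23.
    transitivity (f 2 * l2 + f 3 * l3 + c * l0); last by rewrite e2 addNr.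
    by rewrite cE /l0 /l2 /l3; ring.
  exists (nth 0 [:: a; b; u; w]) => -[|[|[|[|//]]]] _; rewrite !big_ord_recl !big_ord0 /r /=.
  + by rewrite -[LHS](subrK (a * l1)) u1 /l3; ring.
  + by rewrite -[LHS](subrK (b * l1)) u2 /l2; ring.
  + by rewrite -[LHS](addrK (a * l0)) w1 /l3; ring.
  + by rewrite -[LHS](addrK (b * l0)) w2 /l2; ring.
- by move=> l [|[|[|[|//]]]] _; rewrite !big_ord_recl !big_ord0 /s /r /=; ring.
- move=> e h; have := h 0%N isT; have := h 1%N isT; have := h 2 isT.
  rewrite !big_ord_recl !big_ord0 /r /= !mulr0 ?addr0 ?add0r => h2 h1 h0.
  have [_ _ i13] := frame_indep fr.
  have [u [u0 u2]] := lf_koszulN i13 h0.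
  have b0 : e 1%N = - (u * l2).
    apply: (mulIf n1); have := h1; rewrite u2 -/l1.
    by move/eqP; rewrite addr_eq0 => /eqP ->; ring.
  have e3 : e 3 = u * l0.
    have n3 : l3 != 0 by exact: lf_neq0 (indep_sym i23).
    apply: (mulIf n3); have /eqP := h2; rewrite u0 addr_eq0 => /eqP.
    rewrite -/l3 => h2'; rewrite -[LHS]opprK -h2' -/l3 /l0; ring.
  exists (fun=> u) => -[|[|[|[|//]]]] _; rewrite big_ord1 /s /= ?u0 ?u2 ?b0 ?e3 //; ring.
- move=> u h [|//] _; have /eqP := h 3 isT; rewrite big_ord1 /s /= mulf_eq0.
  by rewrite (negPf n0) orbF => /eqP.
Qed.

(** Multiples of p0 and of p1 are grouped in a relation, and the Koszul relation of (p0, p1) is used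
    three times. The Betti numbers are those of two skew lines. *)
Lemma double_line_resolution (p0 p1 p2 p3 : 'rV[K]_4) : frame p0 p1 p2 p3 ->
  (forall g, J g <-> double_line_gen p0 p1 p2 p3 g) -> linear_resolution J 2 4 4 1.
Proof.
move=> fr JE; have [i01 _ _] := frame_indep fr; have [nf2 _] := frame_notin fr.
have n0 := lf_neq0 i01; have n1 := lf_neq0 (indep_sym i01).
pose l0 := lf p0; pose l1 := lf p1; pose l2 := lf p2; pose l3 := lf p3.
pose g j := nth 0 [:: l0 * l0; l0 * l1; l1 * l1; l0 * l3 - l1 * l2] j.
pose r (i j : nat) := nth 0 (nth [::] [:: [:: - l3; l2; 0; l0]; [:: 0; - l3; l2; l1];
  [:: 0; - l1; l0; 0]; [:: l1; - l0; 0; 0]] i) j.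
pose s (l i : nat) := nth 0 [:: l1; - l0; l2; l3] i.
apply: (@LinearResolution _ _ _ _ _ _ g r s).
- move=> [|[|[|[|j]]]]; rewrite /g /= ?nth_nil ?dhomog0 ?(dhomogM (lf_dhomog _) (lf_dhomog _)) //.
  by apply: rpredB; exact: (dhomogM (lf_dhomog _) (lf_dhomog _)).
- by move=> [|[|[|[|i]]]] [|[|[|[|j]]]]; rewrite /r /= ?nth_nil ?rpredN ?dhomog0 ?lf_dhomog.
- by move=> l [|[|[|[|i]]]]; rewrite /s /= ?nth_nil ?rpredN ?dhomog0 ?lf_dhomog.
- by move=> h; rewrite JE; exact: sum4P.
- by move=> [|[|[|[|i]]]]; rewrite !big_ord_recl !big_ord0 /r /g /= ?nth_nil; ring.
- move=> f; rewrite !big_ord_recl !big_ord0 /g /= => e.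
  have [|c [e1 e2]] := @lf_koszulN p0 p1 (f 0%N * l0 + f 1%N * l1 + f 3 * l3)
      (f 2 * l1 - f 3 * l2) i01.
    by rewrite -[RHS]e /l0 /l1; ring.
  have [a [b f3E]] : in_ideal2 p0 p1 (f 3).
    apply: (in_ideal2_prime i01 nf2); exists c, (f 2).
    by rewrite -[c * lf p0]opprK -e2 /l1 /l2; ring.
  have [|u [u1 u2]] := @lf_koszulN p0 p1 (c - a * l2) (f 2 - b * l2) i01.
    transitivity (c * l0 + (f 2 * l1 - f 3 * l2)); last by rewrite e2 subrr.
    by rewrite f3E /l0 /l1; ring.
  have [|w [w1 w2]] := @lf_koszulN p0 p1 (f 0%N + a * l3) (f 1%N + b * l3 - c) i01.
    transitivity (f 0%N * l0 + f 1%N * l1 + f 3 * l3 - c * l1); last by rewrite e1 subrr.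
    by rewrite f3E /l0 /l1; ring.
  have cE : c = u * lf p1 + a * l2 by rewrite -u1 subrK.
  exists (nth 0 [:: a; b; - u; w]) => -[|[|[|[|//]]]] _; rewrite !big_ord_recl !big_ord0 /r /=.
  + by rewrite -[LHS](addrK (a * l3)) w1 /l1; ring.
  + rewrite -[LHS](addrK (b * l3)) -[X in X - _](subrK c) w2 cE /l0 /l1; ring.
  + by rewrite -[LHS](subrK (b * l2)) u2 /l0; ring.
  + by rewrite f3E /l0 /l1; ring.
- by move=> l [|[|[|[|//]]]] _; rewrite !big_ord_recl !big_ord0 /s /r /=; ring.
- move=> e h; have := h 0%N isT; have := h 2 isT; have := h 3 isT.
  rewrite !big_ord_recl !big_ord0 /r /= !mulr0 ?addr0 ?add0r => h3 h2 h0.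
  have [u [u0 u1]] := lf_koszulN i01 h3.
  have e2 : e 2 = u * l2.
    apply: (mulIf n0); have := h2; rewrite u1 -/l0 => /eqP.
    by rewrite addrC addr_eq0 => /eqP ->; ring.
  have e3 : e 3 = u * l3.
    apply: (mulIf n1); have := h0; rewrite u0 -/l1 => /eqP.
    by rewrite addrC addr_eq0 => /eqP ->; rewrite /l1; ring.
  exists (fun=> u) => -[|[|[|[|//]]]] _; rewrite big_ord1 /s /= ?u0 ?u1 ?e2 ?e3 //; ring.
- move=> u h [|//] _; have /eqP := h 0%N isT; rewrite big_ord1 /s /= mulf_eq0.
  by rewrite (negPf n1) orbF => /eqP.
Qed.

End LinearResolutions.

(** * Polynomial vector fields annihilated by a 1-form *)

Definition o0 : 'I_4 := @Ordinal 4 0 isT.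
Definition o1 : 'I_4 := @Ordinal 4 1 isT.
Definition o2 : 'I_4 := @Ordinal 4 2 isT.
Definition o3 : 'I_4 := @Ordinal 4 3 isT.

Lemma ord4P (P : 'I_4 -> Prop) : P o0 -> P o1 -> P o2 -> P o3 -> forall i, P i.
Proof.
move=> h0 h1 h2 h3 [[|[|[|[|//]]]] hi].
- by rewrite (_ : Ordinal hi = o0) //; exact: val_inj.
- by rewrite (_ : Ordinal hi = o1) //; exact: val_inj.
- by rewrite (_ : Ordinal hi = o2) //; exact: val_inj.
- by rewrite (_ : Ordinal hi = o3) //; exact: val_inj.
Qed.

Lemma sum_ord4 (V : nmodType) (F : 'I_4 -> V) :
  \sum_i F i = F o0 + F o1 + F o2 + F o3.
Proof.
rewrite !big_ord_recl big_ord0 addr0 !addrA.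
by do !congr (_ + _); congr (F _); exact: val_inj.
Qed.

Section Cross.
Variable R : comPzRingType.
Implicit Types x v w A : 'I_4 -> R.

Definition dot A w := \sum_i A i * w i.

Definition minor x v i j := x i * v j - x j * v i.

(* The coefficients of the 1-form obtained by contracting the volume form with *)
(* the vector fields x, v and w.                                               *)
Definition cross x v w (i : 'I_4) : R := match val i with
  | 0 => minor x v o1 o2 * w o3 - minor x v o1 o3 * w o2 + minor x v o2 o3 * w o1
  | 1 => - (minor x v o0 o2 * w o3 - minor x v o0 o3 * w o2 + minor x v o2 o3 * w o0)
  | 2 => minor x v o0 o1 * w o3 - minor x v o0 o3 * w o1 + minor x v o1 o3 * w o0
  | _ => - (minor x v o0 o1 * w o2 - minor x v o0 o2 * w o1 + minor x v o1 o2 * w o0)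
  end.

Lemma cross_dot3 x v w : dot (cross x v w) w = 0.
Proof. by rewrite /dot sum_ord4 /cross /= /minor; ring. Qed.

Lemma crossD x v w w' i :
  cross x v (fun k => w k + w' k) i = cross x v w i + cross x v w' i.
Proof. by elim/ord4P: i; rewrite /cross /=; ring. Qed.

Lemma crossZ x v a w i : cross x v (fun k => a * w k) i = a * cross x v w i.
Proof. by elim/ord4P: i; rewrite /cross /=; ring. Qed.

Lemma cross_comb x v a b i : cross x v (fun k => a * x k + b * v k) i = 0.
Proof. by elim/ord4P: i; rewrite /cross /minor /=; ring. Qed.

(** Each 2 x 2 minor of the two forms is, up to sign, the combination [E k l] of A.x, A.v and A.w,
    where k and l are the complementary indices. *)
Lemma cross_parallel A x v w : dot A x = 0 -> dot A v = 0 -> dot A w = 0 ->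
  forall i j, cross x v w i * A j = cross x v w j * A i.
Proof.
move=> Ax Av Aw.
pose E k l := minor x v k l * dot A w + w l * (dot A x * v k - x k * dot A v)
  - w k * (dot A x * v l - x l * dot A v).
have E0 k l : E k l = 0 by rewrite /E Ax Av Aw; ring.
pose D i j := cross x v w i * A j - cross x v w j * A i.
have d01 : D o0 o1 = 0.
  by rewrite -[RHS](E0 o2 o3) /D /E /cross /dot !sum_ord4 /minor /=; ring.
have d02 : D o0 o2 = 0.
  by rewrite -[RHS]oppr0 -[in RHS](E0 o1 o3) /D /E /cross /dot !sum_ord4 /minor /=; ring.
have d03 : D o0 o3 = 0.
  by rewrite -[RHS](E0 o1 o2) /D /E /cross /dot !sum_ord4 /minor /=; ring.
have d12 : D o1 o2 = 0.
  by rewrite -[RHS](E0 o0 o3) /D /E /cross /dot !sum_ord4 /minor /=; ring.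
have d13 : D o1 o3 = 0.
  by rewrite -[RHS]oppr0 -[in RHS](E0 o0 o2) /D /E /cross /dot !sum_ord4 /minor /=; ring.
have d23 : D o2 o3 = 0.
  by rewrite -[RHS](E0 o0 o1) /D /E /cross /dot !sum_ord4 /minor /=; ring.
have swap i j : D i j = 0 -> cross x v w i * A j = cross x v w j * A i.
  exact: subr0_eq.
by move=> i j; elim/ord4P: i; elim/ord4P: j; first [done|exact: swap|symmetry; exact: swap].
Qed.

(** For k, l complementary to i, j, the field w is, up to sign, A_l e_k - A_k e_l, which [A] kills.
    The two sides then differ, coordinate by coordinate, by 0 or by some [E l] up to sign. *)
Lemma minor_cross A x v i j : dot A x = 0 -> dot A v = 0 ->
  exists w, forall k, minor x v i j * A k = cross x v w k.
Proof.
move=> Ax Av; pose E k := x k * dot A v - v k * dot A x.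
have E0 k : E k = 0 by rewrite /E Ax Av; ring.
pose F w i j := forall k, minor x v i j * A k = cross x v w k.
have swap w i' j' : F w j' i' -> F (fun k => -1 * w k) i' j'.
  by move=> h k; rewrite crossZ -h /minor; ring.
pose W (a b c d : R) (k : 'I_4) := nth 0 [:: a; b; c; d] k.
have E0' k : - E k = 0 by rewrite E0 oppr0.
have split i' j' w' : (forall k, exists l, [\/ minor x v i' j' * A k - cross x v w' k = 0,
    minor x v i' j' * A k - cross x v w' k = E l |
    minor x v i' j' * A k - cross x v w' k = - E l]) -> F w' i' j'.
  move=> h k; apply: subr0_eq.
  by have [l [->|->|->]] := h k.
have [[h01 h02 h03] [h12 h13 h23]] : [/\ F (W 0 0 (- A o3) (A o2)) o0 o1,
    F (W 0 (A o3) 0 (- A o1)) o0 o2 & F (W 0 (- A o2) (A o1) 0) o0 o3] /\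
    [/\ F (W (- A o3) 0 0 (A o0)) o1 o2, F (W (A o2) 0 (- A o0) 0) o1 o3 &
    F (W (- A o1) (A o0) 0 0) o2 o3].
  by split; split; apply: split; elim/ord4P; rewrite /cross /W /E /dot !sum_ord4 /minor /=;
    first [exists o0; constructor 1; ring|exists o0; constructor 2; ring
      |exists o0; constructor 3; ring|exists o1; constructor 2; ring
      |exists o1; constructor 3; ring|exists o2; constructor 2; ring
      |exists o2; constructor 3; ring|exists o3; constructor 2; ring
      |exists o3; constructor 3; ring].
have diag i' : F (fun=> 0) i' i'.
  by move=> k; elim/ord4P: k; rewrite /cross /minor /=; ring.
suff [w h] : exists w, F w i j by exists w.
by elim/ord4P: i; elim/ord4P: j;
  first [exists (fun=> 0); exact: diag|eexists; eassumption|eexists; apply: swap; eassumption].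
Qed.

(** The hypothesis is the vanishing of the 3 x 3 minors of (x, v, w), and the conclusion is the
    expansion of the one with indices i, j, k. *)
Lemma cross_cramer x v w i j : (forall k, cross x v w k = 0) ->
  forall k, minor x v i j * w k = - minor v w i j * x k + minor x w i j * v k.
Proof.
move=> C0 k; pose D i j k := minor x v i j * w k + minor v w i j * x k - minor x w i j * v k.
suff : D i j k = 0.
  by move/eqP; rewrite subr_eq0 => /eqP e; rewrite -e; ring.
have := C0 o0; have := C0 o1; have := C0 o2; have := C0 o3; rewrite /cross /=.
set c3 := - _; set c2 := _ + _; set c1 := - _; set c0 := _ + _ => z3 z2 z1 z0.
elim/ord4P: i; elim/ord4P: j; elim/ord4P: k;
  first [by rewrite /D /minor; ring
  | transitivity c0; [by rewrite /D /c0 /minor; ring|exact: z0]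
  | transitivity c1; [by rewrite /D /c1 /minor; ring|exact: z1]
  | transitivity c2; [by rewrite /D /c2 /minor; ring|exact: z2]
  | transitivity c3; [by rewrite /D /c3 /minor; ring|exact: z3]
  | transitivity (- c0); [by rewrite /D /c0 /minor; ring|by rewrite z0 oppr0]
  | transitivity (- c1); [by rewrite /D /c1 /minor; ring|by rewrite z1 oppr0]
  | transitivity (- c2); [by rewrite /D /c2 /minor; ring|by rewrite z2 oppr0]
  | transitivity (- c3); [by rewrite /D /c3 /minor; ring|by rewrite z3 oppr0]].
Qed.

End Cross.

Lemma koszul3 (K : fieldType) (phi psi : 'rV[K]_4) f g1 g2 g3 :
  indep phi psi -> ~ in_ideal2 phi psi f ->
  f * g1 - lf psi * g2 + lf phi * g3 = 0 ->
  exists p q, g1 = q * lf phi - p * lf psi.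
Proof.
move=> ind nf e; have [a [b ->]] : in_ideal2 phi psi g1; last first.
  by exists (- b), a; ring.
apply: (in_ideal2_prime ind nf); exists (- g3), g2.
by rewrite -[LHS](addr0) -[in LHS]oppr0 -[in LHS]e; ring.
Qed.

(* A free resolution of the module of the vector fields w such that A.w = 0,   *)
(* modulo the multiples of the Euler field.  The generators er_field j, for j   *)
(* from 0 to n, are of degrees 1, e, ..., e.                                   *)
Record euler_resolution (K : fieldType) (A : 'I_4 -> {mpoly K[4]})
    (e n m k : nat) := EulerResolution {
  er_field : nat -> 'I_4 -> {mpoly K[4]};
  er_rel : nat -> nat -> {mpoly K[4]};
  er_syz : nat -> nat -> {mpoly K[4]};
  er_field0_homog : forall i, er_field 0 i \is 1.-homog;
  er_fieldS_homog : forall j i, er_field j.+1 i \is e.-homog;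
  er_rel0_homog : forall i, er_rel i 0 \is e.-homog;
  er_relS_homog : forall i j, er_rel i j.+1 \is 1.-homog;
  er_syz_homog : forall l i, er_syz l i \is 1.-homog;
  er_dot : forall j, dot A (er_field j) = 0;
  er_fieldP : forall B, dot A B = 0 -> exists a (c : nat -> {mpoly K[4]}),
    forall i, B i = a * 'X_i + \sum_(j < n.+1) c j * er_field j i;
  er_rel_field : forall i, exists a, forall l,
    \sum_(j < n.+1) er_rel i j * er_field j l = a * 'X_l;
  er_relP : forall f : nat -> {mpoly K[4]},
    (exists a, forall l, \sum_(j < n.+1) f j * er_field j l = a * 'X_l) ->
    exists g : nat -> {mpoly K[4]}, forall j, (j < n.+1)%N ->
      f j = \sum_(i < m) g i * er_rel i j;
  er_syz_rel : forall l j, (j < n.+1)%N -> \sum_(i < m) er_syz l i * er_rel i j = 0;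
  er_syzP : forall f : nat -> {mpoly K[4]},
    (forall j, (j < n.+1)%N -> \sum_(i < m) f i * er_rel i j = 0) ->
    exists u : nat -> {mpoly K[4]}, forall i, (i < m)%N ->
      f i = \sum_(l < k) u l * er_syz l i;
  er_syz_inj : forall u : nat -> {mpoly K[4]},
    (forall i, (i < m)%N -> \sum_(l < k) u l * er_syz l i = 0) ->
    forall l, (l < k)%N -> u l = 0 }.

(** * Fields killed by the 1-form, given a linear one *)

Section LinearField.
Variable K : closedFieldType.
Local Notation S := {mpoly K[4]}.
Variables (T : 'M[K]_4) (A : 'I_4 -> S).

Definition euler_field (i : 'I_4) : S := 'X_i.
Definition linear_field (i : 'I_4) : S := lf (row i T).

Local Notation X := euler_field.
Local Notation v := linear_field.

Lemma lf_mul (psi : 'rV[K]_4) : lf (psi *m T) = \sum_j psi 0 j *: v j.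
Proof.
by rewrite mulmx_sum_row raddf_sum; apply: eq_bigr => j _; exact: lfZ.
Qed.

Lemma minors_pencil (J : S -> Prop) : ideal_pred J ->
  (forall i j, J (minor X v i j)) -> pencil_minors J T.
Proof.
move=> Jid h phi psi; rewrite !lf_mul.
have J0 : J 0 by rewrite -(mul0r (minor X v o0 o0)); apply: Jid.2.
have -> : lf phi * (\sum_j psi 0 j *: v j) - lf psi * (\sum_j phi 0 j *: v j) =
    \sum_i \sum_j (phi 0 i * psi 0 j)%:MP * minor X v i j.
  rewrite /lf !sum_ord4 -!mul_mpolyC /minor /euler_field !mpolyCM; ring.
elim/big_ind: _ => // [|i _]; first exact: Jid.1.
elim/big_ind: _ => // [|j _]; first exact: Jid.1.
exact: Jid.2.
Qed.

Hypothesis T_rank : forall a : K, (1 < \rank (T - a%:M)%R)%N.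

(** The ideal 0 is saturated; if it contained all the minors it would be (1). *)
Lemma exists_minor : exists i j, minor X v i j != 0.
Proof.
apply: contrapT => nex.
have m0 i j : minor X v i j = 0.
  by apply/eqP; apply: contrapT => /negP h; apply: nex; exists i, j.
have J0id : ideal_pred (fun g : S => g = 0).
  by split=> [f g -> ->|f g ->]; rewrite ?addr0 ?mulr0.
suff /eqP : (1 : S) = 0 by rewrite oner_eq0.
apply: (saturated2_one J0id (minors_pencil J0id m0) T_rank).
move=> phi psi g ind /eqP + _; rewrite mulf_eq0 (negPf (lf_neq0 ind)) /=.
by move/eqP.
Qed.

Lemma euler_linear_indep a b : (forall k, a * X k + b * v k = 0) -> a = 0 /\ b = 0.
Proof.
move=> h; have [i [j mij]] := exists_minor; split; apply: (mulIf mij); rewrite mul0r.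
  transitivity ((a * X i + b * v i) * v j - (a * X j + b * v j) * v i).
    by rewrite /minor; ring.
  by rewrite !h !mul0r subr0.
transitivity (X i * (a * X j + b * v j) - X j * (a * X i + b * v i)).
  by rewrite /minor; ring.
by rewrite !h !mulr0 subr0.
Qed.

(** The g such that g w is a combination of x and v form an ideal. It contains the minors by
    Cramer's rule and is saturated in codimension 2 by the Koszul relation, so it contains 1. *)
Lemma cross_kernel w : (forall k, cross X v w k = 0) ->
  exists a b, forall k, w k = a * X k + b * v k.
Proof.
move=> C0; pose P g := exists a b, forall k, g * w k = a * X k + b * v k.
have Pid : ideal_pred P.
  split=> [f g [a [b h]] [a' [b' h']]|f g [a [b h]]].
    by exists (a + a'), (b + b') => k; rewrite mulrDl h h'; ring.
  by exists (f * a), (f * b) => k; rewrite -mulrA h; ring.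
have Pm i j : P (minor X v i j).
  by exists (- minor v w i j), (minor X w i j); exact: cross_cramer.
suff [a [b h]] : P 1 by exists a, b => k; rewrite -h mul1r.
apply: (saturated2_one Pid (minors_pencil Pid Pm) T_rank).
move=> phi psi g ind [a [b h]] [a' [b' h']].
have [k1 k2] : lf psi * a - lf phi * a' = 0 /\ lf psi * b - lf phi * b' = 0.
  apply: euler_linear_indep => k.
  transitivity (lf psi * (a * X k + b * v k) - lf phi * (a' * X k + b' * v k)).
    by ring.
  by rewrite -h -h'; ring.
have [|c [_ aE]] := @lf_koszul _ phi psi a' a ind.
  by apply/eqP; rewrite eq_sym -subr_eq0 -[X in _ == X]k1; apply/eqP; ring.
have [|c' [_ bE]] := @lf_koszul _ phi psi b' b ind.
  by apply/eqP; rewrite eq_sym -subr_eq0 -[X in _ == X]k2; apply/eqP; ring.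
exists c, c' => k; apply: (mulfI (lf_neq0 ind)); rewrite mulrA h aE bE; ring.
Qed.

Hypotheses (AX : dot A X = 0) (Av : dot A v = 0).
Hypothesis A_n0 : exists i, A i != 0.

(* The ideal of the zero scheme of v, as a section of the tangent sheaf of the *)
(* distribution.                                                               *)
Definition zero_ideal (g : S) := exists w, forall i, g * A i = cross X v w i.

Lemma zero_ideal_ideal : ideal_pred zero_ideal.
Proof.
split=> [f g [w h] [w' h']|f g [w h]].
  by exists (fun k => w k + w' k) => i; rewrite crossD mulrDl h h'.
by exists (fun k => f * w k) => i; rewrite crossZ -mulrA h.
Qed.

Lemma zero_ideal_minors : pencil_minors zero_ideal T.
Proof.
apply: minors_pencil zero_ideal_ideal _ => i j.
by have [w h] := minor_cross i j AX Av; exists w.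
Qed.

(** With a = phi and b = psi, the fields wa, wb and wc lift a g, b g and f g. Differences such as a
    wb - b wa lie in the free module on x and v and satisfy the Koszul identity of (a, b, f). By
    [koszul3], wa and wb can be corrected by combinations of x and v so that a divides wa; the
    quotient lifts g. *)
Lemma zero_ideal_saturated : saturated3 zero_ideal.
Proof.
move=> phi psi f g ind nf [wa ha] [wb hb] [wc hc].
set a := lf phi in ha *; set b := lf psi in hb *.
have diff p q w w' : (forall i, p * g * A i = cross X v w i) ->
    (forall i, q * g * A i = cross X v w' i) ->
    exists c c', forall k, p * w' k - q * w k = c * X k + c' * v k.
  move=> hw hw'; apply: cross_kernel => k.
  transitivity (cross X v (fun k => p * w' k + (- q) * w k) k).
    by elim/ord4P: k; rewrite /cross /=; ring.
  by rewrite crossD !crossZ -hw -hw'; ring.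
have [c1 [c1' e1]] := diff _ _ _ _ ha hb.
have [c2 [c2' e2]] := diff _ _ _ _ ha hc.
have [c3 [c3' e3]] := diff _ _ _ _ hb hc.
have [z1 z2] : f * c1 - b * c2 + a * c3 = 0 /\ f * c1' - b * c2' + a * c3' = 0.
  apply: euler_linear_indep => k.
  transitivity (f * (c1 * X k + c1' * v k) - b * (c2 * X k + c2' * v k)
    + a * (c3 * X k + c3' * v k)); first by ring.
  by rewrite -e1 -e2 -e3; ring.
have [p [q c1E]] := koszul3 ind nf z1.
have [p' [q' c1'E]] := koszul3 ind nf z2.
have wE k : exists w, wa k - p * X k - p' * v k = w * a.
  have [|w [_ ->]] := @lf_koszul _ phi psi (wb k - q * X k - q' * v k)
    (wa k - p * X k - p' * v k) ind; last by exists w.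
  apply/eqP; rewrite -subr_eq0 -/a -/b; apply/eqP.
  transitivity ((a * wb k - b * wa k) - (c1 * X k + c1' * v k)).
    by rewrite c1E c1'E -/a -/b; ring.
  by rewrite e1 subrr.
have [w wP] := choice wE; exists w => i; apply: (mulfI (lf_neq0 ind)); rewrite -/a.
transitivity (cross X v wa i); first by rewrite mulrA ha.
rewrite -crossZ; transitivity (cross X v (fun k => a * w k + (p * X k + p' * v k)) i).
  congr (cross _ _ _ i); apply: funext => k; rewrite [a * _]mulrC -wP; ring.
by rewrite crossD cross_comb addr0.
Qed.

Hypothesis A_prim : forall C, (forall i j, C i * A j = C j * A i) ->
  exists g, forall i, C i = g * A i.

Variable d : nat.
Hypothesis A_homog : forall i, A i \is d.+1.-homog.

Lemma minor_homog i j : minor X v i j \is 2.-homog.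
Proof.
have X1 k : X k \is 1.-homog by rewrite dhomogX /= mdeg1.
by apply: rpredB; apply: (dhomogM (X1 _) (lf_dhomog _)).
Qed.

Lemma pihomog_cross e w i : pihomog mdeg (e + 2) (cross X v w i) =
  cross X v (fun k => pihomog mdeg e (w k)) i.
Proof.
have mE i' j k : pihomog mdeg (e + 2) (minor X v i' j * w k) =
    minor X v i' j * pihomog mdeg e (w k).
  by rewrite mulrC (pihomogM _ _ (minor_homog _ _)) mulrC.
by elim/ord4P: i; rewrite /cross /= ?raddfN !raddfD ?raddfN /= !mE.
Qed.

Lemma pihomog1_cross w i : pihomog mdeg 1 (cross X v w i) = 0.
Proof.
have mE i' j k : pihomog mdeg 1 (minor X v i' j * w k) = 0.
  by rewrite mulrC (pihomogM_lt _ (minor_homog _ _)).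
by elim/ord4P: i; rewrite /cross /= ?raddfN !raddfD ?raddfN /= !mE !oppr0 !addr0 ?oppr0.
Qed.

(** If delta = d = 0, a generator times [A] has degree 1, whereas a contraction with x and v has no
    term of degree below 2. All generators would vanish, and the minors with them. *)
Lemma zero_ideal_degree delta n m k :
  linear_resolution zero_ideal delta n m k -> (0 < delta + d)%N.
Proof.
move=> L; rewrite lt0n; apply/eqP => /eqP; rewrite addn_eq0 => /andP[/eqP dl0 /eqP d0].
have [i0 Ai0] := A_n0.
have gen0 j : (j < n)%N -> lr_gen L j = 0.
  move=> jn; have [w h] : zero_ideal (lr_gen L j).
    apply/(lr_genP L); exists (fun l => (l == j)%:R).
    rewrite (bigD1 (Ordinal jn)) //= eqxx mul1r big1 ?addr0 // => l lj.
    by rewrite -val_eqE /= in lj; rewrite (negPf lj) mul0r.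
  have := pihomog1_cross w i0; rewrite -h pihomog_dE; last first.
    have := dhomogM (lr_gen_homog L j) (A_homog i0).
    by have -> : (delta + d.+1)%N = 1%N by rewrite dl0 d0.
  by move/eqP; rewrite mulf_eq0 (negPf Ai0) orbF => /eqP.
have [i [j /eqP]] := exists_minor; apply.
have : zero_ideal (minor X v i j) by have [w h] := minor_cross i j AX Av; exists w.
move/(lr_genP L) => [c ->]; apply: big1 => l _.
by rewrite gen0 ?mulr0 //; exact: ltn_ord.
Qed.

(** A generator times [A] has degree delta + d + 1 = e + 2 and [cross] adds 2 to the degree, so
    generators of J lift to fields of degree e. A relation between the generators lifts to one
    modulo x that also involves v, with coefficient [- h i]. Since x and v are independent, the
    higher syzygies are unchanged. *)
Lemma horseshoe delta n m k e : linear_resolution zero_ideal delta n m k ->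
  (delta + d)%N = e.+1 -> inhabited (euler_resolution A e n m k).
Proof.
move=> L de.
(* The generators are indexed by all natural numbers, so the lift is set to 0 beyond n. *)
have wE j : exists w, (forall i, w i \is e.-homog) /\
    (if (j < n)%N then forall i, lr_gen L j * A i = cross X v w i
     else forall i, w i = 0).
  have [jn|_] := boolP (j < n)%N; last first.
    by exists (fun=> 0); split=> i //; exact: dhomog0.
  have [w h] : zero_ideal (lr_gen L j).
    apply/(lr_genP L); exists (fun l => (l == j)%:R).
    rewrite (bigD1 (Ordinal jn)) //= eqxx mul1r big1 ?addr0 // => l lj.
    by rewrite -val_eqE /= in lj; rewrite (negPf lj) mul0r.
  exists (fun i => pihomog mdeg e (w i)); split=> i; first exact: pihomogP.
  rewrite -pihomog_cross -h pihomog_dE //.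
  have := dhomogM (lr_gen_homog L j) (A_homog i).
  by rewrite addnS de addn2.
have [w wP] := choice wE.
have w_homog j i : w j i \is e.-homog by have [] := wP j.
have w_cross j i : (j < n)%N -> lr_gen L j * A i = cross X v (w j) i.
  by move=> jn; have [_] := wP j; rewrite jn; apply.
have w_out j i : ~~ (j < n)%N -> w j i = 0.
  by move=> jn; have [_] := wP j; rewrite (negPf jn); apply.
have cross_sum (f : nat -> S) i : cross X v (fun l => \sum_(j < n) f j * w j l) i =
    (\sum_(j < n) f j * lr_gen L j) * A i.
  transitivity (\sum_(j < n) f j * cross X v (w j) i).
    have cE : forall s : seq 'I_n, cross X v (fun l => \sum_(j <- s) f j * w j l) i =
        \sum_(j <- s) f j * cross X v (w j) i.
      elim=> [|j s IHs].
        transitivity (cross X v (fun l => 0 * w 0%N l) i).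
          by congr (cross _ _ _ i); apply: funext => l; rewrite big_nil mul0r.
        by rewrite crossZ mul0r big_nil.
      rewrite big_cons -IHs -crossZ -crossD.
      by congr (cross _ _ _ i); apply: funext => l; rewrite big_cons.
    exact: cE.
  by rewrite mulr_suml; apply: eq_bigr => j _; rewrite -mulrA w_cross.
have hE i : exists h, h \is e.-homog /\ exists a, forall l,
    \sum_(j < n) lr_rel L i j * w j l = a * X l + h * v l.
  have [|a [h ah]] := @cross_kernel (fun l => \sum_(j < n) lr_rel L i j * w j l).
    by move=> l; rewrite (cross_sum (lr_rel L i)) lr_rel_gen mul0r.
  exists (pihomog mdeg e h); split; first exact: pihomogP.
  exists (pihomog mdeg e a) => l.
  have X1 : X l \is 1.-homog by rewrite dhomogX /= mdeg1.
  have := congr1 (pihomog mdeg (e + 1)) (ah l).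
  rewrite raddfD /= (pihomogM _ _ X1) (pihomogM _ _ (lf_dhomog _)) pihomog_dE //.
  apply: rpred_sum => j _; rewrite addnC; exact: dhomogM (lr_rel_homog L i j) (w_homog j l).
have [h hP] := choice hE.
have /choice [a aE] : forall i, exists a, forall l,
    \sum_(j < n) lr_rel L i j * w j l = a * X l + h i * v l.
  by move=> i; have [] := hP i.
pose W j := if j is j'.+1 then w j' else v.
pose r i j := if j is j'.+1 then lr_rel L i j' else - h i.
have dotW j : dot A (W j) = 0.
  case: j => [|j] //=; have [jn|jn] := boolP (j < n)%N; last first.
    by rewrite /dot big1 // => i _; rewrite w_out ?mulr0.
  have [g0|g0] := eqVneq (lr_gen L j) 0.
    have [|b [c bc]] := @cross_kernel (w j).
      by move=> i; rewrite -w_cross // g0 mul0r.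
    transitivity (b * dot A X + c * dot A v); last by rewrite AX Av !mulr0 addr0.
    rewrite /dot !mulr_sumr -big_split; apply: eq_bigr => i _; rewrite /= bc; ring.
  apply: (mulfI g0); rewrite mulr0 -(cross_dot3 X v (w j)) /dot mulr_sumr.
  by apply: eq_bigr => i _; rewrite mulrA w_cross.
have sumW (f : nat -> S) l : \sum_(j < n.+1) f j * W j l =
    f 0%N * v l + \sum_(j < n) f j.+1 * w j l.
  by rewrite big_ord_recl; congr (_ + _); apply: eq_bigr.
have sum_rel (g : nat -> S) l :
    \sum_(j < n) (\sum_(i < m) g i * lr_rel L i j) * w j l =
    (\sum_(i < m) g i * a i) * X l - (\sum_(i < m) g i * r i 0%N) * v l.
  transitivity (\sum_(j < n) \sum_(i < m) g i * (lr_rel L i j * w j l)).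
    by apply: eq_bigr => j _; rewrite mulr_suml; apply: eq_bigr => i _; rewrite mulrA.
  rewrite exchange_big !mulr_suml -sumrB; apply: eq_bigr => i _.
  by rewrite -mulr_sumr aE /=; ring.
constructor; apply: (@EulerResolution _ _ _ _ _ _ W r (lr_syz L)).
- by move=> i; exact: lf_dhomog.
- by move=> j i; exact: w_homog.
- by move=> i; rewrite rpredN; have [] := hP i.
- by move=> i j; exact: lr_rel_homog.
- by move=> l i; exact: lr_syz_homog.
- exact: dotW.
- move=> B AB; have [g gE] := A_prim (cross_parallel AX Av AB).
  have /(lr_genP L) [c cE] : zero_ideal g by exists B.
  have [|b [b' bE]] := @cross_kernel (fun l => B l - \sum_(j < n) c j * w j l).
    move=> l; transitivity (cross X v B l - cross X v (fun l => \sum_(j < n) c j * w j l) l).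
      by elim/ord4P: l; rewrite /cross /=; ring.
    by rewrite (cross_sum c) -cE gE subrr.
  exists b, (fun j => if j is j'.+1 then c j' else b') => i.
  by rewrite (sumW (fun j => if j is j'.+1 then c j' else b')) addrA -bE subrK.
- by move=> i; exists (a i) => l; rewrite (sumW (r i)) /= aE /euler_field; ring.
- move=> f [b fb].
  have f0 : \sum_(j < n) f j.+1 * lr_gen L j = 0.
    have [i0 Ai0] := A_n0; apply: (mulIf Ai0); rewrite mul0r.
    rewrite -(cross_sum (fun j => f j.+1)); apply: etrans (cross_comb X v b (- f 0%N) i0).
    congr (cross _ _ _ i0); apply: funext => l; rewrite -[b * _]fb (sumW f) /=; ring.
  have [g gE] := @lr_relP _ _ _ _ _ _ L (fun j => f j.+1) f0; exists g => -[_|j jn]; last exact: gE.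
  suff [_ /eqP] : \sum_(i < m) g i * a i - b = 0 /\
      f 0%N - \sum_(i < m) g i * r i 0%N = 0 by rewrite subr_eq0 => /eqP.
  apply: euler_linear_indep => l; have := fb l; rewrite (sumW f).
  rewrite (eq_bigr (fun j : 'I_n => (\sum_(i < m) g i * lr_rel L i j) * w j l)).
    rewrite sum_rel -/(X l) => /eqP; rewrite -subr_eq0 => /eqP e0.
    by apply: etrans e0; ring.
  by move=> j _; rewrite gE.
- move=> l [_|j jn]; last exact: lr_syz_rel.
  suff [_ /eqP] : \sum_(i < m) lr_syz L l i * a i = 0 /\
      - \sum_(i < m) lr_syz L l i * r i 0%N = 0 by rewrite oppr_eq0 => /eqP.
  apply: euler_linear_indep => l'; rewrite mulNr -(sum_rel (lr_syz L l)).
  by apply: big1 => j _; rewrite lr_syz_rel ?mul0r.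
- move=> f fr; apply: (lr_syzP (l0 := L)) => j jn.
  exact: (fr j.+1).
- exact: lr_syz_inj.
Qed.

Lemma euler_resolution_cases : exists e,
  [\/ inhabited (euler_resolution A e 1 0 0) /\ d = e.+1,
      inhabited (euler_resolution A e 2 1 0) /\ d = e
    | inhabited (euler_resolution A e 4 4 1) /\ d.+1 = e].
Proof.
have resolve delta n m k : linear_resolution zero_ideal delta n m k ->
    exists e, inhabited (euler_resolution A e n m k) /\ (delta + d)%N = e.+1.
  move=> L; exists (delta + d).-1; rewrite prednK ?(zero_ideal_degree L) //.
  split=> //; apply: (horseshoe L).
  by rewrite prednK // (zero_ideal_degree L).
have := pencil_ideal_cases zero_ideal_ideal zero_ideal_minors T_rank zero_ideal_saturated.
case=> [J1|[phi [psi [ind JE]]]|[p0 [p1 [p2 [p3 [fr JE]]]]]|[p0 [p1 [p2 [p3 [fr JE]]]]]].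
- by have [e [h de]] := resolve _ _ _ _ (unit_resolution J1 zero_ideal_ideal); exists e; apply: Or31.
- by have [e [h [de]]] := resolve _ _ _ _ (line_resolution ind JE); exists e; apply: Or32.
- by have [e [h [de]]] := resolve _ _ _ _ (two_lines_resolution fr JE); exists e; apply: Or33.
- by have [e [h [de]]] := resolve _ _ _ _ (double_line_resolution fr JE); exists e; apply: Or33.
Qed.

End LinearField.

(** * Regular functions on open sets of P^3 *)

Section Fractions.
Variable K : closedFieldType.
Local Notation S := {mpoly K[4]}.
Implicit Types (p q r : S) (x y : point K) (U V W : opens K).
Implicit Types (phi psi : point K -> K).

Lemma pevalM p q x : peval (p * q) x = peval p x * peval q x.
Proof. exact: mevalM. Qed.
Lemma pevalD p q x : peval (p + q) x = peval p x + peval q x.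
Proof. exact: mevalD. Qed.
Lemma pevalB p q x : peval (p - q) x = peval p x - peval q x.
Proof. exact: mevalB. Qed.
Lemma pevalN p x : peval (- p) x = - peval p x.
Proof. exact: mevalN. Qed.
Lemma peval0 x : peval 0 x = 0.
Proof. exact: meval0. Qed.
Lemma peval1 x : peval 1 x = 1.
Proof. exact: meval1. Qed.
Lemma pevalC c x : peval c%:MP x = c.
Proof. exact: mevalC. Qed.
Lemma pevalX i x : peval 'X_i x = sval x i.
Proof. exact: mevalXU. Qed.
Lemma peval_exp p n x : peval (p ^+ n) x = peval p x ^+ n.
Proof. exact: rmorphXn. Qed.
Lemma peval_sum (I : Type) (s : seq I) (P : pred I) (F : I -> S) x :
  peval (\sum_(i <- s | P i) F i) x = \sum_(i <- s | P i) peval (F i) x.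
Proof. exact: raddf_sum. Qed.
Definition pevalE := (pevalM, pevalD, pevalB, pevalN, peval0, peval1, pevalC, pevalX).

Lemma point_coord x : exists i, sval x i != 0.
Proof. by case: x => x /= /existsP. Qed.

Lemma peval_eq0 p : (forall x, peval p x = 0) -> p = 0.
Proof.
move=> h; suff : p * 'X_o0 = 0.
  by move/eqP; rewrite mulf_eq0 (negPf (mpolyXU_neq0 _ _)) orbF => /eqP.
apply: mpoly_eq0 => x; rewrite mevalM mevalXU.
have [x0|x0] := eqVneq (x o0) 0; first by rewrite x0 mulr0.
have xP : [exists i, x i != 0] by apply/existsP; exists o0.
by have := h (exist _ x xP); rewrite /peval /= => ->; rewrite mul0r.
Qed.

Lemma peval_neq0 p x : peval p x != 0 -> p != 0.
Proof. by apply: contra => /eqP ->; rewrite peval0. Qed.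

Lemma peval_dense p r : r != 0 -> (forall x, peval r x != 0 -> peval p x = 0) ->
  p = 0.
Proof.
move=> r0 h; suff /eqP : p * r = 0 by rewrite mulf_eq0 (negPf r0) orbF => /eqP.
apply: peval_eq0 => x; rewrite pevalM; have [->|rx] := eqVneq (peval r x) 0.
  by rewrite mulr0.
by rewrite h ?mul0r.
Qed.

Lemma exists_point p : p != 0 -> exists x, peval p x != 0.
Proof.
move=> p0; apply: contrapT => nx; case/eqP: p0; apply: peval_eq0 => x.
by apply/eqP; apply: contrapT => /negP h; apply: nx; exists x.
Qed.

Lemma homogX (i : 'I_4) : ('X_i : S) \is 1.-homog.
Proof. by rewrite dhomogX /= mdeg1. Qed.

Lemma homogXn (i : 'I_4) n : ('X_i ^+ n : S) \is n.-homog.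
Proof. by rewrite -[X in X.-homog]mul1n; apply: dhomogMn; exact: homogX. Qed.

Lemma basic_subproof q : homogeneous q ->
  zariski_closed (fun x => ~ (fun x => peval q x != 0) x).
Proof.
move=> hq; exists (fun p => p = q); first by move=> p ->.
move=> y; split=> [/negP/negPn/eqP y0 p -> //|/(_ _ erefl) ->].
by rewrite eqxx.
Qed.
Definition basic q (hq : homogeneous q) : opens K := Opens (basic_subproof hq).

Definition chart_homog (j : 'I_4) : homogeneous ('X_j : S) := ex_intro _ 1%N (homogX j).
Definition chart j : opens K := basic (chart_homog j).

Lemma chartE j x : chart j x = (sval x j != 0) :> Prop.
Proof. by rewrite /chart /= pevalX. Qed.

Lemma exists_chart x : exists j, chart j x.
Proof. by have [j h] := point_coord x; exists j; rewrite chartE. Qed.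

Lemma basic_nbhd U x : U x -> exists r n,
  [/\ r \is n.-homog, peval r x != 0 & forall y, peval r y != 0 -> U y].
Proof.
move=> Ux; have [S0 hS SE] := opensP U.
have [r Sr rx] : exists2 r, S0 r & peval r x != 0.
  apply: contrapT => nr; suff : ~ U x by [].
  apply/SE => p Sp; apply/eqP; apply: contrapT => /negP p0; apply: nr.
  by exists p.
have [n hn] := hS r Sr; exists r, n; split=> // y ry.
apply: contrapT => /SE /(_ r Sr) r0; by rewrite r0 eqxx in ry.
Qed.

Definition frac U phi p q := forall y, U y -> peval q y != 0 ->
  phi y = peval p y / peval q y.

Lemma frac_cross U phi p q p' q' x : U x -> frac U phi p q -> frac U phi p' q' ->
  peval q x != 0 -> peval q' x != 0 -> p * q' = p' * q.
Proof.
move=> Ux h h' qx q'x; have [r [n [rn rx rU]]] := basic_nbhd Ux.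
apply: subr0_eq.
apply: (@peval_dense _ (r * q * q')).
  by rewrite !mulf_neq0 // ?(peval_neq0 rx) ?(peval_neq0 qx) ?(peval_neq0 q'x).
move=> y; rewrite !pevalM !mulf_eq0 !negb_or => /andP[/andP[/rU Uy qy] q'y].
have := h y Uy qy; rewrite (h' y Uy q'y) pevalB !pevalM => /eqP.
by rewrite eqr_div // => /eqP ->; rewrite subrr.
Qed.

Definition locfrac (k : int) U phi := forall x, U x ->
  exists p q (m n : nat), [/\ p \is m.-homog, q \is n.-homog, peval q x != 0,
    m%:Z = n%:Z + k & frac U phi p q].

(** Sections become functions on all points, 0 outside [U], so that no proof of membership appears
    in their argument. *)
Definition tv k U (s : twfun k U) x : K :=
  if pselect (U x) is left h then s (exist _ x h) else 0.

Lemma tvE k U (s : twfun k U) x (Ux : U x) : tv s x = s (exist _ x Ux).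
Proof.
rewrite /tv; case: pselect => [h|//]; congr (s (exist _ _ _)).
exact: Prop_irrelevance.
Qed.

Lemma tv_ext k U (s t : twfun k U) : (forall x, U x -> tv s x = tv t x) -> s = t.
Proof.
move=> h; apply: twfun_ext => -[x Ux]; have := h x Ux.
by rewrite !(tvE _ Ux).
Qed.

Lemma tv_locfrac k U (s : twfun k U) : locfrac k U (tv s).
Proof.
move=> x Ux; have [V [p [q [m [n [[VU Vx hp hq mn] hs]]]]]] := twvalP s Ux.
have [r [l [hr rx rV]]] := basic_nbhd Vx.
exists (p * r), (q * r), (m + l)%N, (n + l)%N; split.
- exact: dhomogM.
- exact: dhomogM.
- by have [qx _] := hs x Ux Vx; rewrite pevalM mulf_neq0.
- by rewrite !PoszD mn addrAC.
move=> y Uy; rewrite !pevalM mulf_eq0 negb_or => /andP[qy ry].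
have [_ e] := hs y Uy (rV _ ry); rewrite (tvE _ Uy) e.
by rewrite -mulf_div divff // mulr1.
Qed.

Lemma locfrac_regular k U phi : locfrac k U phi ->
  @regular_of_degree K k U (fun z => phi (sval z)).
Proof.
move=> h x Ux; have [p [q [m [n [hp hq qx mn f]]]]] := h x Ux.
exists (capO U (basic (ex_intro _ n hq))), p, q, m, n; split; first split=> //.
  exact: capO_subl.
by move=> y Uy [_ /= qy]; rewrite qy (f _ Uy qy).
Qed.

Definition mkfun k U phi (h : locfrac k U phi) : twfun k U := TwFun (locfrac_regular h).

Lemma tv_mkfun k U phi (h : locfrac k U phi) x : U x -> tv (mkfun h) x = phi x.
Proof. by move=> Ux; rewrite (tvE _ Ux). Qed.

Lemma tvD k U (s t : twfun k U) x : tv (s + t) x = tv s x + tv t x.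
Proof. by rewrite /tv; case: pselect => [h|_] //; rewrite addr0. Qed.

Lemma tvN k U (s : twfun k U) x : tv (- s) x = - tv s x.
Proof. by rewrite /tv; case: pselect => [h|_]; [reflexivity|rewrite oppr0]. Qed.

Lemma tv0 k U x : tv (0 : twfun k U) x = 0.
Proof. by rewrite /tv; case: pselect. Qed.

Lemma tvZ k U (f : regfun U) (s : twfun k U) x : tv (f *: s) x = tv f x * tv s x.
Proof. by rewrite /tv; case: pselect => [h|_] //; rewrite mulr0. Qed.

Lemma tvM U (f g : regfun U) x : tv (f * g) x = tv f x * tv g x.
Proof. by rewrite /tv; case: pselect => [h|_] //; rewrite mulr0. Qed.

Lemma tvC U c x : U x -> tv (regfunC U c) x = c.
Proof. by move=> Ux; rewrite (tvE _ Ux). Qed.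

Lemma tv_res k U V (VU : sub_opens V U) (s : twfun k U) x : V x ->
  tv (twres VU s) x = tv s x.
Proof.
move=> Vx; rewrite (tvE (twres VU s) Vx) (tvE s (VU _ Vx)) /=; exact: twvalE.
Qed.

Lemma eq_frac U phi psi p q : (forall x, U x -> phi x = psi x) -> frac U phi p q ->
  frac U psi p q.
Proof. by move=> e h y Uy qy; rewrite -e // h. Qed.

Lemma eq_locfrac k U phi psi : (forall x, U x -> phi x = psi x) -> locfrac k U phi ->
  locfrac k U psi.
Proof.
move=> e h x Ux; have [p [q [m [n [hp hq qx mn f]]]]] := h x Ux.
by exists p, q, m, n; split=> //; exact: eq_frac f.
Qed.

Lemma frac_sub U V phi p q : sub_opens V U -> frac U phi p q -> frac V phi p q.
Proof. by move=> VU h y /VU Uy qy; exact: h. Qed.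

Lemma locfrac_sub k U V phi : sub_opens V U -> locfrac k U phi -> locfrac k V phi.
Proof.
move=> VU h x /VU Ux; have [p [q [m [n [hp hq qx mn f]]]]] := h x Ux.
by exists p, q, m, n; split=> //; exact: frac_sub f.
Qed.

Lemma locfrac_local k U phi : (forall x, U x -> exists V, [/\ V x & locfrac k (capO U V) phi]) ->
  locfrac k U phi.
Proof.
move=> h x Ux; have [V [Vx hV]] := h x Ux.
have [p [q [m [n [hp hq qx mn f]]]]] := hV x (conj Ux Vx).
have [r [l [hr rx rV]]] := basic_nbhd Vx.
exists (p * r), (q * r), (m + l)%N, (n + l)%N; split.
- exact: dhomogM.
- exact: dhomogM.
- by rewrite pevalM mulf_neq0.
- by rewrite !PoszD mn addrAC.
move=> y Uy; rewrite !pevalM mulf_eq0 negb_or => /andP[qy ry].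
have -> : phi y = peval p y / peval q y by apply: f => //; split=> //; exact: rV.
by rewrite -mulf_div divff // mulr1.
Qed.

Lemma frac_mul U phi psi p q p' q' : frac U phi p q -> frac U psi p' q' ->
  frac U (fun x => phi x * psi x) (p * p') (q * q').
Proof.
move=> h h' y Uy; rewrite pevalM mulf_eq0 negb_or => /andP[qy q'y].
by rewrite h // h' // pevalM mulf_div.
Qed.

Lemma frac_add U phi psi p q p' q' : frac U phi p q -> frac U psi p' q' ->
  frac U (fun x => phi x + psi x) (p * q' + p' * q) (q * q').
Proof.
move=> h h' y Uy; rewrite pevalM mulf_eq0 negb_or => /andP[qy q'y].
by rewrite h // h' // pevalD !pevalM addf_div.
Qed.

Lemma locfracM k l m U phi psi : k + l = m -> locfrac k U phi -> locfrac l U psi ->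
  locfrac m U (fun x => phi x * psi x).
Proof.
move=> <- h h' x Ux.
have [p [q [a [b [hp hq qx ab f]]]]] := h x Ux.
have [p' [q' [a' [b' [hp' hq' q'x ab' f']]]]] := h' x Ux.
exists (p * p'), (q * q'), (a + a')%N, (b + b')%N; split.
- exact: dhomogM.
- exact: dhomogM.
- by rewrite pevalM mulf_neq0.
- by rewrite !PoszD ab ab' addrACA.
- exact: frac_mul.
Qed.

Lemma locfracD k U phi psi : locfrac k U phi -> locfrac k U psi ->
  locfrac k U (fun x => phi x + psi x).
Proof.
move=> h h' x Ux.
have [p [q [a [b [hp hq qx ab f]]]]] := h x Ux.
have [p' [q' [a' [b' [hp' hq' q'x ab' f']]]]] := h' x Ux.
exists (p * q' + p' * q), (q * q'), (a + b')%N, (b + b')%N; split.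
- have e : (a + b' = a' + b)%N by lia.
  by apply: rpredD; [|rewrite e]; exact: dhomogM.
- exact: dhomogM.
- by rewrite pevalM mulf_neq0.
- by rewrite !PoszD ab addrAC.
- exact: frac_add.
Qed.

Lemma locfrac_poly (n : nat) U p : p \is n.-homog -> locfrac n U (peval p).
Proof.
move=> hp x Ux; exists p, 1, n, 0%N; split=> //.
- exact: dhomog1.
- by rewrite peval1 oner_eq0.
- by move=> y _ _; rewrite peval1 divr1.
Qed.

Lemma locfracC U c : locfrac 0 U (fun=> c).
Proof.
apply: (@eq_locfrac _ _ (peval c%:MP)); first by move=> x _; rewrite pevalC.
by apply: locfrac_poly; rewrite -[c%:MP]mulr1 mul_mpolyC dhomogZ ?dhomog1.
Qed.

Lemma locfrac0 k U : locfrac k U (fun=> 0).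
Proof.
apply: (@eq_locfrac _ _ (tv (0 : twfun k U))); last exact: tv_locfrac.
by move=> x _; rewrite tv0.
Qed.

Lemma locfracN k U phi : locfrac k U phi -> locfrac k U (fun x => - phi x).
Proof.
move=> h; apply: (@eq_locfrac _ _ (fun x => -1 * phi x)).
  by move=> x _; rewrite mulN1r.
exact: (@locfracM 0 k k U (fun=> -1) phi (add0r k) (@locfracC U (-1)) h).
Qed.

Lemma locfracB k U phi psi : locfrac k U phi -> locfrac k U psi ->
  locfrac k U (fun x => phi x - psi x).
Proof. by move=> h h'; apply: locfracD h (locfracN h'). Qed.

Lemma locfrac_sum k U (I : Type) (s : seq I) (F : I -> point K -> K) :
  (forall i, locfrac k U (F i)) -> locfrac k U (fun x => \sum_(i <- s) F i x).
Proof.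
move=> h; elim: s => [|i s IHs].
  by apply: (@eq_locfrac _ _ (fun=> 0)); [move=> x _; rewrite big_nil|exact: locfrac0].
apply: (@eq_locfrac _ _ (fun x => F i x + \sum_(j <- s) F j x)).
  by move=> x _; rewrite big_cons.
exact: locfracD (h i) IHs.
Qed.

Lemma locfrac_inv (n : nat) U p : p \is n.-homog -> (forall x, U x -> peval p x != 0) ->
  locfrac (- n%:Z) U (fun x => (peval p x)^-1).
Proof.
move=> hp h x Ux; exists 1, p, 0%N, n; split=> //.
- exact: dhomog1.
- exact: h.
- by rewrite subrr.
- by move=> y _ _; rewrite peval1 mul1r.
Qed.

(** All local fractions of phi are equal as rational functions. Hence one of them is regular along
    the line x_2 = x_3 = 0, and [dvd_of_regular] makes its denominator divide its numerator. *)
Lemma global_poly (k : int) phi : locfrac k (P3 K) phi -> exists p,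
  (p = 0 \/ exists2 n : nat, k = n & p \is n.-homog) /\ forall x, phi x = peval p x.
Proof.
move=> h; have [x0 x0i] := @exists_point 1 (oner_neq0 _).
have [p [q [m [n [hp hq qx mn f]]]]] := h x0 I.
have q0 := peval_neq0 qx.
have cross p' q' x : peval q' x != 0 -> frac (P3 K) phi p' q' -> p * q' = p' * q.
  move=> q'x f'; apply: subr0_eq.
  apply: (@peval_dense _ (q * q')); first by rewrite mulf_neq0 ?(peval_neq0 q'x).
  move=> y; rewrite pevalM mulf_eq0 negb_or => /andP[qy q'y].
  have := f y I qy; rewrite (f' y I q'y) pevalB !pevalM => /eqP.
  by rewrite eqr_div // => /eqP ->; rewrite subrr.
have [r pE] : dvd q p.
  apply: (@dvd_of_regular _ _ p q m n o0 o1) => // x _ x01.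
  have xP : [exists i, x i != 0].
    by apply/existsP; case: x01 => h1; [exists o0|exists o1].
  have [p' [q' [m' [n' [hp' hq' q'x mn' f']]]]] := h (exist _ x xP) I.
  by exists p', q'; split=> //; exact: cross q'x f'.
exists r; split; last first.
  move=> x; have [p' [q' [m' [n' [hp' hq' q'x mn' f']]]]] := h x I.
  rewrite (f' x I q'x); have := cross _ _ _ q'x f'; rewrite pE.
  move=> e; have -> : p' = r * q' by apply: (mulIf q0); rewrite -e; ring.
  by rewrite pevalM mulfK.
rewrite pE in hp; have [->|[nm hr]] := dhomog_quotient q0 hq hp; [by left|right].
by exists (m - n)%N => //; lia.
Qed.

End Fractions.

(** * Derivations and homogeneous vector fields *)

Section Derivatives.
Variable K : closedFieldType.
Local Notation S := {mpoly K[4]}.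
Implicit Types (p q r : S) (x y : point K) (U V W : opens K).
Implicit Types (phi psi : point K -> K).

Lemma dhomog_mderiv i p m : p \is m.-homog -> p^`M(i) \is m.-1.-homog.
Proof.
move=> /dhomogP pm; apply/dhomogP => m'; rewrite mcoeff_msupp mcoeff_mderiv.
have [mp _|mp] := boolP ((m' + U_(i))%MM \in msupp p); last first.
  by rewrite (memN_msupp_eq0 mp) mul0rn eqxx.
by rewrite -(pm _ mp) /= mdegD mdeg1 addn1.
Qed.

Lemma mpoly_euler p m : p \is m.-homog -> \sum_i 'X_i * p^`M(i) = p *+ m.
Proof.
move=> /dhomogP pm.
have mono (m' : 'X_{1..4}) : \sum_i 'X_i * ('X_[K, m'])^`M(i) = 'X_[K, m'] *+ mdeg m'.
  rewrite mdegE -sumrMnr; apply: eq_bigr => i _; rewrite mderivX -scalerAr.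
  have [->|m0] := posnP (m' i); first by rewrite scale0r mulr0n.
  rewrite -mpolyXD addmC submK; last by rewrite lep1mP -lt0n.
  by rewrite scaler_nat.
transitivity (\sum_(m' <- msupp p) p@_m' *: ('X_[K, m'] *+ mdeg m')).
  rewrite (eq_bigr (fun i => \sum_(m' <- msupp p) p@_m' *: ('X_i * ('X_[K, m'])^`M(i)))).
    rewrite exchange_big /=; apply: eq_bigr => m' _.
    by rewrite -scaler_sumr mono.
  move=> i _; rewrite {1}[p]mpolyE raddf_sum mulr_sumr; apply: eq_bigr => m' _.
  by rewrite /= mderivZ scalerAr.
rewrite [in RHS](mpolyE p) -sumrMnl big_seq [RHS]big_seq; apply: eq_bigr => m' mp.
by rewrite (pm _ mp) scalerMnr.
Qed.

Definition dquot i p q x :=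
  (peval p^`M(i) x * peval q x - peval p x * peval q^`M(i) x) / peval q x ^+ 2.

Lemma dquot_eq i p q p' q' x : p * q' = p' * q -> peval q x != 0 ->
  peval q' x != 0 -> dquot i p q x = dquot i p' q' x.
Proof.
move=> e qx q'x; rewrite /dquot.
have := congr1 (fun r => peval r^`M(i) x) e; have := congr1 (fun r => peval r x) e.
rewrite /= !mderivM !pevalD !pevalM => e1 e2.
apply/eqP; rewrite eqr_div ?expf_neq0 //; apply/eqP.
move: qx q'x e1 e2; move: (peval p x) (peval q x) (peval p' x) (peval q' x)
  (peval p^`M(i) x) (peval q^`M(i) x) (peval p'^`M(i) x) (peval q'^`M(i) x).
move=> P Q P' Q' dP dQ dP' dQ' qx q'x e1 e2.
transitivity (Q * Q' * (dP * Q' + P * dQ') - Q * dQ' * (P * Q') - Q' * dQ * (P * Q')).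
  by ring.
by rewrite e1 e2; ring.
Qed.

(* The partial derivative of phi, computed from any fraction which represents  *)
(* phi near x; it is 0 when there is no such fraction.                         *)
Definition dval U i phi x : K :=
  if pselect (exists pq : S * S, peval pq.2 x != 0 /\ frac U phi pq.1 pq.2)
  is left h then dquot i (sval (cid h)).1 (sval (cid h)).2 x else 0.

Lemma dvalE U i phi p q x : U x -> frac U phi p q -> peval q x != 0 ->
  dval U i phi x = dquot i p q x.
Proof.
move=> Ux f qx; rewrite /dval; case: pselect => [h|[]]; last by exists (p, q).
case: cid => -[p' q'] /= [q'x f']; apply: dquot_eq => //.
exact: frac_cross Ux f' f q'x qx.
Qed.

Lemma eq_dval U V i phi psi x : sub_opens V U -> V x -> (forall y, V y -> phi y = psi y) ->
  (exists k, locfrac k U phi) -> dval V i psi x = dval U i phi x.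
Proof.
move=> VU Vx e [k /(_ x (VU x Vx)) [p [q [m [n [hp hq qx mn f]]]]]].
rewrite (dvalE i (VU x Vx) f qx); apply: dvalE => //.
by apply: eq_frac e _; exact: frac_sub f.
Qed.

(** The degree of a derivative is a truncated predecessor. Both degrees are made positive by a
    coordinate that does not vanish at x. *)
Lemma locfrac_pos k U phi x : U x -> locfrac k U phi -> exists p q (m n : nat),
  [/\ p \is m.+1.-homog, q \is n.+1.-homog, peval q x != 0,
    m%:Z = n%:Z + k & frac U phi p q].
Proof.
move=> Ux h; have [p [q [m [n [hp hq qx mn f]]]]] := h x Ux.
have [j xj] := point_coord x.
exists (p * 'X_j), (q * 'X_j), m, n; split=> //.
- by have := dhomogM hp (@homogX K j); rewrite addn1.
- by have := dhomogM hq (@homogX K j); rewrite addn1.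
- by rewrite pevalM pevalX mulf_neq0.
move=> y Uy; rewrite !pevalM mulf_eq0 negb_or => /andP[qy yj].
by rewrite -mulf_div divff // mulr1; exact: f.
Qed.

Lemma locfrac_dval k l U i phi : l = k - 1 -> locfrac k U phi ->
  locfrac l U (dval U i phi).
Proof.
move=> -> h x Ux; have [p [q [m [n [hp hq qx mn f]]]]] := locfrac_pos Ux h.
exists (p^`M(i) * q - p * q^`M(i)), (q ^+ 2), (m + n.+1)%N, (n.+1 * 2)%N; split.
- apply: rpredB; first exact: dhomogM (dhomog_mderiv i hp) hq.
  by rewrite addnS -addSn; exact: dhomogM hp (dhomog_mderiv i hq).
- exact: dhomogMn.
- by rewrite peval_exp expf_neq0.
- lia.
move=> y Uy; rewrite peval_exp expf_eq0 /= => qy.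
by rewrite (dvalE i Uy f qy) /dquot pevalB !pevalM.
Qed.

Lemma dvalD k l U i phi psi x : U x -> locfrac k U phi -> locfrac l U psi ->
  dval U i (fun y => phi y + psi y) x = dval U i phi x + dval U i psi x.
Proof.
move=> Ux h h'; have [p [q [m [n [_ _ qx _ f]]]]] := h x Ux.
have [p' [q' [m' [n' [_ _ q'x _ f']]]]] := h' x Ux.
rewrite (dvalE i Ux f qx) (dvalE i Ux f' q'x).
rewrite (dvalE i Ux (frac_add f f')) ?pevalM ?mulf_neq0 //.
rewrite /dquot !mderivD !mderivM !pevalE; field.
by rewrite qx q'x.
Qed.

Lemma dvalM k l U i phi psi x : U x -> locfrac k U phi -> locfrac l U psi ->
  dval U i (fun y => phi y * psi y) x = phi x * dval U i psi x + psi x * dval U i phi x.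
Proof.
move=> Ux h h'; have [p [q [m [n [_ _ qx _ f]]]]] := h x Ux.
have [p' [q' [m' [n' [_ _ q'x _ f']]]]] := h' x Ux.
rewrite (dvalE i Ux f qx) (dvalE i Ux f' q'x).
rewrite (dvalE i Ux (frac_mul f f')) ?pevalM ?mulf_neq0 //.
rewrite (f x Ux qx) (f' x Ux q'x).
rewrite /dquot !mderivM !pevalE; field.
by rewrite qx q'x.
Qed.

Lemma dvalC U i c x : U x -> dval U i (fun=> c) x = 0.
Proof.
move=> Ux; have f : frac U (fun=> c) c%:MP 1.
  by move=> y _ _; rewrite peval1 divr1 pevalC.
rewrite (dvalE i Ux f) ?peval1 ?oner_eq0 // /dquot -[1]/(1%:MP) !mderivC.
by rewrite peval0 mul0r mulr0 subr0 mul0r.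
Qed.

Lemma dval_euler U phi x : U x -> locfrac 0 U phi ->
  \sum_i sval x i * dval U i phi x = 0.
Proof.
move=> Ux h; have [p [q [m [n [hp hq qx mn f]]]]] := h x Ux.
have {}mn : m = n by lia.
have ev r d : r \is d.-homog -> \sum_i peval ('X_i * r^`M(i)) x = peval r x *+ d.
  move=> hr; transitivity (peval (\sum_i 'X_i * r^`M(i)) x); first by rewrite peval_sum.
  by rewrite (mpoly_euler hr); exact: raddfMn.
transitivity ((\sum_i peval ('X_i * p^`M(i)) x * peval q x
  - \sum_i peval ('X_i * q^`M(i)) x * peval p x) / peval q x ^+ 2).
  rewrite -sumrB mulr_suml; apply: eq_bigr => i _.
  by rewrite (dvalE i Ux f qx) /dquot !pevalM pevalX; ring.
rewrite -[X in (X - _) / _]mulr_suml -[X in (_ - X) / _]mulr_suml (ev _ _ hp) (ev _ _ hq) mn.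
by rewrite !mulrnAl [peval q x * _]mulrC subrr mul0r.
Qed.

End Derivatives.

Section TangentFields.
Variable K : closedFieldType.
Local Notation S := {mpoly K[4]}.
Local Notation T := (tangent_sheaf K).
Implicit Types (x y : point K) (U V W : opens K) (b : 'I_4 -> point K -> K).

(** These are the sections of O(1)^4, which the Euler sequence maps onto the tangent sheaf. *)
Definition is_field U b := forall i, locfrac 1 U (b i).

Definition lie b V phi y := \sum_i b i y * dval V i phi y.

Lemma locfrac_lie U V b k phi : is_field U b -> sub_opens V U -> locfrac k V phi ->
  locfrac k V (lie b V phi).
Proof.
move=> hb VU h; apply: locfrac_sum => i.
apply: (@locfracM _ 1 (k - 1)); first by rewrite addrC subrK.
  exact: locfrac_sub VU (hb i).
exact: locfrac_dval h.
Qed.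

Definition derfun U b (hb : is_field U b) V (VU : sub_opens V U) (f : lineb K 0 V) :
  lineb K 0 V := mkfun (locfrac_lie hb VU (tv_locfrac f)).

Lemma tv_derfun U b (hb : is_field U b) V (VU : sub_opens V U) f x : V x ->
  tv (derfun hb VU f : twfun 0 V) x = lie b V (tv f) x.
Proof. exact: tv_mkfun. Qed.

Lemma derfun_res U b (hb : is_field U b) V W (VU : sub_opens V U) (WV : sub_opens W V)
  (WU : sub_opens W U) s : res WV (derfun hb VU s) = derfun hb WU (res WV s).
Proof.
apply: tv_ext => x Wx; rewrite tv_res // !tv_derfun //; last exact: WV.
apply: eq_bigr => i _; congr (_ * _); symmetry; apply: eq_dval => //.
  by move=> y Wy; rewrite tv_res.
by exists 0; exact: tv_locfrac.
Qed.

Lemma derfun_derivation U b (hb : is_field U b) V (VU : sub_opens V U) :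
  derivation_cond K V (derfun hb VU).
Proof.
split=> [f g|f g|c]; apply: tv_ext => x Vx.
- rewrite tvD !tv_derfun // /lie -big_split; apply: eq_bigr => i _ /=.
  rewrite -mulrDr -(dvalD i Vx (tv_locfrac f) (tv_locfrac g)); congr (_ * _).
  by apply: eq_dval => // [y _|]; [rewrite tvD|exists 0; apply: locfracD; exact: tv_locfrac].
- rewrite tvD !tvZ !tv_derfun // /lie !mulr_sumr -big_split; apply: eq_bigr => i _ /=.
  rewrite mulrCA [X in _ + X]mulrCA -mulrDr; congr (_ * _).
  rewrite -(dvalM i Vx (tv_locfrac f) (tv_locfrac g)).
  apply: eq_dval => // [y _|]; first by rewrite tvM.
  by exists 0; apply: (locfracM (addr0 0)); exact: tv_locfrac.
- rewrite tv_derfun // tv0 /lie big1 // => i _.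
  have e : dval V i (tv (regfunC V c)) x = dval V i (fun=> c) x.
    apply: eq_dval => //; first by move=> y Vy; rewrite tvC.
    by exists 0; exact: locfracC.
  by rewrite e dvalC ?mulr0.
Qed.

Definition der U b (hb : is_field U b) : T U :=
  @Op K (lineb K 0) (lineb K 0) (derivation_cond K) U (derfun hb)
    (derfun_res hb) (derfun_derivation hb).

End TangentFields.

Section OpEval.
Variables (K : closedFieldType) (F G : sheaf K) (C : opcond F G).
Variables (U : opens K) (a b : op C U).
Variables (V : opens K) (VU : sub_opens V U) (s : F V).

Lemma op_addE : (a + b) V VU s = a V VU s + b V VU s.
Proof. by []. Qed.

Lemma op_scaleE (f : regfun U) : (f *: a) V VU s = regres VU f *: a V VU s.
Proof. by []. Qed.

Lemma op_zeroE : (0 : op C U) V VU s = 0.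
Proof. by []. Qed.

Lemma op_oppE : (- a) V VU s = - a V VU s.
Proof.
transitivity (regres VU (-1) *: a V VU s); first by [].
by rewrite regresN1 scaleN1r.
Qed.

Lemma op_resE W (WU : sub_opens W U) (WV : sub_opens W V) t :
  opres VU a W WV t = a W WU t.
Proof. by congr (a W _ t); exact: Prop_irrelevance. Qed.

End OpEval.

(** * The Euler sequence *)

Section Tangent.
Variable K : closedFieldType.
Local Notation S := {mpoly K[4]}.
Local Notation T := (tangent_sheaf K).
Local Notation chart := (@chart K).
Implicit Types (x y : point K) (U V W : opens K) (b : 'I_4 -> point K -> K).

Definition ratio (i j : 'I_4) y : K := sval y i / sval y j.

Lemma frac_ratio U i j : frac U (ratio i j) 'X_i 'X_j.
Proof. by move=> y _ _; rewrite !pevalX. Qed.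

Lemma locfrac_ratio U i j : sub_opens U (chart j) -> locfrac 0 U (ratio i j).
Proof.
move=> Uj x /Uj; rewrite chartE => xj.
exists 'X_i, 'X_j, 1%N, 1%N; split=> //; [exact: homogX|exact: homogX|by rewrite pevalX|].
exact: frac_ratio.
Qed.

Definition coordfun i j U (Uj : sub_opens U (chart j)) : lineb K 0 U :=
  mkfun (locfrac_ratio i Uj).

Lemma dval_ratio U k i j x : U x -> sval x j != 0 -> dval U k (ratio i j) x =
  ((k == i)%:R * sval x j - sval x i * (k == j)%:R) / sval x j ^+ 2.
Proof.
move=> Ux xj; rewrite (dvalE k Ux (@frac_ratio U i j)) ?pevalX //.
have dX l : peval ('X_l : S)^`M(k) x = (k == l)%:R.
  rewrite mderivX mnm1E eq_sym; case: eqP => [->|_]; last by rewrite scale0r peval0.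
  have -> : (U_(l) - U_(l))%MM = 0%MM by apply/mnmP => i'; rewrite mnmBE mnm0E subnn.
  by rewrite mpolyX0 scale1r peval1.
by rewrite /dquot !dX !pevalX.
Qed.

Lemma lie_ratio U b i j x : U x -> sval x j != 0 ->
  lie b U (ratio i j) x = (b i x * sval x j - b j x * sval x i) / sval x j ^+ 2.
Proof.
move=> Ux xj; rewrite /lie.
under eq_bigr => k _ do rewrite (dval_ratio k i Ux xj) mulrA.
rewrite -mulr_suml; congr (_ / _).
have delta l : \sum_k b k x * (k == l)%:R = b l x.
  by rewrite (bigD1 l) //= eqxx mulr1 big1 ?addr0 // => k /negPf ->; rewrite mulr0.
rewrite -[in RHS](delta i) -[in RHS](delta j) !mulr_suml -sumrB.
by apply: eq_bigr => k _; ring.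
Qed.

Lemma eq_lie V b phi psi x : V x -> (forall y, V y -> phi y = psi y) ->
  (exists k, locfrac k V phi) -> lie b V psi x = lie b V phi x.
Proof.
by move=> Vx e h; apply: eq_bigr => i _; congr (_ * _); apply: eq_dval.
Qed.

(** The function p / x_j^n is a polynomial in the ratios x_i / x_j, to which the Leibniz rule
    applies. *)
Lemma derivation_dehomogenized W j (Wj : sub_opens W (chart j))
    (a : lineb K 0 W -> lineb K 0 W) (n : nat) (p : S) (f : lineb K 0 W) :
  is_derivation a -> (forall i, a (coordfun i Wj) = 0) -> p \is n.-homog ->
  (forall y, W y -> tv (f : twfun 0 W) y = peval p y / sval y j ^+ n) -> a f = 0.
Proof.
move=> [aD aM aC] a0 /dhomogP pn fE.
pose R := (regfun W : comPzRingType).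
pose u (i : 'I_4) : R := coordfun i Wj.
pose N (g : R) := a g = 0.
have NM g h : N g -> N h -> N (g * h).
  by rewrite /N => g0 h0; rewrite aM g0 h0 !scaler0 addr0.
have ND g h : N g -> N h -> N (g + h).
  by rewrite /N => g0 h0; rewrite aD g0 h0 addr0.
have NC c : N (regfunC W c) := aC c.
have N1 : N 1 := aC 1.
have N0 : N 0.
  have -> : (0 : R) = regfunC W 0 by apply: tv_ext => y Wy; rewrite tv0 tvC.
  exact: aC.
pose G : R := \sum_(m <- msupp p) regfunC W p@_m * \prod_i u i ^+ m i.
have tvu i y : W y -> tv (u i : twfun 0 W) y = ratio i j y by exact: tv_mkfun.
have tvX (g : R) k y : W y -> tv (g ^+ k : twfun 0 W) y = tv (g : twfun 0 W) y ^+ k.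
  move=> Wy; elim: k => [|k IHk]; first by rewrite !expr0; exact: (tvC 1 Wy).
  by rewrite !exprS tvM IHk.
have -> : f = G.
  apply: tv_ext => y Wy; rewrite fE //.
  have yj : sval y j != 0 by rewrite -chartE; exact: (Wj y Wy).
  transitivity (\sum_(m <- msupp p) p@_m * \prod_i ratio i j y ^+ m i).
    rewrite /peval mevalE mulr_suml !big_seq; apply: eq_bigr => m mp.
    rewrite -mulrA; congr (_ * _).
    have -> : sval y j ^+ n = \prod_i sval y j ^+ m i.
      by rewrite prodrXr -mdegE (pn _ mp).
    rewrite -prodf_div; apply: eq_bigr => i _.
    by rewrite /ratio expr_div_n.
  rewrite /G; elim: (msupp p) => [|m s IHs]; first by rewrite !big_nil tv0.
  rewrite !big_cons tvD IHs; congr (_ + _); rewrite tvM tvC //; congr (_ * _).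
  elim/big_rec2: _ => [|i g h _ ->]; first by symmetry; exact: (tvC 1 Wy).
  by rewrite tvM tvX // tvu.
suff : N G by [].
rewrite /G; apply: (big_ind N) => [||m _]; [exact: N0|exact: ND|].
apply: (NM); first exact: NC.
apply: (big_ind N) => [||i _]; [exact: N1|exact: NM|].
elim: (m i) => [|k IHk]; first by rewrite expr0.
by rewrite exprS; apply: NM => //; exact: a0.
Qed.

(** Near x a function f satisfies f Q = P, where P and Q are polynomials in the ratios x_i / x_j.
    The derivation kills both, so Q times the image of f is 0, and Q(x) is nonzero. *)
Lemma tangent_eq0 U j (Uj : sub_opens U (chart j)) (E : T U) :
  (forall i, E U (@subO_refl K U) (coordfun i Uj) = 0) -> E = 0.
Proof.
move=> E0; apply: op_ext => V VU f; rewrite op_zeroE.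
apply: tv_ext => x Vx; rewrite tv0.
have [p [q [m [n [hp hq qx mn fr]]]]] := tv_locfrac f Vx.
have {}mn : m = n by lia.
pose W := capO V (basic (ex_intro _ n hq)).
have WV : sub_opens W V := @capO_subl K _ _.
have WU : sub_opens W U := subO_trans WV VU.
have Wj : sub_opens W (chart j) := subO_trans WU Uj.
have Wx : W x by split.
pose a := E W WU; have aP : is_derivation a := opP E WU.
have a0 i : a (coordfun i Wj) = 0.
  have -> : coordfun i Wj = res WU (coordfun i Uj).
    by apply: tv_ext => y Wy; rewrite tv_res // !tv_mkfun //; exact: (WU y).
  rewrite /a -(op_res E (@subO_refl K U) WU WU) E0.
  exact: res0.
have deh (r : S) : r \is n.-homog ->
    locfrac 0 W (fun y => peval r y / sval y j ^+ n).
  move=> hr y Wy; exists r, ('X_j ^+ n), n, n; split=> //.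
  - exact: homogXn.
  - by rewrite peval_exp pevalX expf_neq0 // -chartE; exact: (Wj y Wy).
  - by rewrite addr0.
  - by move=> z _ _; rewrite peval_exp pevalX.
rewrite mn in hp; pose P : regfun W := mkfun (deh p hp); pose Q : regfun W := mkfun (deh q hq).
have aPf : a P = 0.
  by apply: (derivation_dehomogenized aP a0 hp) => y Wy; exact: tv_mkfun.
have aQf : a Q = 0.
  by apply: (derivation_dehomogenized aP a0 hq) => y Wy; exact: tv_mkfun.
have yj y : W y -> sval y j != 0 by move=> Wy; rewrite -chartE; exact: (Wj y Wy).
have PQ : P = (res WV f : regfun W) * Q.
  apply: tv_ext => y Wy; rewrite tvM tv_res // !tv_mkfun //.
  have [Vy /= qy] := Wy; rewrite (fr y Vy qy) mulrA divfK //.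
have : tv (a P : twfun 0 W) x = 0 by rewrite aPf tv0.
have [aD aM aC] := aP; rewrite PQ aM aQf scaler0 add0r tvZ tv_mkfun // => /eqP.
rewrite mulf_eq0 mulf_eq0 (negPf qx) invr_eq0 expf_eq0 (negPf (yj x Wx)) andbF /=.
by rewrite /a -(op_res E VU WV WU) tv_res // => /eqP.
Qed.

(** This is the kernel in the Euler sequence. In one direction the derivation is evaluated on ratios
    of coordinates; in the other, Euler's identity says that x kills functions of degree 0. *)
Lemma der_eq0 U b (hb : is_field U b) : der hb = 0 <->
  forall x i j, U x -> b i x * sval x j = b j x * sval x i.
Proof.
split=> [d0 x i j Ux|h].
  wlog xj : i j / sval x j != 0 => [sym|].
    have [xj|] := eqVneq (sval x j) 0; last exact: sym.
    have [xi|] := eqVneq (sval x i) 0; last by move/(sym j i) ->.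
    by rewrite xi xj !mulr0.
  pose V := capO U (chart j).
  have VU : sub_opens V U := @capO_subl K _ _.
  have Vj : sub_opens V (chart j) := @capO_subr K _ _.
  have Vx : V x by split=> //; rewrite chartE.
  have : tv (der hb V VU (coordfun i Vj) : twfun 0 V) x = 0 by rewrite d0 op_zeroE tv0.
  rewrite tv_derfun // (@eq_lie V b (ratio i j)) //; first last.
  - by exists 0; exact: locfrac_ratio.
  - by move=> y Vy; rewrite tv_mkfun.
  rewrite lie_ratio // => /eqP; rewrite mulf_eq0 invr_eq0 expf_eq0 (negPf xj) andbF orbF.
  by rewrite subr_eq0 => /eqP.
apply: op_ext => V VU f; rewrite op_zeroE; apply: tv_ext => x Vx.
rewrite tv_derfun // tv0; have [j xj] := point_coord x.
rewrite /lie (eq_bigr (fun i => b j x / sval x j * (sval x i * dval V i (tv f) x))).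
  by rewrite -mulr_sumr (dval_euler Vx (tv_locfrac f)) mulr0.
by move=> i _; rewrite mulrA [_ / _ * _]mulrAC -h ?mulfK //; exact: VU.
Qed.

Lemma is_fieldB U b b' : is_field U b -> is_field U b' ->
  is_field U (fun i x => b i x - b' i x).
Proof. by move=> h h' i; exact: locfracB. Qed.

Lemma derB U b b' (hb : is_field U b) (hb' : is_field U b') :
  der (is_fieldB hb hb') = der hb - der hb'.
Proof.
apply: op_ext => V VU f; rewrite op_addE op_oppE; apply: tv_ext => x Vx.
rewrite tvD tvN.
by rewrite !tv_derfun // /lie -sumrB; apply: eq_bigr => i _; rewrite mulrBl.
Qed.

Lemma eq_der U b b' (hb : is_field U b) (hb' : is_field U b') :
  (forall x i j, U x -> b i x * sval x j - b j x * sval x i =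
    b' i x * sval x j - b' j x * sval x i) -> der hb = der hb'.
Proof.
move=> h; apply/eqP; rewrite -subr_eq0 -derB; apply/eqP/der_eq0 => x i j Ux.
apply: subr0_eq.
transitivity (b i x * sval x j - b j x * sval x i -
  (b' i x * sval x j - b' j x * sval x i)); first by ring.
by rewrite h // subrr.
Qed.

Lemma is_field_sub U V b : sub_opens V U -> is_field U b -> is_field V b.
Proof. by move=> VU h i; exact: locfrac_sub VU (h i). Qed.

Lemma der_res U V (VU : sub_opens V U) b (hb : is_field U b) (hb' : is_field V b) :
  res VU (der hb) = der hb'.
Proof.
by apply: op_ext => W WV f; apply: tv_ext => x Wx; rewrite !tv_derfun.
Qed.

Lemma is_fieldZ U (f : regfun U) b : is_field U b ->
  is_field U (fun i x => tv f x * b i x).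
Proof. by move=> h i; apply: (locfracM (add0r 1)) => //; exact: tv_locfrac. Qed.

Lemma derZ U (f : regfun U) b (hb : is_field U b) :
  der (is_fieldZ f hb) = f *: der hb.
Proof.
apply: op_ext => V VU g; rewrite op_scaleE; apply: tv_ext => x Vx.
rewrite tvZ !tv_derfun // tv_res // /lie mulr_sumr; apply: eq_bigr => i _.
by rewrite mulrA.
Qed.

Lemma is_fieldD U b b' : is_field U b -> is_field U b' ->
  is_field U (fun i x => b i x + b' i x).
Proof. by move=> h h' i; exact: locfracD. Qed.

Lemma derD U b b' (hb : is_field U b) (hb' : is_field U b') :
  der (is_fieldD hb hb') = der hb + der hb'.
Proof.
apply: op_ext => V VU f; rewrite op_addE; apply: tv_ext => x Vx.
rewrite tvD !tv_derfun // /lie -big_split; apply: eq_bigr => i _.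
by rewrite mulrDl.
Qed.

(** The lift of [D] to the cone normalised to have no component along x_j. *)
Definition chart_comp U j (Uj : sub_opens U (chart j)) (D : T U) i x :=
  sval x j * tv (D U (@subO_refl K U) (coordfun i Uj) : twfun 0 U) x.

Lemma chart_comp_field U j (Uj : sub_opens U (chart j)) (D : T U) :
  is_field U (chart_comp Uj D).
Proof.
move=> i; apply: (@locfracM _ 1 0); rewrite ?addr0 //; last exact: tv_locfrac.
apply: (@eq_locfrac _ _ _ (peval 'X_j)); first by move=> x _; rewrite pevalX.
by apply: (@locfrac_poly _ 1); exact: homogX.
Qed.

Lemma chart_comp_self U j (Uj : sub_opens U (chart j)) (D : T U) x : U x ->
  chart_comp Uj D j x = 0.
Proof.
move=> Ux; have [_ _ DC] : is_derivation (D U (@subO_refl K U)) := opP D _.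
rewrite /chart_comp; have -> : coordfun j Uj = regfunC U 1.
  apply: tv_ext => y Uy; rewrite tv_mkfun // tvC // /ratio divff // -chartE.
  exact: Uj.
by rewrite DC tv0 mulr0.
Qed.

Lemma tangent_der U j (Uj : sub_opens U (chart j)) (D : T U) :
  D = der (chart_comp_field Uj D).
Proof.
apply: subr0_eq; apply: (tangent_eq0 (Uj := Uj)) => i.
rewrite op_addE op_oppE; apply/eqP; rewrite subr_eq0; apply/eqP.
apply: tv_ext => x Ux; rewrite tv_derfun //.
have xj : sval x j != 0 by rewrite -chartE; exact: Uj.
rewrite (@eq_lie U _ (ratio i j)) //; first last.
- by exists 0; exact: locfrac_ratio.
- by move=> y Uy; rewrite tv_mkfun.
rewrite lie_ratio // chart_comp_self // mul0r subr0 /chart_comp.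
by field.
Qed.

End Tangent.

Section Morphisms.
Variable K : closedFieldType.
Implicit Types (F G : sheaf K) (U V W : opens K).

Section Hom.
Variables (F G : sheaf K) (U : opens K) (h : op (linear_cond F G) U).
Variables (V : opens K) (VU : sub_opens V U).

Lemma hom_add s t : h V VU (s + t) = h V VU s + h V VU t.
Proof. by have [e _] : is_linear (h V VU) := opP h VU; exact: e. Qed.

Lemma hom_scale f s : h V VU (f *: s) = f *: h V VU s.
Proof. by have [_ e] : is_linear (h V VU) := opP h VU; exact: e. Qed.

Lemma hom_zero : h V VU 0 = 0.
Proof. by apply: (addrI (h V VU 0)); rewrite -hom_add !addr0. Qed.

Lemma hom_opp s : h V VU (- s) = - h V VU s.
Proof. by apply: (addrI (h V VU s)); rewrite -hom_add !subrr hom_zero. Qed.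
End Hom.

Section App.
Variables (F G : sheaf K) (a : mor F G) (U : opens K).

Lemma app_add (s t : F U) : app a (s + t) = app a s + app a t.
Proof. exact: hom_add. Qed.

Lemma app_scale f (s : F U) : app a (f *: s) = f *: app a s.
Proof. exact: hom_scale. Qed.

Lemma app_zero : app a (0 : F U) = 0.
Proof. exact: hom_zero. Qed.

Lemma app_opp (s : F U) : app a (- s) = - app a s.
Proof. exact: hom_opp. Qed.

Lemma app_res V (VU : sub_opens V U) (s : F U) : res VU (app a s) = app a (res VU s).
Proof. exact: op_res. Qed.

Lemma app_inj_eq0 (s : F U) : mor_injective a -> app a s = 0 -> s = 0.
Proof. by move=> ainj as0; apply: (ainj U); rewrite as0 app_zero. Qed.
End App.

End Morphisms.

(** * The 1-form of a distribution *)

Section Distribution.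
Variables (K : closedFieldType) (d : nat) (F : distribution K d).
Local Notation S := {mpoly K[4]}.
Local Notation T := (tangent_sheaf K).
Local Notation chart := (@chart K).
Local Notation N := (d%:Z + 2).
Local Notation I := (ideal (dist_sing F)).
Local Notation io := (ideal_incl (dist_sing F)).
Local Notation pr := (dist_proj F).
Implicit Types (x y : point K) (U V W : opens K) (b : 'I_4 -> point K -> K).

(** Sections of the twisted ideal are operators O(- N) -> I: the projection of [D] is evaluated at
    [s], and the result is read as a function. *)
Definition contract U (D : T U) V (VU : sub_opens V U) (s : lineb K (- N) V) :
  twfun 0 V := app io ((app pr D : op (linear_cond (lineb K (- N)) I) U) V VU s).

Lemma contractD U (D E : T U) V (VU : sub_opens V U) s :
  contract (D + E) VU s = contract D VU s + contract E VU s.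
Proof. by rewrite /contract app_add op_addE app_add. Qed.

Lemma contractZ U f (D : T U) V (VU : sub_opens V U) s :
  contract (f *: D) VU s = regres VU f *: contract D VU s.
Proof. by rewrite /contract app_scale op_scaleE app_scale. Qed.

Lemma contract_scale U (D : T U) V (VU : sub_opens V U) (f : regfun V) s :
  contract D VU (f *: s) = f *: contract D VU s.
Proof. by rewrite /contract hom_scale app_scale. Qed.

Lemma contract_res U (D : T U) V (VU : sub_opens V U) W (WV : sub_opens W V)
  (WU : sub_opens W U) s : twres WV (contract D VU s) = contract D WU (res WV s).
Proof.
rewrite /contract -(op_res (app pr D : op (linear_cond (lineb K (- N)) I) U) VU WV WU).
exact: (app_res io WV).
Qed.

Lemma contract_resl U (D : T U) V (VU : sub_opens V U) W (WV : sub_opens W V)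
  (WU : sub_opens W U) s : contract (res VU D) WV s = contract D WU s.
Proof.
rewrite /contract -(app_res pr); congr (app io _).
exact: (op_resE (app pr D : op (linear_cond (lineb K (- N)) I) U)).
Qed.

Lemma locfrac_gen U j : sub_opens U (chart j) ->
  locfrac (- N) U (fun x => (sval x j ^+ (d + 2))^-1).
Proof.
move=> Uj; apply: (@eq_locfrac _ _ _ (fun x => (peval ('X_j ^+ (d + 2)) x)^-1)).
  by move=> x _; rewrite peval_exp pevalX.
rewrite -PoszD; apply: locfrac_inv; first exact: homogXn.
by move=> x /Uj; rewrite chartE peval_exp pevalX; exact: expf_neq0.
Qed.

Definition chart_gen U j (Uj : sub_opens U (chart j)) : lineb K (- N) U :=
  mkfun (locfrac_gen Uj).

Lemma tv_chart_gen U j (Uj : sub_opens U (chart j)) x : U x ->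
  tv (chart_gen Uj : twfun (- N) U) x = (sval x j ^+ (d + 2))^-1.
Proof. exact: tv_mkfun. Qed.

Lemma chart_gen_res U V j (Uj : sub_opens U (chart j)) (VU : sub_opens V U)
  (Vj : sub_opens V (chart j)) : res VU (chart_gen Uj) = chart_gen Vj.
Proof. by apply: tv_ext => x Vx; rewrite tv_res // !tv_mkfun //; exact: VU. Qed.

Lemma chart_gen_span U j (Uj : sub_opens U (chart j)) (s : lineb K (- N) U) :
  exists f : regfun U, s = f *: chart_gen Uj /\
    forall x, U x -> tv f x = tv (s : twfun (- N) U) x * sval x j ^+ (d + 2).
Proof.
have h : locfrac 0 U (fun x => tv (s : twfun (- N) U) x * peval ('X_j ^+ (d + 2)) x).
  apply: (@locfracM _ (- N) N); first by rewrite addNr.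
    exact: tv_locfrac.
  by rewrite -PoszD; apply: locfrac_poly; exact: homogXn.
exists (mkfun h); split; last by move=> x Ux; rewrite tv_mkfun // peval_exp pevalX.
apply: tv_ext => x Ux; rewrite tvZ !tv_mkfun // peval_exp pevalX mulfK //.
by rewrite expf_neq0 // -chartE; exact: (Uj x).
Qed.

Definition chart_contract U (D : T U) j y : K :=
  sval y j ^+ (d + 2) *
    tv (contract D (@capO_subl K U (chart j)) (chart_gen (@capO_subr K U (chart j)))) y.

Lemma chart_contractE U (D : T U) j y V (VU : sub_opens V U)
    (Vj : sub_opens V (chart j)) : V y -> chart_contract D j y =
  sval y j ^+ (d + 2) * tv (contract D VU (chart_gen Vj)) y.
Proof.
move=> Vy; pose C := capO U (chart j).
have VC : sub_opens V C by move=> z Vz; split; [exact: VU|exact: Vj].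
rewrite /chart_contract; congr (_ * _).
rewrite -(@tv_res _ _ _ _ VC) // (contract_res _ _ _ VU); congr (tv _ y).
by rewrite (chart_gen_res _ _ Vj).
Qed.

Lemma chart_contract_indep U (D : T U) i j y : U y -> chart i y -> chart j y ->
  chart_contract D i y = chart_contract D j y.
Proof.
move=> Uy iy jy; pose V := capO U (capO (chart i) (chart j)).
have VU : sub_opens V U by move=> z [].
have Vi : sub_opens V (chart i) by move=> z [_ []].
have Vj : sub_opens V (chart j) by move=> z [_ []].
have Vy : V y by [].
rewrite (chart_contractE D VU Vi Vy) (chart_contractE D VU Vj Vy).
have [f [sE fE]] := chart_gen_span Vj (chart_gen Vi).
rewrite sE contract_scale tvZ fE // tv_chart_gen // mulrA; congr (_ * _).
by rewrite mulrA mulfV ?mul1r // expf_neq0 // -chartE.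
Qed.

(* The section of O(d + 2) to which D is mapped. *)
Definition contraction U (D : T U) y : K :=
  chart_contract D (sval (cid (exists_chart y))) y.

Lemma contractionE U (D : T U) j y : U y -> chart j y ->
  contraction D y = chart_contract D j y.
Proof.
by move=> Uy jy; apply: chart_contract_indep => //; exact: svalP (cid (exists_chart y)).
Qed.

Lemma contractionD U (D E : T U) y : contraction (D + E) y = contraction D y + contraction E y.
Proof. by rewrite /contraction /chart_contract contractD tvD mulrDr. Qed.

Lemma contractionZ U f (D : T U) y : U y ->
  contraction (f *: D) y = tv f y * contraction D y.
Proof.
move=> Uy; have [j jy] := exists_chart y; rewrite !(contractionE _ Uy jy).
rewrite /chart_contract contractZ tvZ mulrCA; congr (_ * _).
by rewrite tv_res.
Qed.

Lemma contraction_res U V (VU : sub_opens V U) (D : T U) y : V y ->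
  contraction (res VU D) y = contraction D y.
Proof.
move=> Vy; have [j jy] := exists_chart y.
rewrite (contractionE _ Vy jy) (contractionE _ (VU y Vy) jy).
pose C := capO V (chart j).
have CU : sub_opens C U := subO_trans (@capO_subl K _ _) VU.
rewrite (chart_contractE D CU (@capO_subr K _ _)) //.
by rewrite /chart_contract (contract_resl _ _ _ CU).
Qed.

Lemma locfrac_contraction U (D : T U) : locfrac N U (contraction D).
Proof.
apply: locfrac_local => x Ux; have [j jx] := exists_chart x.
exists (chart j); split=> //.
apply: (@eq_locfrac _ _ _ (chart_contract D j)).
  by move=> y [Uy jy]; rewrite (contractionE D Uy jy).
apply: (@locfracM _ N 0); first by rewrite addr0.
  apply: (@eq_locfrac _ _ _ (peval ('X_j ^+ (d + 2)))).
    by move=> y _; rewrite peval_exp pevalX.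
  by rewrite -PoszD; apply: locfrac_poly; exact: homogXn.
exact: tv_locfrac.
Qed.

Lemma proj_eq0 U (D : T U) : app pr D = 0 <-> forall y, U y -> contraction D y = 0.
Proof.
split=> [D0 y Uy|h].
  have [j jy] := exists_chart y.
  rewrite (contractionE _ Uy jy) /chart_contract /contract D0 op_zeroE app_zero.
  by rewrite (tv0 0) mulr0.
apply: sheaf_sep => x Ux; have [j jx] := exists_chart x.
pose V := capO U (chart j); have VU : sub_opens V U := @capO_subl K _ _.
have Vj : sub_opens V (chart j) := @capO_subr K _ _.
exists V, VU; split=> //; rewrite (res0 (twist I N)) app_res.
pose E : T V := res VU D.
have E0 : contract E (@subO_refl K V) (chart_gen Vj) = 0.
  apply: tv_ext => y Vy; rewrite tv0.
  have : contraction E y = 0 by rewrite contraction_res // h //; exact: (VU y).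
  rewrite (contractionE _ Vy (Vj y Vy)) (chart_contractE E (@subO_refl K V) Vj Vy).
  move/eqP; rewrite mulf_eq0 expf_eq0 => /orP[/andP[_ yj]|/eqP //].
  by have := Vj y Vy; rewrite chartE yj.
apply: op_ext => W WV s; rewrite op_zeroE.
apply: (app_inj_eq0 (a := io)); first exact: ideal_incl_inj.
have Wj : sub_opens W (chart j) := subO_trans WV Vj.
have [f [sE _]] := chart_gen_span Wj s.
have := contract_res E (@subO_refl K V) WV WV (chart_gen Vj).
rewrite E0 (chart_gen_res _ _ Wj) => e.
rewrite sE -/(contract E WV (f *: chart_gen Wj)) contract_scale -e.
by apply: tv_ext => y Wy; rewrite tvZ tv_res // !tv0 mulr0.
Qed.

(** The field x_j d/dx_i. The factor x_j gives it degree 1; [form_coef_at] divides it out to get the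
    coefficient of dx_i. *)
Definition unit_field (i : 'I_4) (j : 'I_4) (k : 'I_4) (y : point K) : K :=
  if k == i then sval y j else 0.

Lemma unit_field_is_field U i j : is_field U (unit_field i j).
Proof.
move=> k; rewrite /unit_field; case: eqP => _; last exact: locfrac0.
apply: (@eq_locfrac _ _ _ (peval 'X_j)); first by move=> y _; rewrite pevalX.
by apply: (@locfrac_poly _ 1); exact: homogX.
Qed.

Arguments unit_field_is_field : clear implicits.

Lemma locfrac_coord_ratio U k j (phi : point K -> K) : sub_opens U (chart j) ->
  locfrac (k + 1) U phi -> locfrac k U (fun y => phi y / sval y j).
Proof.
move=> Uj h; apply: (@locfracM _ (k + 1) (- 1%:Z)) => //; first by rewrite addrK.
apply: (@eq_locfrac _ _ _ (fun x => (peval 'X_j x)^-1)).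
  by move=> x _; rewrite pevalX.
apply: locfrac_inv; first exact: homogX.
by move=> x /Uj; rewrite chartE pevalX.
Qed.

Definition form_coef_at (i j : 'I_4) y : K :=
  contraction (der (unit_field_is_field (P3 K) i j)) y / sval y j.

Lemma form_coef_indep i j l y : chart j y -> chart l y ->
  form_coef_at i j y = form_coef_at i l y.
Proof.
move=> jy ly; pose W := capO (chart j) (chart l).
have Wj : sub_opens W (chart j) := @capO_subl K _ _.
have Wl : sub_opens W (chart l) := @capO_subr K _ _.
have WP : sub_opens W (P3 K) by [].
have Wy : W y by [].
have yj : sval y j != 0 by rewrite -chartE.
have yl : sval y l != 0 by rewrite -chartE.
rewrite /form_coef_at -!(contraction_res WP) // !(der_res _ _ (unit_field_is_field W i _)).
have -> : der (unit_field_is_field W i j) =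
    (coordfun j Wl : regfun W) *: der (unit_field_is_field W i l).
  rewrite -derZ; apply: eq_der => x a b Wx; rewrite tv_mkfun // /ratio /unit_field.
  have xl : sval x l != 0 by rewrite -chartE; exact: (Wl x).
  by case: (a == i); case: (b == i); field.
by rewrite contractionZ // tv_mkfun // /ratio; field; rewrite yj yl.
Qed.

Definition form_coef i y : K := form_coef_at i (sval (cid (exists_chart y))) y.

Lemma form_coefE i j y : chart j y -> form_coef i y = form_coef_at i j y.
Proof. by move=> jy; apply: form_coef_indep => //; exact: svalP (cid (exists_chart y)). Qed.

Lemma locfrac_form_coef i : locfrac (d.+1) (P3 K) (form_coef i).
Proof.
apply: locfrac_local => x _; have [j jx] := exists_chart x.
exists (chart j); split=> //.
apply: (@eq_locfrac _ _ _ (form_coef_at i j)).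
  by move=> y [_ jy]; rewrite (form_coefE i jy).
apply: locfrac_coord_ratio; first exact: capO_subr.
have -> : d.+1%:Z + 1 = N by lia.
by apply: locfrac_sub (locfrac_contraction _).
Qed.

Lemma contraction_der U b (hb : is_field U b) y : U y ->
  contraction (der hb) y = \sum_i form_coef i y * b i y.
Proof.
move=> Uy; have [j jy] := exists_chart y.
pose W := capO U (chart j); have WU : sub_opens W U := @capO_subl K _ _.
have Wj : sub_opens W (chart j) := @capO_subr K _ _.
have WP : sub_opens W (P3 K) by [].
have Wy : W y by [].
have yj : sval y j != 0 by rewrite -chartE.
have hf i : locfrac 0 W (fun y => b i y / sval y j).
  by apply: locfrac_coord_ratio => //; rewrite add0r; exact: locfrac_sub (hb i).
pose f i : regfun W := mkfun (hf i).
pose E i : T W := der (unit_field_is_field W i j).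
rewrite -(contraction_res WU) // (der_res _ _ (is_field_sub WU hb)).
have -> : der (is_field_sub WU hb) =
    f o0 *: E o0 + f o1 *: E o1 + f o2 *: E o2 + f o3 *: E o3.
  rewrite /E -!derZ -!derD; apply: eq_der => x k l Wx.
  have xj : sval x j != 0 by rewrite -chartE; exact: (Wj x).
  rewrite /f !tv_mkfun // /unit_field.
  by elim/ord4P: k; elim/ord4P: l => /=; field.
rewrite !contractionD !contractionZ // sum_ord4.
have e i : tv (f i) y * contraction (E i) y = form_coef i y * b i y.
  rewrite (form_coefE i jy) /form_coef_at -(contraction_res WP) //.
  by rewrite (der_res _ _ (unit_field_is_field W i _)) tv_mkfun //; field.
by rewrite !e.
Qed.

(* The distribution is defined by the homogeneous 1-form \sum_i A_i dx_i.      *)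
Lemma exists_form : exists A : 'I_4 -> S, [/\ forall i, A i \is d.+1.-homog,
  dot A (euler_field K) = 0 &
  forall U b (hb : is_field U b) y, U y ->
    contraction (der hb) y = \sum_i peval (A i) y * b i y].
Proof.
have /choice [A AP] i : exists p, p \is d.+1.-homog /\
    forall x, form_coef i x = peval p x.
  have [p [hp pE]] := global_poly (locfrac_form_coef i); exists p; split=> //.
  by case: hp => [->|[n [->]]//]; exact: dhomog0.
have cE U b (hb : is_field U b) y : U y ->
    contraction (der hb) y = \sum_i peval (A i) y * b i y.
  move=> Uy; rewrite contraction_der //; apply: eq_bigr => i _.
  by have [_ ->] := AP i.
exists A; split=> // [i|]; first by have [] := AP i.
have hX : is_field (P3 K) (fun i y => sval y i).
  move=> i; apply: (@eq_locfrac _ _ _ (peval 'X_i)); first by move=> y _; rewrite pevalX.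
  by apply: (@locfrac_poly _ 1); exact: homogX.
apply: peval_eq0 => y; rewrite /dot peval_sum.
transitivity (contraction (der hX) y).
  by rewrite cE //; apply: eq_bigr => i _; rewrite pevalM pevalX.
have -> : der hX = 0 by apply/der_eq0 => x i j _; rewrite mulrC.
have /proj_eq0 : app pr (0 : T (P3 K)) = 0 by exact: app_zero.
exact.
Qed.

End Distribution.

(** * The coefficients of the 1-form have no common factor *)

Section Hypersurfaces.
Variable K : closedFieldType.
Local Notation S := {mpoly K[4]}.
Implicit Types (h p q : S) (x y : point K).

Lemma homog_prime_factor p n : p \is n.-homog -> p != 0 -> ~ dvd p 1 ->
  exists h, [/\ prime_elt h, homogeneous h & dvd h p].
Proof.
move=> hp p0 p1; have [u [[|h s] [u1 sP pE]]] := @factorial_mpoly K 4 p p0.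
  by case: p1; rewrite pE big_nil mulr1.
have pE' : p = h * (u * \prod_(q <- s) q) by rewrite pE big_cons; ring.
exists h; split; first by apply: sP; rewrite inE eqxx.
  by rewrite pE' in p0 hp; have [e he] := dhomog_factor p0 hp; exists e.
by exists (u * \prod_(q <- s) q); rewrite pE' mulrC.
Qed.

Lemma homogeneousM p q : homogeneous p -> homogeneous q -> homogeneous (p * q).
Proof. by move=> [m hm] [n hn]; exists (m + n)%N; exact: dhomogM. Qed.

Section Prime.
Variable h : S.
Hypotheses (h_prime : prime_elt h) (h_homog : homogeneous h).

Definition hypersurface : set (point K) := fun x => peval h x = 0.

Lemma prime_degree_gt0 e : h \is e.-homog -> (0 < e)%N.
Proof.
move=> he; rewrite lt0n; apply/eqP => e0; rewrite e0 in he.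
have [h0 h1 _] := h_prime; case: h1.
have hE := dhomog0_const he.
have c0 : h@_0%MM != 0 by apply: contra h0 => /eqP c0; rewrite hE c0 mpolyC0.
by exists (h@_0%MM)^-1%:MP; rewrite hE -mpolyCM mcoeffC eqxx mulr1 mulVf.
Qed.

Lemma hypersurface_nonempty : exists x, hypersurface x.
Proof.
have [e he] := h_homog; have e0 := prime_degree_gt0 he.
have [x [x01 _ hx]] := @homog_zero_line K 4 h e o0 o1 he e0 isT.
have xP : [exists i, x i != 0].
  by apply/existsP; case: x01 => hx'; [exists o0|exists o1].
by exists (exist _ x xP).
Qed.

Lemma hypersurface_dvd p : homogeneous p -> (forall x, hypersurface x -> peval p x = 0) ->
  dvd h p.
Proof.
move=> [n hp] pY; apply: dvd_of_zeros h_prime _ => x hx.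
have [/existsP xP|x0] := boolP [exists i, x i != 0].
  have xP' : [exists i, x i != 0] by apply/existsP.
  exact: (pY (exist _ x xP')).
(* The origin of the cone is not a point of P^3; there p takes the value 0^n p(y), for any y on the
   hypersurface. *)
have [y hy] := hypersurface_nonempty; have py := pY y hy.
have -> : p.@[x] = p.@[fun i => 0 * sval y i].
  apply: meval_eq => i; rewrite mul0r; apply/eqP.
  by move: x0; rewrite negb_exists => /forallP /(_ i); rewrite negbK.
by rewrite (meval_dhomog _ _ hp) -/(peval p y) py mulr0.
Qed.

Lemma hypersurface_closed : zariski_closed hypersurface.
Proof.
exists (fun p => p = h) => [p ->|x]; first exact: h_homog.
by split=> [hx p ->|/(_ h erefl)].
Qed.

Lemma zariski_closed_separate (Z : set (point K)) x : zariski_closed Z -> ~ Z x ->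
  exists p, [/\ homogeneous p, forall y, Z y -> peval p y = 0 & peval p x != 0].
Proof.
move=> [S0 hS SE] nZ; apply: contrapT => np; apply: nZ; apply/SE => p Sp.
apply/eqP; apply: contrapT => /negP px; apply: np; exists p; split=> //; first exact: hS.
by move=> y /SE; apply.
Qed.

Lemma hypersurface_irreducible : irreducible_closed hypersurface.
Proof.
split; [exact: hypersurface_closed|exact: hypersurface_nonempty|].
move=> A B cA cB sub; apply: contrapT => /not_orP [nA nB].
have [x [hx nAx]] : exists x, hypersurface x /\ ~ A x.
  by have /existsNP [z /not_implyP] := nA; exists z.
have [y [hy nBy]] : exists y, hypersurface y /\ ~ B y.
  by have /existsNP [z /not_implyP] := nB; exists z.
have [a [ha aA ax]] := zariski_closed_separate cA nAx.
have [b [hb bB bY]] := zariski_closed_separate cB nBy.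
have : dvd h (a * b).
  apply: hypersurface_dvd; first exact: homogeneousM.
  by move=> z /sub [/aA|/bB] z0; rewrite pevalM z0 ?mul0r ?mulr0.
have [_ _ hM] := h_prime; case/hM => -[c cE].
  by rewrite cE pevalM hx mulr0 eqxx in ax.
by rewrite cE pevalM hy mulr0 eqxx in bY.
Qed.

(** A nonzero homogeneous p vanishing on [Y1] is divisible by h. As [Y1] is irreducible and not
    inside the hypersurface, the quotient vanishes on it too, and has smaller degree: infinite
    descent. *)
Lemma hypersurface_maximal (Y1 Y2 : set (point K)) :
  irreducible_closed Y1 -> (hypersurface `<` Y1)%classic -> ~ (Y1 `<` Y2)%classic.
Proof.
move=> [cY1 _ irr] [hY1 Y1h] [_ Y2Y1].
have [y [_ nY1y]] : exists y, Y2 y /\ ~ Y1 y.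
  by have /existsNP [z /not_implyP] := Y2Y1; exists z.
have [p [[n hp] pY1 py]] := zariski_closed_separate cY1 nY1y.
have p0 := peval_neq0 py.
have [m nm] := ubnP n; elim: m => // m IHm in n p hp pY1 p0 nm {py} *.
have [e he] := h_homog; have e0 := prime_degree_gt0 he.
have [|c cE] := hypersurface_dvd (ex_intro _ n hp); first by move=> x /hY1 /pY1.
have h0 : h != 0 by have [] := h_prime.
have hc := hp; rewrite cE in hc; have c0 : c != 0.
  by apply: contra p0 => /eqP c0; rewrite cE c0 mul0r.
case: (dhomog_quotient h0 he hc) => [/eqP|[en {}hc]]; first by rewrite (negPf c0).
have cC : zariski_closed (fun x => peval c x = 0).
  exists (fun q => q = c) => [q ->|x]; first by exists (n - e)%N.
  by split=> [cx q ->|/(_ c erefl)].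
have sub : (Y1 `<=` hypersurface `|` (fun x => peval c x = 0))%classic.
  move=> x /pY1 /eqP; rewrite cE pevalM mulf_eq0 => /orP[/eqP cx|/eqP hx].
    by right.
  by left.
have [/Y1h //|cY1'] := irr _ _ hypersurface_closed cC sub.
by apply: (IHm (n - e)%N c) => //; lia.
Qed.

End Prime.
End Hypersurfaces.

Section PrimitiveForm.
Variables (K : closedFieldType) (d : nat) (F : distribution K d).
Local Notation S := {mpoly K[4]}.
Local Notation T := (tangent_sheaf K).
Local Notation chart := (@chart K).
Local Notation N := (d%:Z + 2).
Local Notation I := (ideal (dist_sing F)).
Local Notation io := (ideal_incl (dist_sing F)).
Local Notation pr := (dist_proj F).
Variable A : 'I_4 -> S.
Hypothesis A_homog : forall i, A i \is d.+1.-homog.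
Hypothesis A_contraction : forall U b (hb : is_field U b) y, U y ->
  contraction F (der hb) y = \sum_i peval (A i) y * b i y.

Section MultOp.
Variables (U : opens K) (j : 'I_4) (Uj : sub_opens U (chart j)) (f : I U).

Let coef V (VU : sub_opens V U) (s : lineb K (- N) V) : regfun V :=
  projT1 (cid (chart_gen_span (subO_trans VU Uj) s)).

Let coefE V (VU : sub_opens V U) (s : lineb K (- N) V) x : V x ->
  tv (coef VU s) x = tv (s : twfun (- N) V) x * sval x j ^+ (d + 2).
Proof. by move=> Vx; have [_ ->] := projT2 (cid (chart_gen_span (subO_trans VU Uj) s)). Qed.

(** The section [f] of the ideal, viewed in its twist through the trivialisation x_j^-(d + 2) |->
    f. *)
Definition mult_op : twist I N U.
Proof.
refine (@Op K (lineb K (- N)) I (linear_cond (lineb K (- N)) I) U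
  (fun V VU s => coef VU s *: res VU f) _ _).
  move=> V W VU WV WU s; rewrite resZ (res_comp _ _ WU); congr (_ *: _).
  apply: tv_ext => x Wx; rewrite tv_res // !coefE //; last exact: WV.
  by rewrite tv_res.
move=> V VU; split=> [s t|g s]; rewrite -?scalerDl ?scalerA; congr (_ *: _).
  by apply: tv_ext => x Vx; rewrite tvD !coefE // tvD mulrDl.
by apply: tv_ext => x Vx; rewrite tvM !coefE // tvZ mulrA.
Defined.

Lemma mult_op_gen V (VU : sub_opens V U) (Vj : sub_opens V (chart j)) :
  (mult_op : op (linear_cond (lineb K (- N)) I) U) V VU (chart_gen d Vj) = res VU f.
Proof.
rewrite /mult_op /= (_ : coef VU _ = 1) ?scale1r //.
apply: tv_ext => x Vx; rewrite coefE // tv_chart_gen // mulVf.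
  by symmetry; exact: (tvC 1 Vx).
by rewrite expf_neq0 // -chartE; exact: (Vj x).
Qed.
End MultOp.

(** By surjectivity of the projection, a local section of the ideal is locally the contraction of
    [A] with some field, up to a power of x_j. It vanishes wherever all the [A i] do. *)
Lemma hypersurface_support h : (forall i, dvd h (A i)) ->
  (hypersurface h `<=` support (dist_sing F))%classic.
Proof.
move=> hA x hx U Ux f; have [j jx] := exists_chart x.
pose V := capO U (chart j); have VU : sub_opens V U := @capO_subl K _ _.
have Vj : sub_opens V (chart j) := @capO_subr K _ _.
have Vx : V x by [].
have [_ surj _] := dist_exact F.
have [W [WV [Wx [D DE]]]] := surj V (mult_op Vj (res VU f)) x Vx.
have Wj : sub_opens W (chart j) := subO_trans WV Vj.
have WU : sub_opens W U := subO_trans WV VU.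
have e1 : contract F D (@subO_refl K W) (chart_gen d Wj) = app io (res WU f).
  rewrite /contract DE.
  rewrite (op_resE (mult_op Vj (res VU f) : op (linear_cond (lineb K (- N)) I) V) _ WV).
  by rewrite mult_op_gen (res_comp _ _ WU).
have := A_contraction (chart_comp_field Wj D) Wx.
rewrite -tangent_der (contractionE F _ Wx jx) (chart_contractE F D (@subO_refl K W) Wj Wx) e1.
rewrite big1 => [/eqP|i _]; last first.
  by have [c ->] := hA i; rewrite pevalM hx mulr0 mul0r.
rewrite mulf_eq0 expf_eq0 -(app_res io) => /orP[/andP[_ xj]|].
  by move: jx; rewrite chartE xj.
by rewrite (tv_res WU) // (tvE _ Ux) => /eqP.
Qed.

Lemma form_no_factor h : prime_elt h -> homogeneous h -> ~ forall i, dvd h (A i).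
Proof.
move=> hP hh /hypersurface_support sub.
have [Y1 [Y2 [irr1 irr2 lt1 lt2]]] :=
  dist_codim (hypersurface_irreducible hP hh) sub.
by case: (hypersurface_maximal hP hh irr1 lt1 lt2).
Qed.

Lemma form_neq0 : exists i, A i != 0.
Proof.
apply: contrapT => nA.
have A0 i : A i = 0 by apply/eqP; apply: contrapT => /negP h; apply: nA; exists i.
have [|h [hP hh _]] := homog_prime_factor (homogX K o0) (mpolyXU_neq0 _ _).
  move=> [c /(congr1 (fun p => p.@[fun=> 0]))]; rewrite mevalM mevalXU mulr0 meval1.
  by move/eqP; rewrite oner_eq0.
by apply: (form_no_factor hP hh) => i; rewrite A0; exact: dvd0.
Qed.

(** Write C_i / A_i = a / b in lowest terms. Then b divides every [A j], so it is a unit. *)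
Lemma form_primitive (C : 'I_4 -> S) : (forall i j, C i * A j = C j * A i) ->
  exists g, forall i, C i = g * A i.
Proof.
move=> CA; have [i0 Ai0] := form_neq0.
have [a [b [g [CE AE low]]]] := lowest_terms (C i0) (@factorial_mpoly K 4) Ai0.
have g0 : g != 0 by apply: contra Ai0 => /eqP g0; rewrite AE g0 mulr0.
have b0 : b != 0 by apply: contra Ai0 => /eqP b0; rewrite AE b0 mul0r.
have aA j : a * A j = C j * b.
  by apply: (mulIf g0); rewrite mulrAC -CE CA AE mulrA.
have bA j : dvd b (A j) := low _ _ (aA j).
have [e he] : exists e, b \is e.-homog.
  by apply: (@dhomog_factor _ _ b g d.+1); rewrite -AE.
have [[b' b1]|nb1] := pselect (dvd b 1).
  exists (b' * a) => i; apply: (mulIf b0); rewrite -aA.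
  by rewrite -[LHS]mul1r b1; ring.
have [h [hP hh hb]] := homog_prime_factor he b0 nb1.
by case: (form_no_factor hP hh) => i; exact: dvd_trans hb (bA i).
Qed.

End PrimitiveForm.

(** * Morphisms between sums of line bundles and the tangent sheaf *)

Section SheafMorphisms.
Variable K : closedFieldType.
Implicit Types (F G H : sheaf K) (U V W : opens K).

Definition mk_mor F G (a : forall U, F U -> G U)
  (aD : forall U s t, a U (s + t) = a U s + a U t)
  (aZ : forall U f s, a U (f *: s) = f *: a U s)
  (ares : forall U V (VU : sub_opens V U) s, res VU (a U s) = a V (res VU s)) :
  mor F G :=
  @Op K F G (linear_cond F G) (P3 K) (fun V _ s => a V s)
    (fun V W _ WV _ s => ares V W WV s) (fun V _ => conj (aD V) (aZ V)).

Lemma app_mk_mor F G a aD aZ ares U (s : F U) :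
  app (@mk_mor F G a aD aZ ares) s = a U s.
Proof. by []. Qed.

Definition comp_mor F G H (b : mor G H) (a : mor F G) : mor F H :=
  @mk_mor F H (fun U s => app b (app a s))
    (fun U s t => etrans (congr1 (@app K _ _ b U) (app_add a s t)) (app_add b _ _))
    (fun U f s => etrans (congr1 (@app K _ _ b U) (app_scale a f s)) (app_scale b _ _))
    (fun U V VU s => etrans (app_res b VU _) (congr1 (@app K _ _ b V) (app_res a VU s))).

Definition id_mor F : mor F F :=
  @mk_mor F F (fun U s => s) (fun _ _ _ => erefl) (fun _ _ _ => erefl) (fun _ _ _ _ => erefl).

(** Exactness only gives local preimages; they glue because [a] is injective. *)
Lemma exact_lift F G H (a : mor F G) (b : mor G H) U (t : G U) :
  short_exact a b -> app b t = 0 -> exists s : F U, app a s = t.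
Proof.
move=> [ainj _ ab] /ab im.
pose h1 (x : {x | U x}) := cid (im (sval x) (svalP x)).
pose V x := sval (h1 x); pose h2 x := cid (svalP (h1 x)).
pose VU x : sub_opens (V x) U := sval (h2 x).
have Vx x : V x (sval x) := (svalP (h2 x)).1.
pose h3 x := cid (svalP (h2 x)).2.
pose s x : F (V x) := sval (h3 x).
have sE x : app a (s x) = res (VU x) t := svalP (h3 x).
have [||s0 s0E] := @sheaf_glue K F U {x | U x} V VU s.
- by move=> x Ux; exists (exist _ x Ux); exact: Vx.
- move=> x y W Wx Wy; apply: (ainj W); rewrite -!app_res !sE.
  by rewrite !(res_comp _ _ (subO_trans Wx (VU x))).
exists s0; apply: sheaf_sep => x Ux; exists (V (exist _ x Ux)), (VU (exist _ x Ux)).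
by split; [exact: Vx|rewrite app_res s0E sE].
Qed.

Lemma mor_lift E F G H (a : mor F G) (b : mor G H) (m : mor E G) :
  short_exact a b -> (forall U (s : E U), app b (app m s) = 0) ->
  exists l : mor E F, forall U (s : E U), app a (app l s) = app m s.
Proof.
move=> ex bm; have ainj : mor_injective a by case: ex.
have h U (s : E U) := cid (exact_lift ex (bm U s)).
pose l U (s : E U) : F U := sval (h U s).
have lE U (s : E U) : app a (l U s) = app m s := svalP (h U s).
have lD U (s t : E U) : l U (s + t) = l U s + l U t.
  by apply: (ainj U); rewrite app_add !lE app_add.
have lZ U f (s : E U) : l U (f *: s) = f *: l U s.
  by apply: (ainj U); rewrite app_scale !lE app_scale.
have lres U V (VU : sub_opens V U) (s : E U) : res VU (l U s) = l V (res VU s).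
  by apply: (ainj V); rewrite -app_res !lE app_res.
by exists (mk_mor lD lZ lres) => U s; rewrite app_mk_mor.
Qed.

Lemma bijective_isomorphic F G (a : mor F G) :
  (forall U, bijective (@app K F G a U)) -> isomorphic G F.
Proof.
move=> abij; have ainj U := bij_inj (abij U).
have h U (t : G U) : exists s, app a s = t.
  by have [g _ gK] := abij U; exists (g t).
pose g U (t : G U) : F U := sval (cid (h U t)).
have gE U (t : G U) : app a (g U t) = t := svalP (cid (h U t)).
have gD U (s t : G U) : g U (s + t) = g U s + g U t.
  by apply: (ainj U); rewrite app_add !gE.
have gZ U f (s : G U) : g U (f *: s) = f *: g U s.
  by apply: (ainj U); rewrite app_scale !gE.
have gres U V (VU : sub_opens V U) (s : G U) : res VU (g U s) = g V (res VU s).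
  by apply: (ainj V); rewrite -app_res !gE.
exists (mk_mor gD gZ gres) => U; exists (@app K F G a U) => s; rewrite app_mk_mor //.
by apply: (ainj U); rewrite gE.
Qed.

Section KernelSheaf.
Variables (F G : sheaf K) (a : mor F G).

Definition ker_pred U : {pred F U} := fun s => app a s == 0.

Lemma ker_predE U (s : F U) : (s \in @ker_pred U) = (app a s == 0).
Proof. by []. Qed.

Fact ker_submod U : submod_closed (@ker_pred U).
Proof.
split=> [|f s t]; rewrite !ker_predE; first by rewrite app_zero.
by move=> /eqP s0 /eqP t0; rewrite app_add app_scale s0 t0 scaler0 addr0.
Qed.

HB.instance Definition _ U := GRing.isSubmodClosed.Build (regfun U) (F U) (@ker_pred U)
  (@ker_submod U).

Record ker_sec U := KerSec { ker_val : F U; _ : ker_val \in @ker_pred U }.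

HB.instance Definition _ U := [isSub for @ker_val U].
HB.instance Definition _ U := [Choice of ker_sec U by <:].
HB.instance Definition _ U := [SubChoice_isSubLmodule of ker_sec U by <:].

Lemma ker_valP U (s : ker_sec U) : app a (ker_val s) = 0.
Proof. by apply/eqP; case: s. Qed.

Lemma ker_ext U (s t : ker_sec U) : ker_val s = ker_val t -> s = t.
Proof. exact: val_inj. Qed.

Definition mk_ker U (s : F U) (s0 : app a s = 0) : ker_sec U :=
  @KerSec U s (introT eqP s0).

Fact ker_res_subproof U V (VU : sub_opens V U) (s : ker_sec U) :
  app a (res VU (ker_val s)) = 0.
Proof. by rewrite -app_res ker_valP res0. Qed.

Definition ker_res U V (VU : sub_opens V U) (s : ker_sec U) : ker_sec V :=
  mk_ker (ker_res_subproof VU s).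

Fact ker_resD U V (VU : sub_opens V U) s t :
  ker_res VU (s + t) = ker_res VU s + ker_res VU t.
Proof. by apply: ker_ext; exact: resD. Qed.

Fact ker_resZ U V (VU : sub_opens V U) f s :
  ker_res VU (f *: s) = regres VU f *: ker_res VU s.
Proof. by apply: ker_ext; exact: resZ. Qed.

Fact ker_res_id U (UU : sub_opens U U) s : ker_res UU s = s.
Proof. by apply: ker_ext; exact: res_id. Qed.

Fact ker_res_comp U V W (VU : sub_opens V U) (WV : sub_opens W V) (WU : sub_opens W U) s :
  ker_res WV (ker_res VU s) = ker_res WU s.
Proof. by apply: ker_ext; exact: res_comp. Qed.

Fact ker_sep U (s t : ker_sec U) :
  (forall x, U x -> exists V (VU : sub_opens V U), V x /\ ker_res VU s = ker_res VU t) ->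
  s = t.
Proof.
move=> st; apply: ker_ext; apply: sheaf_sep => x /st [V [VU [Vx e]]].
by exists V, VU; split=> //; exact: (congr1 (@ker_val V) e).
Qed.

Fact ker_glue U (I : Type) (V : I -> opens K) (VU : forall i, sub_opens (V i) U)
    (s : forall i, ker_sec (V i)) :
  (forall x, U x -> exists i, V i x) ->
  (forall i j W (Wi : sub_opens W (V i)) (Wj : sub_opens W (V j)),
    ker_res Wi (s i) = ker_res Wj (s j)) ->
  exists t, forall i, ker_res (VU i) t = s i.
Proof.
move=> cov comp.
have [|t tE] := sheaf_glue VU (s := fun i => ker_val (s i)) cov.
  by move=> i j W Wi Wj; exact: (congr1 (@ker_val W) (comp i j W Wi Wj)).
have t0 : app a t = 0.
  apply: sheaf_sep => x Ux; have [i Vx] := cov x Ux.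
  by exists (V i), (VU i); split=> //; rewrite app_res tE ker_valP res0.
by exists (mk_ker t0) => i; apply: ker_ext; exact: tE.
Qed.

Definition ker_sheaf : sheaf K :=
  @Sheaf K (fun U => ker_sec U : lmodType (regfun U)) ker_res ker_resD ker_resZ
    ker_res_id ker_res_comp ker_sep ker_glue.

Definition ker_incl : mor ker_sheaf F :=
  @mk_mor ker_sheaf F (@ker_val) (fun _ _ _ => erefl) (fun _ _ _ => erefl)
    (fun _ _ _ _ => erefl).

Lemma ker_exact : mor_surjective a -> short_exact ker_incl a.
Proof.
move=> asurj; split=> //; first by move=> U s t /ker_ext.
move=> U t; split=> [t0 x Ux|im].
  exists U, (@subO_refl K U); split=> //; exists (mk_ker t0).
  by rewrite res_id.
apply: sheaf_sep => x /im [V [VU [Vx [s sE]]]]; exists V, VU; split=> //.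
by rewrite res0 app_res -sE; exact: ker_valP.
Qed.

Lemma ker_corestrict E (m : mor E F) : (forall U (s : E U), app a (app m s) = 0) ->
  exists l : mor E ker_sheaf, forall U (s : E U), ker_val (app l s : ker_sec U) = app m s.
Proof.
move=> am; pose l U (s : E U) : ker_sheaf U := mk_ker (am U s).
have lD U (s t : E U) : l U (s + t) = l U s + l U t.
  by apply: ker_ext; exact: app_add.
have lZ U f (s : E U) : l U (f *: s) = f *: l U s.
  by apply: ker_ext; exact: app_scale.
have lres U V (VU : sub_opens V U) (s : E U) : res VU (l U s) = l V (res VU s).
  by apply: ker_ext; exact: app_res.
by exists (mk_mor lD lZ lres).
Qed.

End KernelSheaf.
End SheafMorphisms.

(** * Sections of sums of line bundles as families of functions *)

Section Lines.
Variable K : closedFieldType.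
Implicit Types (U V W : opens K) (a : seq int).

Fixpoint line_comp a U : lines K a U -> forall i, twfun (nth 0 a i) U :=
  match a return lines K a U -> forall i, twfun (nth 0 a i) U with
  | [::] => fun _ i => 0
  | k :: a' => fun s i =>
    match i return twfun (nth 0 (k :: a') i) U with
    | 0 => s.1
    | i'.+1 => @line_comp a' U s.2 i'
    end
  end.

Definition line_val a U (s : lines K a U) i x : K := tv (line_comp s i) x.

Lemma line_val_locfrac a U (s : lines K a U) i : locfrac (nth 0 a i) U (line_val s i).
Proof. exact: tv_locfrac. Qed.

Lemma line_valD a U (s t : lines K a U) i x :
  line_val (s + t) i x = line_val s i x + line_val t i x.
Proof.
elim: a s t i => [|k a IHa] s t i; first by rewrite /line_val /= tv0 addr0.
by case: i => [|i]; [exact: tvD|exact: (IHa s.2 t.2 i)].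
Qed.

Lemma line_valZ a U f (s : lines K a U) i x :
  line_val (f *: s) i x = tv f x * line_val s i x.
Proof.
elim: a s i => [|k a IHa] s i; first by rewrite /line_val /= tv0 mulr0.
by case: i => [|i]; [exact: tvZ|exact: (IHa s.2 i)].
Qed.

Lemma line_val_res a U V (VU : sub_opens V U) (s : lines K a U) i x : V x ->
  line_val (res VU s) i x = line_val s i x.
Proof.
move=> Vx; elim: a s i => [|k a IHa] s i; first by rewrite /line_val /= !tv0.
by case: i => [|i]; [exact: (tv_res VU)|exact: (IHa s.2 i)].
Qed.

Lemma lines_ext a U (s t : lines K a U) :
  (forall i x, (i < size a)%N -> U x -> line_val s i x = line_val t i x) -> s = t.
Proof.
elim: a s t => [|k a IHa] s t h; first by apply/matrixP => i [].
case: s t h => [s1 s2] [t1 t2] h; congr (_, _).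
  by apply: tv_ext => x Ux; exact: (h 0%N x).
by apply: IHa => i x ia Ux; exact: (h i.+1 x).
Qed.

Lemma exists_lines a U (phi : nat -> point K -> K) :
  (forall i, (i < size a)%N -> locfrac (nth 0 a i) U (phi i)) ->
  exists s : lines K a U, forall i x, (i < size a)%N -> U x -> line_val s i x = phi i x.
Proof.
elim: a phi => [|k a IHa] phi h; first by exists 0.
have [s sE] := IHa (fun i => phi i.+1) (fun i ia => h i.+1 ia).
exists ((mkfun (h 0%N isT) : lineb K k U), s) => -[|i] x ia Ux.
  exact: (tv_mkfun (h 0%N isT)).
exact: sE.
Qed.

Lemma line_val0 a U i x : line_val (0 : lines K a U) i x = 0.
Proof.
apply: (addrI (line_val (0 : lines K a U) i x)).
by rewrite -line_valD !addr0.
Qed.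

End Lines.

(** * Morphisms given by matrices of homogeneous polynomials *)

Section GradedMaps.
Variable K : closedFieldType.
Local Notation S := {mpoly K[4]}.
Local Notation T := (tangent_sheaf K).
Implicit Types (p q : S) (x y : point K) (U V W : opens K) (a b : seq int).

Lemma open_dense U p q x : U x -> q != 0 ->
  (forall y, U y -> peval q y != 0 -> peval p y = 0) -> p = 0.
Proof.
move=> Ux q0 h; have [r [n [hr rx rU]]] := basic_nbhd Ux.
apply: (@peval_dense _ _ (r * q)); first by rewrite mulf_neq0 // (peval_neq0 rx).
by move=> y; rewrite pevalM mulf_eq0 negb_or => /andP[/rU Uy qy]; exact: h.
Qed.

Lemma common_denominator (N : nat) (k : nat -> int) (phi : nat -> point K -> K) U x :
  (forall i, (i < N)%N -> locfrac (k i) U (phi i)) -> U x ->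
  exists q (n : nat) (p : nat -> S), [/\ q \is n.-homog, peval q x != 0 &
    forall i, (i < N)%N -> frac U (phi i) (p i) q /\
      exists2 m : nat, m%:Z = n%:Z + k i & p i \is m.-homog].
Proof.
elim: N => [|N IHN] h Ux.
  exists 1, 0%N, (fun=> 0); split=> //; first exact: dhomog1.
  by rewrite peval1 oner_eq0.
have [q [n [p [hq qx pP]]]] := IHN (fun i iN => h i (leqW iN)) Ux.
have [p' [q' [m' [n' [hp' hq' q'x mn f]]]]] := h N (leqnn _) x Ux.
exists (q * q'), (n + n')%N, (fun i => if i == N then p' * q else p i * q'); split.
- exact: dhomogM.
- by rewrite pevalM mulf_neq0.
move=> i iN; have [->|iN'] := eqVneq i N.
  split; last by exists (m' + n)%N; [lia|exact: dhomogM].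
  move=> y Uy; rewrite !pevalM mulf_eq0 negb_or => /andP[qy q'y].
  by rewrite f //; field; rewrite qy q'y.
have [fi [m mE hm]] : frac U (phi i) (p i) q /\
    exists2 m : nat, m%:Z = n%:Z + k i & p i \is m.-homog by apply: pP; lia.
split; last by exists (m + n')%N; [lia|exact: dhomogM].
move=> y Uy; rewrite !pevalM mulf_eq0 negb_or => /andP[qy q'y].
by rewrite fi //; field; rewrite qy q'y.
Qed.

(** Components of negative degree are 0, so that twists by negative integers need no separate
    case. *)
Definition zcomp (z : int) p : S := if z is Posz l then pihomog mdeg l p else 0.

Lemma zcompM (z : int) (m D : nat) p g : m%:Z = z + D%:Z -> g \is D.-homog ->
  pihomog mdeg m (p * g) = zcomp z p * g.
Proof.
case: z => [l|l] e hg; rewrite /zcomp.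
  have -> : m = (l + D)%N by lia.
  exact: pihomogM.
by rewrite mul0r (pihomogM_lt _ hg) //; lia.
Qed.

Lemma locfrac_zcomp (k : int) (n : nat) q p U : q \is n.-homog ->
  (forall y, U y -> peval q y != 0) ->
  locfrac k U (fun y => peval (zcomp (n%:Z + k) p) y / peval q y).
Proof.
move=> hq qU; case e : (n%:Z + k) => [l|l]; rewrite /zcomp; last first.
  by apply: (@eq_locfrac _ _ _ (fun=> 0)) (@locfrac0 _ _ _) => y _; rewrite peval0 mul0r.
move=> y Uy; exists (pihomog mdeg l p), q, l, n; split=> //; first exact: pihomogP.
exact: qU.
Qed.

Definition graded_matrix a b (r : nat -> nat -> S) := forall i j,
  (i < size a)%N -> (j < size b)%N ->
  exists2 n : nat, nth 0 b j = nth 0 a i + n%:Z & r i j \is n.-homog.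

Definition given_by a b (r : nat -> nat -> S) (m : mor (lines K a) (lines K b)) :=
  forall U (s : lines K a U) j x, (j < size b)%N -> U x ->
    line_val (app m s) j x = \sum_(i < size a) line_val s i x * peval (r i j) x.

Lemma locfrac_dot N (k : int) (phi : nat -> point K -> K) (r : nat -> S)
    (a : nat -> int) U :
  (forall i, (i < N)%N -> locfrac (a i) U (phi i)) ->
  (forall i, (i < N)%N -> exists2 n : nat, k = a i + n%:Z & r i \is n.-homog) ->
  locfrac k U (fun x => \sum_(i < N) phi i x * peval (r i) x).
Proof.
move=> hphi hr; apply: locfrac_sum => i.
have [n kE hn] := hr i (ltn_ord i).
apply: (@locfracM _ (a i) n) => //; first exact: hphi.
exact: locfrac_poly.
Qed.

Lemma exists_matrix_mor a b r : graded_matrix a b r ->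
  exists m : mor (lines K a) (lines K b), given_by r m.
Proof.
move=> hr; have h U (s : lines K a U) := cid (exists_lines (fun j jb =>
  locfrac_dot (fun i _ => line_val_locfrac s i) (fun i ia => hr i j ia jb))).
pose m U (s : lines K a U) : lines K b U := sval (h U s).
have mE U (s : lines K a U) j x : (j < size b)%N -> U x ->
  line_val (m U s) j x = \sum_(i < size a) line_val s i x * peval (r i j) x.
  exact: (svalP (h U s)).
have mD U (s t : lines K a U) : m U (s + t) = m U s + m U t.
  apply: lines_ext => j x jb Ux; rewrite line_valD !mE // -big_split.
  by apply: eq_bigr => i _; rewrite line_valD mulrDl.
have mZ U f (s : lines K a U) : m U (f *: s) = f *: m U s.
  apply: lines_ext => j x jb Ux; rewrite line_valZ !mE // mulr_sumr.
  by apply: eq_bigr => i _; rewrite line_valZ mulrA.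
have mres U V (VU : sub_opens V U) (s : lines K a U) : res VU (m U s) = m V (res VU s).
  apply: lines_ext => j x jb Vx; rewrite line_val_res // !mE //; last exact: VU.
  by apply: eq_bigr => i _; rewrite line_val_res.
by exists (mk_mor mD mZ mres).
Qed.

Definition line_field a U (s : lines K a U) (w : nat -> 'I_4 -> S) k x : K :=
  \sum_(i < size a) line_val s i x * peval (w i k) x.

Definition graded_fields a (w : nat -> 'I_4 -> S) := forall i k, (i < size a)%N ->
  exists2 n : nat, 1 = nth 0 a i + n%:Z & w i k \is n.-homog.

Lemma line_field_is_field a U (s : lines K a U) w : graded_fields a w ->
  is_field U (line_field s w).
Proof.
move=> hw k; apply: (locfrac_dot (N := size a) (a := nth 0 a) (r := w^~ k)) => i ia; last exact: hw.
exact: line_val_locfrac.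
Qed.

Lemma exists_field_mor a w (hw : graded_fields a w) :
  exists m : mor (lines K a) T, forall U (s : lines K a U),
    app m s = der (line_field_is_field s hw).
Proof.
pose m U (s : lines K a U) : T U := der (line_field_is_field s hw).
have mD U (s t : lines K a U) : m U (s + t) = m U s + m U t.
  rewrite /m -derD; apply: eq_der => x i j Ux.
  have e k : line_field (s + t) w k x = line_field s w k x + line_field t w k x.
    by rewrite -big_split; apply: eq_bigr => l _; rewrite line_valD mulrDl.
  by rewrite !e.
have mZ U f (s : lines K a U) : m U (f *: s) = f *: m U s.
  rewrite /m -derZ; apply: eq_der => x i j Ux.
  have e k : line_field (f *: s) w k x = tv f x * line_field s w k x.
    by rewrite mulr_sumr; apply: eq_bigr => l _; rewrite line_valZ mulrA.
  by rewrite !e.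
have mres U V (VU : sub_opens V U) (s : lines K a U) : res VU (m U s) = m V (res VU s).
  rewrite /m (der_res _ _ (is_field_sub VU (line_field_is_field s hw))).
  apply: eq_der => x i j Vx.
  have e k : line_field (res VU s) w k x = line_field s w k x.
    by apply: eq_bigr => l _; rewrite line_val_res.
  by rewrite !e.
by exists (mk_mor mD mZ mres).
Qed.

(* Solving a linear system over the polynomials solves it locally over O. *)
Lemma local_image a b r (m : mor (lines K a) (lines K b)) U (t : lines K b U) :
  graded_matrix a b r ->
  given_by r m ->
  (forall (p : nat -> S) q x, U x -> peval q x != 0 ->
    (forall j, (j < size b)%N -> frac U (line_val t j) (p j) q) ->
    exists g : nat -> S, forall j, (j < size b)%N ->
      p j = \sum_(i < size a) g i * r i j) -> in_image m t.
Proof.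
move=> hr mE sol x Ux.
have [q [n [p [hq qx pP]]]] := common_denominator
  (N := size b) (fun j _ => line_val_locfrac t j) Ux.
have [|g gE] := sol p q x Ux qx; first by move=> j /pP [].
pose V := capO U (basic (ex_intro _ n hq)); have VU : sub_opens V U := @capO_subl K _ _.
have [s sE] := exists_lines (a := a) (fun i _ =>
  locfrac_zcomp (nth 0 a i) (g i) hq (fun y (Vy : V y) => Vy.2)).
exists V, VU; split; first by split.
exists s; apply: lines_ext => j y jb Vy; rewrite line_val_res // mE //.
have [Uy qy] := Vy; have [f [l le hl]] := pP j jb.
rewrite (f y Uy qy) -(pihomog_dE hl) gE // raddf_sum peval_sum mulr_suml.
apply: eq_bigr => i _ /=; rewrite sE //.
have [D DE hD] := hr i j (ltn_ord i) jb.
rewrite (@zcompM (n%:Z + nth 0 a i) _ D) //; last by rewrite le DE addrA.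
by rewrite pevalM /=; ring.
Qed.

Lemma matrix_exact a b c (r s : nat -> nat -> S) (m : mor (lines K a) (lines K b))
    (m' : mor (lines K b) (lines K c)) : graded_matrix a b r ->
  given_by r m ->
  given_by s m' ->
  (forall f : nat -> S, (forall l, (l < size c)%N -> \sum_(j < size b) f j * s j l = 0) ->
    exists g : nat -> S, forall j, (j < size b)%N ->
      f j = \sum_(i < size a) g i * r i j) ->
  forall U (t : lines K b U), app m' t = 0 -> in_image m t.
Proof.
move=> hr mE m'E sol U t t0; apply: (local_image hr mE) => p q x Ux qx pq.
apply: sol => l lc; apply: (open_dense Ux (peval_neq0 qx)) => y Uy qy.
rewrite peval_sum; transitivity (peval q y * line_val (app m' t) l y).
  rewrite m'E // mulr_sumr; apply: eq_bigr => j _; rewrite pevalM.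
  by rewrite (pq j (ltn_ord j) y Uy qy); field.
by rewrite t0 line_val0 mulr0.
Qed.

Lemma matrix_comp_eq0 a b c (r s : nat -> nat -> S) (m : mor (lines K a) (lines K b))
    (m' : mor (lines K b) (lines K c)) :
  given_by r m ->
  given_by s m' ->
  (forall i l, (i < size a)%N -> (l < size c)%N -> \sum_(j < size b) r i j * s j l = 0) ->
  forall U (t : lines K a U), app m' (app m t) = 0.
Proof.
move=> mE m'E rs U t; apply: lines_ext => l x lc Ux; rewrite line_val0 m'E //.
rewrite (eq_bigr (fun j : 'I_(size b) =>
  \sum_(i < size a) line_val t i x * peval (r i j * s j l) x)); last first.
  move=> j _; rewrite mE // mulr_suml; apply: eq_bigr => i _.
  by rewrite pevalM mulrA.
rewrite exchange_big big1 // => i _.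
by rewrite -mulr_sumr -peval_sum rs // peval0 mulr0.
Qed.

Lemma matrix_injective a b r (m : mor (lines K a) (lines K b)) :
  given_by r m ->
  (forall f : nat -> S, (forall j, (j < size b)%N -> \sum_(i < size a) f i * r i j = 0) ->
    forall i, (i < size a)%N -> f i = 0) -> mor_injective m.
Proof.
move=> mE inj U s t st; apply: subr0_eq.
have {st} : app m (s - t) = 0 by rewrite app_add app_opp st subrr.
move: (s - t) => {s t} s s0; apply: lines_ext => i x ia Ux; rewrite line_val0.
have [q [n [p [hq qx pP]]]] := common_denominator
  (N := size a) (fun j _ => line_val_locfrac s j) Ux.
have [f _] := pP i ia; rewrite (f x Ux qx) (inj p) ?peval0 ?mul0r // => j jb.
apply: (open_dense Ux (peval_neq0 qx)) => y Uy qy.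
rewrite peval_sum; transitivity (peval q y * line_val (app m s) j y).
  rewrite mE // mulr_sumr; apply: eq_bigr => l _; rewrite pevalM.
  by have [fl _] := pP l (ltn_ord l); rewrite (fl y Uy qy); field.
by rewrite s0 line_val0 mulr0.
Qed.

Lemma euler_parallel (B : 'I_4 -> S) : (forall i j, B i * 'X_j = B j * 'X_i) ->
  exists g, forall i, B i = g * 'X_i.
Proof.
move=> h; have ind (i j : 'I_4) : i != j ->
    indep (delta_mx 0 i : 'rV[K]_4) (delta_mx 0 j).
  move=> ij; apply: indepP.
    by apply/eqP => /matrixP/(_ 0 i); rewrite !mxE !eqxx => /eqP; rewrite oner_eq0.
  apply/negP => /sub_rVP [c /matrixP/(_ 0 j)]; rewrite !mxE !eqxx.
  by rewrite eq_sym (negPf ij) mulr0 => /eqP; rewrite oner_eq0.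
have [g B0] : exists g, B o0 = g * 'X_o0.
  have := h o0 o1; rewrite -!lf_delta => /(lf_koszul (ind o1 o0 isT)) [g [gE _]].
  by exists g; rewrite gE lf_delta.
by exists g => i; apply: (mulIf (mpolyXU_neq0 K o0)); rewrite h B0; ring.
Qed.

End GradedMaps.

(** * From exact complexes to free resolutions *)

Section Resolutions.
Variable K : closedFieldType.
Implicit Types (F G H : sheaf K) (U V W : opens K).

Lemma exact_comp0 F G H (a : mor F G) (b : mor G H) U (s : F U) :
  short_exact a b -> app b (app a s) = 0.
Proof.
move=> [_ _ ab]; apply/ab => x Ux; exists U, (@subO_refl K U); split=> //.
by exists s; rewrite res_id.
Qed.

Lemma in_image_eq0 F G H (a : mor F G) (b : mor G H) U (t : G U) :
  (forall V (s : F V), app b (app a s) = 0) -> in_image a t -> app b t = 0.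
Proof.
move=> ba im; apply: sheaf_sep => x /im [V [VU [Vx [s sE]]]].
by exists V, VU; split=> //; rewrite res0 app_res -sE ba.
Qed.

Fact zero_morD F G U (s t : F U) : (0 : G U) = 0 + 0.
Proof. by rewrite addr0. Qed.
Fact zero_morZ F G U (f : regfun U) (s : F U) : (0 : G U) = f *: 0.
Proof. by rewrite scaler0. Qed.

Definition zero_mor F G : mor F G :=
  @mk_mor K F G (fun U _ => 0) (@zero_morD F G) (@zero_morZ F G) (fun _ _ _ _ => res0 _ _).

Lemma zero_sheaf_eq U (s t : zero_sheaf K U) : s = t.
Proof. by apply/matrixP => i []. Qed.

Lemma free_resolution_lines a : free_resolution [:: a] (lines K a).
Proof.
apply: (@FreeResCons K a [::] (lines K a) (zero_sheaf K) (zero_mor _ _) (id_mor _)).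
  split=> [U s t _|U t x Ux|U t]; first exact: zero_sheaf_eq.
    by exists U, (@subO_refl K U); split=> //; exists t; rewrite res_id.
  split=> [t0 x Ux|im].
    exists U, (@subO_refl K U); split=> //; exists 0; rewrite app_zero res_id.
    exact: esym t0.
  by apply: in_image_eq0 im => V s; exact: app_zero.
by apply: FreeResNil => U s; exact: zero_sheaf_eq.
Qed.

(** The complex is cut at the kernel sheaf of [a], to which [b] corestricts. *)
Lemma free_resolution3 F E0 E1 E2 (a : mor (lines K E0) F)
    (b : mor (lines K E1) (lines K E0)) (c : mor (lines K E2) (lines K E1)) :
  mor_surjective a ->
  (forall U (s : lines K E1 U), app a (app b s) = 0) ->
  (forall U (s : lines K E0 U), app a s = 0 -> in_image b s) ->
  (forall U (s : lines K E2 U), app b (app c s) = 0) ->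
  (forall U (s : lines K E1 U), app b s = 0 -> in_image c s) ->
  mor_injective c ->
  free_resolution [:: E0; E1; E2] F.
Proof.
move=> asurj ab akb bc bkc cinj.
apply: FreeResCons (ker_exact asurj) _.
have [l lE] := ker_corestrict ab.
have l0 U (s : lines K E1 U) : app l s = 0 <-> app b s = 0.
  split=> [e|e]; first by rewrite -lE e.
  by apply: (@ker_ext K _ _ a); rewrite lE.
apply: (@FreeResCons K E1 [:: E2] _ (lines K E2) c l); last exact: free_resolution_lines.
split=> // [U t x Ux|U t].
  have [V [VU [Vx [s sE]]]] := akb U (ker_val t) (ker_valP t) x Ux.
  exists V, VU; split=> //; exists s.
  by apply: (@ker_ext K _ _ a); rewrite lE sE.
split=> [/l0/bkc //|im]; apply: in_image_eq0 im => V s.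
by apply/l0; exact: bc.
Qed.

Lemma injective_surjective_bij F G (a : mor F G) :
  mor_injective a -> mor_surjective a -> forall U, bijective (@app K F G a U).
Proof.
move=> ainj asurj U.
have ex : short_exact a (zero_mor G (zero_sheaf K)).
  split=> [//|V t x Vx|V t].
    exists V, (@subO_refl K V); split=> //; exists 0; exact: zero_sheaf_eq.
  by split=> _; [exact: asurj|exact: zero_sheaf_eq].
have h (t : G U) := cid (exact_lift (t := t) ex (zero_sheaf_eq _ _)).
exists (fun t => sval (h t)) => s; last exact: (svalP (h s)).
by apply: (ainj U); exact: (svalP (h (app a s))).
Qed.

Lemma isomorphic_lines2 F k l (a : mor (lines K [:: k; l]) F) :
  mor_injective a -> mor_surjective a -> isomorphic F (dsum (lineb K k) (lineb K l)).
Proof.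
move=> ainj asurj; pose L := dsum (lineb K k) (lineb K l).
pose j U (s : L U) : lines K [:: k; l] U := (s.1, (s.2, 0)).
have jD U (s t : L U) : j U (s + t) = j U s + j U t.
  by congr (_, (_, _)); exact: zero_sheaf_eq.
have jZ U f (s : L U) : j U (f *: s) = f *: j U s.
  by congr (_, (_, _)); exact: zero_sheaf_eq.
have jres U V (VU : sub_opens V U) (s : L U) : res VU (j U s) = j V (res VU s) by [].
apply: (@bijective_isomorphic K L F (comp_mor a (mk_mor jD jZ jres))) => U.
apply: (bij_comp (injective_surjective_bij ainj asurj U)).
exists (fun s : lines K [:: k; l] U => (s.1, s.2.1) : L U) => [[]//|[s [t u]]].
by congr (_, (_, _)); exact: zero_sheaf_eq.
Qed.

End Resolutions.

(** * The resolution of the tangent sheaf *)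

Section TangentResolution.
Variables (K : closedFieldType) (d : nat) (F : distribution K d).
Local Notation S := {mpoly K[4]}.
Local Notation T := (tangent_sheaf K).
Local Notation TF := (dist_tangent F).
Local Notation incl := (dist_incl F).
Local Notation pr := (dist_proj F).
Implicit Types (x y : point K) (U V W : opens K) (b : 'I_4 -> point K -> K).
Variable A : 'I_4 -> S.
Hypothesis A_contraction : forall U b (hb : is_field U b) y, U y ->
  contraction F (der hb) y = \sum_i peval (A i) y * b i y.

Lemma incl_inj : mor_injective incl.
Proof. by case: (dist_exact F). Qed.

Section Fields.
Variables (a : seq int) (w : nat -> 'I_4 -> S).
Hypothesis hw : graded_fields a w.
Hypothesis Aw : forall j, (j < size a)%N -> dot A (w j) = 0.

Lemma exists_tangent_mor : exists phi : mor (lines K a) TF,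
  forall U (s : lines K a U), app incl (app phi s) = der (line_field_is_field s hw).
Proof.
have [m mE] := exists_field_mor hw.
have [|phi phiE] := mor_lift (m := m) (dist_exact F).
  move=> U s; apply/proj_eq0 => y Uy; rewrite mE A_contraction //.
  rewrite /line_field; under eq_bigr => i _ do rewrite mulr_sumr.
  rewrite exchange_big big1 //= => j _.
  transitivity (line_val s j y * peval (dot A (w j)) y); last first.
    by rewrite Aw // peval0 mulr0.
  rewrite /dot peval_sum mulr_sumr; apply: eq_bigr => i _.
  by rewrite pevalM mulrCA.
by exists phi => U s; rewrite phiE mE.
Qed.

Variable phi : mor (lines K a) TF.
Hypothesis phiE : forall U (s : lines K a U),
  app incl (app phi s) = der (line_field_is_field s hw).

Lemma tangent_mor_eq0 U (s : lines K a U) : app phi s = 0 <->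
  forall x i j, U x -> line_field s w i x * sval x j = line_field s w j x * sval x i.
Proof.
split=> [s0|h]; first by apply/(der_eq0 (line_field_is_field s hw)); rewrite -phiE s0 app_zero.
by apply: (app_inj_eq0 incl_inj); rewrite phiE; apply/der_eq0.
Qed.

(** Over a chart a section is a field p / q with a common denominator, and A.p = 0 holds as
    polynomials by density. In p = g x + sum of c_j w_j, the term g x induces the zero derivation;
    homogeneous components of the c_j, divided by q, give the preimage. *)
Lemma tangent_mor_onto :
  (forall B, dot A B = 0 -> exists g (c : nat -> S),
    forall i, B i = g * 'X_i + \sum_(j < size a) c j * w j i) ->
  mor_surjective phi.
Proof.
move=> gen U t x Ux; have [j jx] := exists_chart x.
pose V0 := capO U (chart K j); have V0U : sub_opens V0 U := @capO_subl K _ _.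
have V0j : sub_opens V0 (chart K j) := @capO_subr K _ _.
have V0x : V0 x by split.
pose D : T V0 := app incl (res V0U t).
have DE := tangent_der V0j D; pose b := chart_comp V0j D.
have hb : is_field V0 b := chart_comp_field V0j D.
have [q [n [p [hq qx pP]]]] := common_denominator
  (N := 4) (phi := fun i => b (inord i)) (fun i _ => hb (inord i)) V0x.
have bE (i : 'I_4) : frac V0 (b i) (p i) q.
  by have [+ _] := pP i (ltn_ord i); rewrite inord_val.
have hp (i : 'I_4) : p i \is n.+1.-homog.
  by have [_ [m me]] := pP i (ltn_ord i); have -> : m = n.+1 by lia.
have Ap : dot A (fun i => p i) = 0.
  apply: (open_dense V0x (peval_neq0 qx)) => y Vy qy.
  transitivity (peval q y * contraction F D y).
    rewrite DE A_contraction // /dot peval_sum mulr_sumr; apply: eq_bigr => i _.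
    by rewrite pevalM -/(b i y) (bE i y Vy qy); field.
  have /proj_eq0 -> // : app pr D = 0 by apply: exact_comp0; exact: dist_exact.
  by rewrite mulr0.
have [g [c gc]] : exists (g : S) (c : nat -> S), forall i : 'I_4,
    p i = g * 'X_i + \sum_(j < size a) c j * w j i := gen _ Ap.
pose V := capO V0 (basic (ex_intro _ n hq)).
have VV0 : sub_opens V V0 := @capO_subl K _ _; have VU := subO_trans VV0 V0U.
have [s sE] := exists_lines (a := a) (fun i _ =>
  locfrac_zcomp (nth 0 a i) (c i) hq (fun y (Vy : V y) => Vy.2)).
exists V, VU; split; first by split.
exists s; apply: (incl_inj (U := V)); rewrite phiE.
have -> : app incl (res VU t) = res VV0 D by rewrite /D app_res (res_comp V0U VV0 VU).
rewrite DE (der_res _ _ (is_field_sub VV0 hb)).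
have key (i : 'I_4) y : V y -> line_field s w i y =
    b i y - peval (zcomp n g) y / peval q y * sval y i.
  move=> Vy; have [V0y qy] := Vy.
  have pE : p i = zcomp n g * 'X_i + \sum_(l < size a) pihomog mdeg n.+1 (c l * w l i).
    rewrite -[LHS](pihomog_dE (hp i)) gc raddfD /=; congr (_ + _).
      by apply: (@zcompM K n%:Z n.+1 1 _ _ _ (homogX K i)); lia.
    by rewrite raddf_sum.
  rewrite (bE i y V0y qy) pE pevalD peval_sum pevalM pevalX; transitivity
    ((\sum_(l < size a) peval (pihomog mdeg n.+1 (c l * w l i)) y) / peval q y).
    rewrite mulr_suml; apply: eq_bigr => l _; rewrite sE //.
    have [D' D'E hD] := hw i (ltn_ord l).
    rewrite (@zcompM K (n%:Z + nth 0 a l) _ D') //; last by lia.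
    by rewrite pevalM; ring.
  by field.
by apply: eq_der => y i l Vy; rewrite !key //; ring.
Qed.

Lemma tangent_mor_ker a' r (psi : mor (lines K a') (lines K a)) :
  graded_matrix a' a r -> given_by r psi ->
  (forall f : nat -> S,
    (exists g, forall l, \sum_(j < size a) f j * w j l = g * 'X_l) ->
    exists g : nat -> S, forall j, (j < size a)%N ->
      f j = \sum_(i < size a') g i * r i j) ->
  forall U (s : lines K a U), app phi s = 0 -> in_image psi s.
Proof.
move=> hr psiE sol U s /tangent_mor_eq0 s0; apply: (local_image hr psiE).
move=> p q x Ux qx pq; apply: sol; apply: euler_parallel => i k.
apply: subr0_eq.
apply: (open_dense Ux (peval_neq0 qx)) => y Uy qy.
have e l : peval (\sum_(j < size a) p j * w j l) y = peval q y * line_field s w l y.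
  rewrite peval_sum mulr_sumr; apply: eq_bigr => j _; rewrite pevalM.
  by rewrite (pq j (ltn_ord j) y Uy qy); field.
by rewrite pevalB !pevalM !pevalX !e -!mulrA s0 // subrr.
Qed.

Lemma tangent_mor_comp a' r (psi : mor (lines K a') (lines K a)) : given_by r psi ->
  (forall i, exists g, forall l, \sum_(j < size a) r i j * w j l = g * 'X_l) ->
  forall U (s : lines K a' U), app phi (app psi s) = 0.
Proof.
move=> psiE /choice [g gE] U s; apply/tangent_mor_eq0 => x i k Ux.
have e l : line_field (app psi s) w l x =
    (\sum_(i < size a') line_val s i x * peval (g i) x) * sval x l.
  rewrite /line_field (eq_bigr (fun j : 'I_(size a) =>
    \sum_(i < size a') line_val s i x * peval (r i j * w j l) x)); last first.
    move=> j _; rewrite psiE // mulr_suml; apply: eq_bigr => i' _.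
    by rewrite pevalM mulrA.
  rewrite exchange_big mulr_suml; apply: eq_bigr => i' _.
  by rewrite -mulr_sumr -peval_sum gE pevalM pevalX mulrA.
by rewrite !e; ring.
Qed.

End Fields.

(** A field of degree e is paired with sections of O(1 - e) to reach degree 1; thus v contributes
    the summand O, and each other generator O(1 - e). *)
Lemma tangent_free_resolution e n m k : euler_resolution A e n m k ->
  free_resolution [:: 0 :: nseq n (1 - e%:Z); nseq m (- e%:Z); nseq k (- e%:Z - 1)] TF.
Proof.
move=> R; set E0 := 0 :: _; set E1 := nseq m _; set E2 := nseq k _.
have s0 : size E0 = n.+1 by rewrite /= size_nseq.
have s1 : size E1 = m by rewrite size_nseq.
have s2 : size E2 = k by rewrite size_nseq.
have hw : graded_fields E0 (er_field R).
  move=> [|i] l; rewrite s0 ltnS => im; first by exists 1%N => //; exact: er_field0_homog.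
  by exists e; [rewrite /= nth_nseq im subrK|exact: er_fieldS_homog].
have hr : graded_matrix E1 E0 (er_rel R).
  move=> i [|j]; rewrite s0 s1 ltnS => im jn; rewrite /= !nth_nseq im.
    by exists e; [rewrite addNr|exact: er_rel0_homog].
  by exists 1%N; [rewrite jn addrC|exact: er_relS_homog].
have hs : graded_matrix E2 E1 (er_syz R).
  move=> l i; rewrite s1 s2 => lk im; rewrite /= !nth_nseq lk im.
  by exists 1%N; [rewrite subrK|exact: er_syz_homog].
have [phi phiE] := exists_tangent_mor hw (fun j _ => er_dot R j).
have [b bE] := exists_matrix_mor hr; have [c cE] := exists_matrix_mor hs.
apply: (@free_resolution3 K TF E0 E1 E2 phi b c).
- by apply: (tangent_mor_onto phiE); rewrite s0; exact: er_fieldP.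
- by apply: (tangent_mor_comp phiE bE); rewrite s0; exact: er_rel_field.
- by apply: (tangent_mor_ker phiE hr bE); rewrite s0 s1; exact: er_relP.
- by apply: (matrix_comp_eq0 cE bE); rewrite s0 s1 => i l _; exact: er_syz_rel.
- by apply: (matrix_exact hs cE bE); rewrite s0 s1 s2; exact: er_syzP.
- by apply: (matrix_injective cE); rewrite s1 s2; exact: er_syz_inj.
Qed.

Lemma tangent_split e : euler_resolution A e 1 0 0 ->
  isomorphic TF (dsum (lineb K 0) (lineb K (1 - e%:Z))).
Proof.
move=> R; set E0 := [:: 0; 1 - e%:Z].
have hw : graded_fields E0 (er_field R).
  move=> [|[|i]] l // _; first by exists 1%N => //; exact: er_field0_homog.
  by exists e; [rewrite subrK|exact: er_fieldS_homog].
have [phi phiE] := exists_tangent_mor hw (fun j _ => er_dot R j).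
have hr : graded_matrix [::] E0 (er_rel R) by [].
have [b bE] := exists_matrix_mor hr.
apply: (@isomorphic_lines2 K TF 0 (1 - e%:Z) phi); last first.
  by apply: (tangent_mor_onto phiE); exact: er_fieldP.
move=> U s t st; apply: subr0_eq.
have : app phi (s - t) = 0 by rewrite app_add app_opp st subrr.
move/(tangent_mor_ker phiE hr bE (@er_relP _ _ _ _ _ _ R)) => im.
apply: sheaf_sep => x /im [V [VU [Vx [u uE]]]]; exists V, VU; split=> //.
by rewrite res0 -uE (zero_sheaf_eq u 0) app_zero.
Qed.

End TangentResolution.

Lemma dhomog1_lf (K : fieldType) (p : {mpoly K[4]}) : p \is 1.-homog ->
  p = lf (\row_j p@_U_(j)).
Proof.
move=> hp; apply/mpolyP => m; have [|m1] := boolP (mdeg m == 1%N).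
  by rewrite mdeg_eq1 => /existsP [i /eqP ->]; rewrite mcoeff_lf mxE.
by rewrite (dhomog_nemf_coeff hp m1) (dhomog_nemf_coeff (lf_dhomog _) m1).
Qed.

(** * Global sections and the conclusion *)

Section GlobalFields.
Variable K : closedFieldType.
Local Notation S := {mpoly K[4]}.
Local Notation T := (tangent_sheaf K).
Local Notation chart := (@chart K).
Implicit Types (x y : point K) (U V W : opens K) (b : 'I_4 -> point K -> K).

(* Differentiate the third hypothesis with respect to x_k, and sum over k. *)
Lemma koszul_divergence (C : 'I_4 -> 'I_4 -> S) i j :
  (forall i j, C i j \is 2.-homog) -> (forall i j, C j i = - C i j) ->
  (forall i j k, 'X_k * C i j = 'X_j * C i k - 'X_i * C j k) ->
  C i j *+ 4 = 'X_j * (\sum_k (C i k)^`M(k)) - 'X_i * (\sum_k (C j k)^`M(k)).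
Proof.
move=> hC antiC relC.
have dX k l : ('X_l : S)^`M(k) = (k == l)%:R.
  rewrite mderivX mnm1E eq_sym; case: eqP => [->|_]; last by rewrite scale0r.
  have -> : (U_(l) - U_(l))%MM = 0%MM by apply/mnmP => i'; rewrite mnmBE mnm0E subnn.
  by rewrite mpolyX0 scale1r.
have e : \sum_k ('X_k * C i j)^`M(k) = \sum_k ('X_j * C i k - 'X_i * C j k)^`M(k).
  by apply: eq_bigr => k _; rewrite relC.
have delta (l : 'I_4) (G : 'I_4 -> S) : \sum_k (k == l)%:R * G k = G l.
  by rewrite (bigD1 l) //= eqxx mul1r big1 ?addr0 // => k /negPf ->; rewrite mul0r.
have eL : \sum_k ('X_k * C i j)^`M(k) = C i j *+ 6.
  rewrite (eq_bigr (fun k => C i j + 'X_k * (C i j)^`M(k))) => [|k _]; last first.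
    by rewrite mderivM dX eqxx mul1r.
  by rewrite big_split /= (mpoly_euler (hC i j)) sumr_const card_ord -mulrnDr.
have eR l l' : \sum_k ('X_l * C l' k)^`M(k) = C l' l + 'X_l * (\sum_k (C l' k)^`M(k)).
  rewrite mulr_sumr -[in X in X + _](delta l) -big_split.
  by apply: eq_bigr => k _; rewrite mderivM dX.
move: e; rewrite eL (eq_bigr (fun k => ('X_j * C i k)^`M(k) - ('X_i * C j k)^`M(k))).
  rewrite sumrB !eR (antiC i j) => e; apply: subr0_eq.
  transitivity (C i j *+ 6 - (C i j + 'X_j * (\sum_k (C i k)^`M(k)) -
    (- C i j + 'X_i * (\sum_k (C j k)^`M(k))))); first by ring.
  by rewrite e subrr.
by move=> k _; rewrite mderivB.
Qed.

Lemma linear_field_is_field (M : 'M[K]_4) U :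
  is_field U (fun i x => peval (linear_field M i) x).
Proof. by move=> i; apply: (@locfrac_poly _ 1); exact: lf_dhomog. Qed.

Arguments linear_field_is_field M U i : clear implicits.

(** The bivector formed by x and a lift of [D] does not depend on the lift, so its coefficients glue
    to global sections of O(2), which are polynomials. [koszul_divergence] recovers from them a
    linear field, up to the factor 4. *)
Lemma global_tangent (D : T (P3 K)) : (4%:R : K) != 0 ->
  exists M : 'M[K]_4, D = der (linear_field_is_field M (P3 K)).
Proof.
move=> K4.
have CP j : sub_opens (chart j) (P3 K) by [].
pose b j : 'I_4 -> point K -> K := chart_comp (@subO_refl K (chart j)) (res (CP j) D).
have hb j : is_field (chart j) (b j) := chart_comp_field (@subO_refl K (chart j)) _.
have bE j : res (CP j) D = der (hb j).
  by rewrite [LHS](tangent_der (@subO_refl K (chart j))); apply: eq_der.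
pose c j i k x := b j i x * sval x k - b j k x * sval x i.
have c_indep j l i k x : chart j x -> chart l x -> c j i k x = c l i k x.
  move=> jx lx; pose W := capO (chart j) (chart l).
  have Wj : sub_opens W (chart j) := @capO_subl K _ _.
  have Wl : sub_opens W (chart l) := @capO_subr K _ _.
  have : der (is_fieldB (is_field_sub Wj (hb j)) (is_field_sub Wl (hb l))) = 0.
    rewrite derB -(der_res Wj (hb j)) -(der_res Wl (hb l)) -!bE.
    by rewrite !(res_comp _ _ (fun x (_ : W x) => I : P3 K x)) subrr.
  move/der_eq0/(_ x i k (conj jx lx)) => e; apply: subr0_eq.
  transitivity ((b j i x - b l i x) * sval x k - (b j k x - b l k x) * sval x i).
    by rewrite /c; ring.
  by rewrite e subrr.
pose c0 i k x := c (sval (cid (exists_chart x))) i k x.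
have c0E j i k x : chart j x -> c0 i k x = c j i k x.
  by move=> jx; apply: c_indep => //; exact: svalP (cid (exists_chart x)).
have hx (j : 'I_4) U : locfrac 1 U (fun x => sval x j).
  apply: (@eq_locfrac _ _ _ (peval 'X_j)); first by move=> x _; rewrite pevalX.
  by apply: (@locfrac_poly _ 1); exact: homogX.
have hc0 i k : locfrac 2 (P3 K) (c0 i k).
  apply: locfrac_local => x _; have [j jx] := exists_chart x; exists (chart j); split=> //.
  apply: (@eq_locfrac _ _ _ (c j i k)); first by move=> y [_ jy]; rewrite (c0E j).
  have h l m : locfrac 2 (capO (P3 K) (chart j)) (fun x => b j l x * sval x m).
    apply: (@locfracM _ 1 1) => //.
    by apply: locfrac_sub (hb j l); exact: capO_subr.
  exact: locfracB.
have /choice [C CP'] (ik : 'I_4 * 'I_4) : exists p : S, p \is 2.-homog /\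
    forall x, c0 ik.1 ik.2 x = peval p x.
  have [p [hp pE]] := global_poly (hc0 ik.1 ik.2); exists p; split=> //.
  by case: hp => [->|[n [<-]]//]; exact: dhomog0.
have CE i k x : peval (C (i, k)) x = c0 i k x by have [_ ->] := CP' (i, k).
pose B i : S := \sum_k (C (i, k))^`M(k).
have BE i k : C (i, k) *+ 4 = 'X_k * B i - 'X_i * B k.
  apply: (koszul_divergence (C := fun i k => C (i, k))) => {i k} i k.
  - by have [] := CP' (i, k).
  - apply/eqP; rewrite -addr_eq0; apply/eqP; apply: peval_eq0 => x.
    by rewrite pevalD !CE /c0 /c; ring.
  move=> l; apply: subr0_eq; apply: peval_eq0 => x.
  by rewrite !pevalB !pevalM !pevalX !CE /c0 /c; ring.
have hB i : 4%:R^-1 *: B i \is 1.-homog.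
  apply: rpredZ; apply: rpred_sum => k _.
  by apply: (@dhomog_mderiv _ _ _ 2); have [] := CP' (i, k).
exists (\matrix_(i, j) (4%:R^-1 *: B i)@_U_(j)).
set M := \matrix_(i, j) _.
have ME i : linear_field M i = 4%:R^-1 *: B i.
  rewrite [RHS](dhomog1_lf (hB i)); congr lf.
  by apply/rowP => j; rewrite !mxE.
apply: sheaf_sep => x _; have [j jx] := exists_chart x.
exists (chart j), (CP j); split=> //; rewrite bE.
rewrite (der_res _ _ (linear_field_is_field M (chart j))).
apply: eq_der => y i k jy; rewrite !ME -/(c j i k y) -(c0E j) // -CE.
apply: (mulfI K4).
transitivity (peval (C (i, k) *+ 4) y).
  by rewrite /peval raddfMn /= mulr_natl.
rewrite BE pevalB !pevalM !pevalX -!mul_mpolyC !pevalM !pevalC.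
by field.
Qed.

End GlobalFields.

Arguments linear_field_is_field {K} M U i.

Lemma mxrank_le1 (K : fieldType) m n (M : 'M[K]_(m, n)) : (\rank M <= 1)%N ->
  exists (c : 'cV_m) (r : 'rV_n), M = c *m r.
Proof.
rewrite leq_eqVlt ltnS leqn0 => /orP[/eqP e|]; last first.
  by rewrite mxrank_eq0 => /eqP ->; exists 0, 0; rewrite mul0mx.
move: (col_base M) (row_base M) (mulmx_base M); rewrite e => c r <-.
by exists c, r.
Qed.

Section GlobalSections.
Variable K : closedFieldType.
Implicit Types (F : sheaf K) (x y : point K) (U V W : opens K).

Lemma global_section F k : k = 0 -> has_sections (twist F k) -> exists v : F (P3 K), v != 0.
Proof.
move=> k0; have {k0} : - k = 0 by rewrite k0 oppr0.
rewrite /has_sections /twist; move: (- k) => l -> [s s0].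
exists (s (P3 K) (@subO_refl K _) (regfunC (P3 K) 1)); apply: contra s0 => /eqP s1.
apply/eqP; apply: op_ext => V VU f; rewrite op_zeroE.
have -> : f = (f : regfun V) *: (res VU (regfunC (P3 K) 1 : lineb K 0 (P3 K))).
  by apply: twfun_ext => x /=; rewrite mulr1.
rewrite (hom_scale s) -(op_res s (@subO_refl K _) VU VU) s1 res0; exact: scaler0.
Qed.

Lemma has_sections_line F k l (m : mor (lines K [:: l]) F) : - k = l ->
  (exists U s, app m (s : lines K [:: l] U) != 0) -> has_sections (twist F k).
Proof.
rewrite /has_sections /twist => -> [U [s ms]].
pose j V (t : lineb K l V) : lines K [:: l] V := (t, 0).
have jD V (t u : lineb K l V) : j V (t + u) = j V t + j V u.
  by congr (_, _); exact: zero_sheaf_eq.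
have jZ V f (t : lineb K l V) : j V (f *: t) = f *: j V t.
  by congr (_, _); exact: zero_sheaf_eq.
have jres V W (WV : sub_opens W V) (t : lineb K l V) : res WV (j V t) = j W (res WV t) by [].
pose n : mor (lineb K l) F := comp_mor m (@mk_mor K (lineb K l) _ j jD jZ jres).
exists n; apply: contra ms => /eqP n0.
have -> : s = j U s.1 by case: s => t u; congr (_, _); exact: zero_sheaf_eq.
by rewrite -[app m _]/(app n s.1) n0.
Qed.

End GlobalSections.

Section FirstTwist.
Variables (K : closedFieldType) (d : nat) (F : distribution K d).
Local Notation S := {mpoly K[4]}.
Local Notation TF := (dist_tangent F).
Local Notation incl := (dist_incl F).
Local Notation pr := (dist_proj F).
Hypothesis K4 : (4%:R : K) != 0.
Hypothesis t_F : is_first_twist TF 1.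
Variable A : 'I_4 -> S.
Hypothesis A_homog : forall i, A i \is d.+1.-homog.
Hypothesis A_euler : dot A (euler_field K) = 0.
Hypothesis A_contraction : forall U b (hb : is_field U b) y, U y ->
  contraction F (der hb) y = \sum_i peval (A i) y * b i y.

(** A constant field killed by [A] is a morphism O(1) -> T_F, that is, a section of T_F(-1), so it
    induces the zero derivation. Being proportional to x, it is 0. *)
Lemma no_constant_field (w : 'I_4 -> S) : (forall i, w i \is 0.-homog) ->
  dot A w = 0 -> forall i, w i = 0.
Proof.
move=> hw0 Aw i0; apply: contrapT => /eqP wi0.
have hw : graded_fields [:: 1] (fun=> w) by move=> [|[]] //= l _; exists 0%N.
have [phi phiE] := exists_tangent_mor A_contraction hw (fun _ _ => Aw).
suff /(t_F.2 0) : has_sections (twist TF (0 - 1)) by [].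
apply: (has_sections_line (m := phi)) => //.
have [j ji0] : exists j : 'I_4, j != i0.
  by case: (eqVneq o0 i0) => [<-|]; [exists o1|exists o0].
pose s : lines K [:: 1] (P3 K) := ((mkfun (@locfrac_poly K 1 (P3 K) _ (homogX K j)) : lineb K 1 (P3 K)), 0).
exists (P3 K), s; apply/eqP => /(tangent_mor_eq0 phiE) h.
have e : w i0 * 'X_j * 'X_j = w j * 'X_i0 * 'X_j.
  apply: subr0_eq; apply: peval_eq0 => x.
  have := h x i0 j I; rewrite /line_field !big_ord_recl !big_ord0 !addr0.
  have -> : line_val s 0 x = peval 'X_j x by exact: tv_mkfun.
  rewrite pevalB !pevalM !pevalX => e; apply/eqP; rewrite subr_eq0; apply/eqP.
  by transitivity (sval x j * peval (w i0) x * sval x j); [ring|rewrite e; ring].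
move: wi0 (mulIf (mpolyXU_neq0 K j) e); rewrite (dhomog0_const (hw0 i0)) (dhomog0_const (hw0 j)) => /eqP wi0.
move/(congr1 (mcoeff U_(j)%MM)); rewrite !mcoeffCM !mcoeffXU eqxx mulr1.
by rewrite eq_sym (negPf ji0) mulr0 => w0; apply: wi0; rewrite w0 mpolyC0.
Qed.

Lemma exists_linear_field : exists M : 'M[K]_4, dot A (linear_field M) = 0 /\
  forall a : K, (1 < \rank (M - a%:M)%R)%N.
Proof.
have [v v0] := global_section (subrr 1) t_F.1.
have [M ME] := global_tangent (app incl v) K4.
have AM : dot A (linear_field M) = 0.
  have /proj_eq0 h : app pr (app incl v) = 0 by apply: exact_comp0; exact: dist_exact.
  apply: peval_eq0 => x; rewrite -(h x I) ME A_contraction //.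
  by rewrite /dot peval_sum; apply: eq_bigr => i _; rewrite pevalM.
(* If M - a = c r has rank at most 1, the field is a x + r(x) c with c constant. Since [A] kills x,
   it kills c unless r = 0; in both cases the derivation is zero, against the choice of v. *)
exists M; split=> // a; rewrite ltnNge; apply/negP => /mxrank_le1 [c [r Mcr]].
have e i : linear_field M i = a *: 'X_i + c i 0 *: lf r.
  rewrite /linear_field -[M](subrK a%:M) Mcr -lf_delta -!linearZ -raddfD /=; congr lf.
  apply/rowP => j; rewrite !mxE big_ord1 eqxx /= addrC; congr (_ + _).
  by rewrite eq_sym mulr_natr.
have Ac : lf r * dot A (fun i => (c i 0)%:MP) = 0.
  rewrite -AM /dot mulr_sumr -[LHS]addr0 -[X in _ + X](mulr0 a%:MP).
  rewrite -[X in _ * X]A_euler /dot mulr_sumr -big_split.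
  by apply: eq_bigr => i _; rewrite e -!mul_mpolyC /euler_field /=; ring.
have cr0 i : c i 0 *: lf r = 0.
  move/eqP: Ac; rewrite mulf_eq0 => /orP[/eqP ->|/eqP Ac]; first by rewrite scaler0.
  have hc k : ((c k 0)%:MP : S) \is 0.-homog for mdeg.
    by rewrite -[_%:MP]mulr1 mul_mpolyC dhomogZ // dhomog1.
  by have := no_constant_field hc Ac i; rewrite -mul_mpolyC => ->; rewrite mul0r.
case/negP: v0; apply/eqP; apply: (app_inj_eq0 (incl_inj (F := F))); rewrite ME.
apply/(der_eq0 (linear_field_is_field M (P3 K))) => x i j _.
by rewrite !e !cr0 !addr0 -!mul_mpolyC !pevalM !pevalC !pevalX; ring.
Qed.

Section Resolution.
Variables (e n m k : nat) (R : euler_resolution A e n m k).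

Lemma constant_fields_eq0 j i : e = 0%N -> er_field R j.+1 i = 0.
Proof.
move=> e0; apply: (no_constant_field (w := er_field R j.+1)) (er_dot R _) i => l.
by move: (er_fieldS_homog R j l); move: (er_field R j.+1 l); rewrite e0.
Qed.

(** For e = 0 the generator j + 1 vanishes, so the corresponding unit vector is a relation, hence a
    combination of the rows of [er_rel]. *)
Lemma constant_fields_rel j : e = 0%N -> (j < n)%N -> exists g : nat -> S,
  forall l, (l < n.+1)%N -> (l == j.+1)%:R = \sum_(i < m) g i * er_rel R i l.
Proof.
move=> e0 jn; apply: (@er_relP _ _ _ _ _ _ R); exists 0 => l; rewrite mul0r big1 // => i _.
case: eqP => [->|_]; last by rewrite mul0r.
by rewrite constant_fields_eq0 // mulr0.
Qed.

End Resolution.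

Lemma split_degree e : euler_resolution A e 1 0 0 -> (0 < e)%N.
Proof.
move=> R; rewrite lt0n; apply/eqP => e0.
have [g /(_ 1%N isT)] := constant_fields_rel R e0 (isT : (0 < 1)%N).
by rewrite big_ord0 => /eqP; rewrite oner_eq0.
Qed.

(** For e = 0, two distinct unit vectors would be multiples of the single row of relations. *)
Lemma line_degree e : euler_resolution A e 2 1 0 -> (0 < e)%N.
Proof.
move=> R; rewrite lt0n; apply/eqP => e0.
have [g gE] := constant_fields_rel R e0 (isT : (0 < 2)%N).
have [h hE] := constant_fields_rel R e0 (isT : (1 < 2)%N).
have := gE 2%N isT; have := gE 1%N isT; have := hE 2%N isT; rewrite !big_ord1 /=.
move=> h2 g1 /esym/eqP; rewrite mulf_eq0 => /orP[/eqP g0|/eqP r0].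
  by move/eqP: g1; rewrite g0 mul0r oner_eq0.
by move/eqP: h2; rewrite r0 mulr0 oner_eq0.
Qed.

End FirstTwist.

(** An equality modulo ['X^n] becomes a polynomial identity, provable by [ring], once the quotient
    [r] is supplied. *)
Lemma take_poly_eqXn (R : nzRingType) n (p q r : {poly R}) :
  p = q + r * 'X^n -> take_poly n p = take_poly n q.
Proof. by move=> ->; rewrite take_polyD take_polyMXn_0 addr0. Qed.

Lemma chern_classes_line (K : closedFieldType) (F : sheaf K) (d : nat) :
  free_resolution [:: 0 :: nseq 2 (1 - d%:Z); nseq 1 (- d%:Z); nseq 0 (- d%:Z - 1)] F ->
  has_chern_classes F (2 - d%:Z) 1 d%:Z.
Proof.
move=> res; eexists; first exact: res.
rewrite big_mkcond [X in _ = take_poly _ X]big_mkcond /= !big_ord_recl !big_ord0 /=.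
rewrite /chern_poly !big_cons !big_nil.
apply: (@take_poly_eqXn _ _ _ _ (- (d%:Z ^+ 2)%:P)).
rewrite -!mul_polyC !polyCB !polyCN polyC1 polyC0; ring.
Qed.

Lemma chern_classes_two_lines (K : closedFieldType) (F : sheaf K) (d : nat) :
  free_resolution [:: 0 :: nseq 4 (1 - d.+1%:Z); nseq 4 (- d.+1%:Z);
    nseq 1 (- d.+1%:Z - 1)] F ->
  has_chern_classes F (2 - d%:Z) 2 (2 * d%:Z).
Proof.
have -> : 1 - d.+1%:Z = - d%:Z by lia.
have -> : - d.+1%:Z = - d%:Z - 1 by lia.
move=> res; eexists; first exact: res.
rewrite big_mkcond [X in _ = take_poly _ X]big_mkcond /= !big_ord_recl !big_ord0 /=.
rewrite /chern_poly !big_cons !big_nil.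
pose D : {poly int} := (d%:Z)%:P; pose X : {poly int} := 'X.
apply: (@take_poly_eqXn _ _ _ _ (5 - 2 * D ^+ 2
  + (8 * D ^+ 2 + 6 * D ^+ 3 - 5 * D - 6) * X
  + (2 - 12 * D ^+ 2 - 16 * D ^+ 3 - 6 * D ^+ 4) * X ^+ 2
  + (2 * D + 8 * D ^+ 2 + 12 * D ^+ 3 + 8 * D ^+ 4 + 2 * D ^+ 5) * X ^+ 3)).
rewrite -!mul_polyC !polyCB !polyCN polyC1 polyC0 polyCM; rewrite /D /X; ring.
Qed.

Theorem first_twist_classification (K : closedFieldType) (d : nat)
    (F : distribution K d) : (4%:R : K) != 0 -> is_first_twist (dist_tangent F) 1 ->
  [\/ isomorphic (dist_tangent F)
        (dsum (lineb K 0) (lineb K (2 - d%:Z))) /\ (2 <= d)%N,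
      has_chern_classes (dist_tangent F) (2 - d%:Z) 1 d%:Z /\ (1 <= d)%N
    | has_chern_classes (dist_tangent F) (2 - d%:Z) 2 (2 * d%:Z) /\ (0 <= d)%N].
Proof.
move=> K4 t_F; have [A [A_homog A_euler A_contr]] := exists_form F.
have [M [AM M_rank]] := exists_linear_field K4 t_F A_euler A_contr.
have A_n0 := form_neq0 A_contr.
have A_prim := form_primitive A_homog A_contr.
have [e] := euler_resolution_cases M_rank A_euler AM A_n0 A_prim A_homog.
(* The cases are J = (1), then a line, then two skew lines or a double line. *)
case=> -[[R] de]; [apply: Or31|apply: Or32|apply: Or33].
- have e0 := split_degree t_F A_contr R; split; last by rewrite de.
  have -> : 2 - d%:Z = 1 - e%:Z by lia.
  exact: (tangent_split A_contr R).
- have e0 := line_degree t_F A_contr R; split; last by rewrite de.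
  have res := tangent_free_resolution A_contr R; apply: chern_classes_line.
  by move: res; rewrite -[in X in X -> _]de.
- split=> //; apply: chern_classes_two_lines.
  by have := tangent_free_resolution A_contr R; rewrite -[in X in X -> _]de.
Qed.

Theorem proposition3p8 (R : realType) (d : nat) (F : distribution R[i] d)
    (t_F : is_first_twist (dist_tangent F) 1) :
  [\/ isomorphic (dist_tangent F)
        (dsum (lineb R[i] 0) (lineb R[i] (2 - d%:Z))) /\ (2 <= d)%N,
      has_chern_classes (dist_tangent F) (2 - d%:Z) 1 d%:Z /\ (1 <= d)%N
    | has_chern_classes (dist_tangent F) (2 - d%:Z) 2 (2 * d%:Z) /\ (0 <= d)%N].
Proof.
apply: first_twist_classification t_F.
by rewrite Num.Theory.pnatr_eq0.
Qed.
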